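(* Let $(S,\alpha)$ be a flat surface of finite area such that the union of the cross cuts of its horizontal foliation has $\omega_\alpha$-measure zero. Suppose that the Teichm\''uller orbit $\{g_t\cdot(S,\alpha)\}_{t\ge 0}$ does not leave every compact set of $SL(2,\mathbb{R})/SL(S,\alpha)$, i.e. there are a compact set $K\subset SL(2,\mathbb{R})/SL(S,\alpha)$ and times $t_n\to+\infty$ such that the class of $g_{t_n}$ lies in $K$ for all $n$. Then the translation flow on $(S,\alpha)$ (the flow in the horizontal direction) is ergodic with respect to the Lebesgue measure $\omega_\alpha$.
   Context: A flat (translation) surface $(S,\alpha)$ is a connected Riemann surface $S$ without boundary (possibly non-compact, possibly of infinite genus) with a nonzero holomorphic 1-form (Abelian differential) $\alpha$; the flat metric is $|\alpha|$, and the area form is $\omega_\alpha=\Re(\alpha)\wedge\Im(\alpha)$. Finite area means $\omega_\alpha(S)<\infty$. $\bar S$ is the metric completion of $S$, and $\Sigma\subset\bar S$ is the set of singularities: the zeros of $\alpha$ in $S$ together with the ideal boundary points $\bar S\setminus S$ (which may include infinite-angle singularities). On $S\setminus\Sigma$, $X$ and $Y$ are the unit vector fields with $\Re\alpha(X)=1,\ \Im\alpha(X)=0$, $\Re\alpha(Y)=0,\ \Im\alpha(Y)=1$. The horizontal foliation is $\ker\Im(\alpha)$; the translation flow is the (almost everywhere defined) flow generated by $X$, which preserves $\omega_\alpha$. Ergodic means that every flow-invariant measurable set has zero or full $\omega_\alpha$-measure. A cross cut is a trajectory that leaves every compact subset of $S$ in both directions (a trajectory from the ideal boundary to itself). $SL(2,\mathbb{R})$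 acts on flat surfaces by post-composing the translation charts with the linear action on $\mathbb{R}^2$. $SL(S,\alpha)$ is the Veech group of $(S,\alpha)$: the stabilizer of $(S,\alpha)$ for this action (taken up to $\pm\mathrm{Id}$), equivalently the group of derivatives of affine diffeomorphisms of $(S,\alpha)$. The orbit point $A\cdot(S,\alpha)$ is identified with the class of $A$ in $SL(2,\mathbb{R})/SL(S,\alpha)$. Teichm\''uller deformation is the action of $g_t=\begin{pmatrix}e^{-t}&0\\0&e^{t}\end{pmatrix}$, so $g_t\cdot(S,\alpha)=(S,\alpha_t)$ with $\alpha_t=e^{-t}\Re(\alpha)+ie^{t}\Im(\alpha)$. *)

(* Defs.v *)
From HB Require Import structures.
From mathcomp Require Import all_boot all_order all_algebra.
From mathcomp Require Import generic_quotient complex.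
From mathcomp Require Import all_classical all_reals all_analysis.

Set Implicit Arguments.
Unset Strict Implicit.
Unset Printing Implicit Defensive.

Import Order.TTheory GRing.Theory Num.Theory.
Import numFieldNormedType.Exports.

Local Open Scope classical_set_scope.
Local Open Scope ring_scope.
Local Open Scope complex_scope.

(* [R[i]] packaged as a [numClosedFieldType]: this is what equips it with its
   topology and with complex differentiability ([derivable], [derive1] over
   the scalar field [Cplx R]). *)
Definition Cplx (R : realType) : numClosedFieldType := R[i].

(* A homeomorphism from an open subset of [S] onto an open subset of the
   complex plane.  Both [chart_map] and [chart_inv] are total functions; their
   values outside [chart_dom] and its image are irrelevant. *)
Record complex_chart (R : realType) (S : ptopologicalType) := ComplexChart {
  chart_dom : set S ;
  chart_map : S -> Cplx R ;
  chart_inv : Cplx R -> S ;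
  chart_dom_open : open chart_dom ;
  chart_img_open : open (chart_map @` chart_dom) ;
  chart_mapK : forall p, chart_dom p -> chart_inv (chart_map p) = p ;
  chart_map_cont : forall p, chart_dom p -> {for p, continuous chart_map} ;
  chart_inv_cont : forall z, (chart_map @` chart_dom) z ->
    {for z, continuous chart_inv} }.

(* Surfaces are Hausdorff and second countable (for Riemann surfaces the
   latter is automatic, by Rado's theorem).  The atlas is an arbitrary
   holomorphic atlas, not necessarily a maximal one. *)
Record riemann_surface (R : realType) (S : ptopologicalType) :=
  RiemannSurface {
  atlas_index : Type ;
  atlas : atlas_index -> complex_chart R S ;
  surface_hausdorff : hausdorff_space S ;
  surface_second_countable : @second_countable S ;
  surface_connected : connected [set: S] ;
  atlas_cover : forall p, exists i, chart_dom (atlas i) p ;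
  atlas_holomorphic : forall i j p,
    chart_dom (atlas i) p -> chart_dom (atlas j) p ->
    derivable (chart_map (atlas j) \o chart_inv (atlas i))
              (chart_map (atlas i) p) 1 }.

Definition borel (S : ptopologicalType) := g_sigma_algebraType (@open S).

Section forms.
Context {R : realType} {S : ptopologicalType} (X : riemann_surface R S).
Implicit Types (i j : atlas_index X) (p : S).

Definition in_chart i p := chart_dom (atlas i) p.
Definition local_coord i (p : S) : Cplx R := chart_map (atlas i) p.
Definition local_inv i (z : Cplx R) : S := chart_inv (atlas i) z.

(* In the local coordinate [z] of the chart [i] the form is [coef i z dz]. *)
Record abelian_differential := AbelianDifferential {
  coef : atlas_index X -> Cplx R -> Cplx R ;
  coef_holomorphic : forall i p, in_chart i p ->
    derivable (coef i) (local_coord i p) 1 ;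
  coef_transition : forall i j p, in_chart i p -> in_chart j p ->
    coef i (local_coord i p) =
    coef j (local_coord j p) *
      derive1 (local_coord j \o local_inv i) (local_coord i p) }.

End forms.

Section flat_surface.
Context {R : realType} {S : ptopologicalType} {X : riemann_surface R S}.
Variable a : abelian_differential X.
Implicit Types (i : atlas_index X) (p q : S).

Definition zeros : set S :=
  [set p | exists i, in_chart i p /\ coef a i (local_coord i p) = 0].

Definition nonzero_form : Prop := exists p, ~ zeros p.

(* [Re a /\ Im a], which is [|f|^2 dx /\ dy] wherever [a = f dz] with
   [z = x + i y].  A Borel measure on [S] is determined by this property. *)
Definition is_area_measure (mu : set S -> \bar R) : Prop :=
  forall i (A : set S), measurable (A : set (borel S)) -> A `<=` in_chart i ->
    mu A = (\int[(@lebesgue_measure R \x @lebesgue_measure R)]_(x in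
               [set x : R * R | (local_coord i @` A) (x.1 +i* x.2)])
             ((Normc.normc (coef a i (x.1 +i* x.2)) ^+ 2)%:E))%E.

Definition oint (s t : \bar R) : set R := [set x | (s < x%:E < t)%E].

Definition velocity i (g : R -> S) (t : R) (v : Cplx R) : Prop :=
  ((h%:C : Cplx R)^-1 * (local_coord i (g (t + h)) - local_coord i (g t)))
    @[h --> (0 : R)^'] --> v.

(* Integral curves of the horizontal unit vector field, on the open interval
   from [s] to [t]: [Re a = 1] and [Im a = 0] on the velocity vector.  Such a
   curve cannot meet the zeros of [a]; its values outside the interval are
   irrelevant. *)
Definition trajectory (g : R -> S) (s t : \bar R) : Prop :=
  (s < t)%E /\
  forall x, oint s t x -> {for x, continuous g} /\
    forall i, in_chart i (g x) ->
      exists2 v, velocity i g x v & coef a i (local_coord i (g x)) * v = 1.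

Definition maximal_trajectory (g : R -> S) (s t : \bar R) : Prop :=
  trajectory g s t /\
  forall g' s' t', trajectory g' s' t' -> oint s t `<=` oint s' t' ->
    (forall x, oint s t x -> g' x = g x) -> s' = s /\ t' = t.

(* The graph of the (partially defined) time [x] map. *)
Definition translation_flow (x : R) (p q : S) : Prop :=
  exists g s t, [/\ trajectory g s t, oint s t 0, oint s t x, g 0 = p & g x = q].

Definition flow_invariant (A : set S) : Prop :=
  forall x p q, translation_flow x p q -> (A p <-> A q).

Definition flow_ergodic (mu : set S -> \bar R) : Prop :=
  forall A : set S, measurable (A : set (borel S)) -> flow_invariant A ->
    mu A = 0%E \/ mu (~` A) = 0%E.

Definition cross_cut (g : R -> S) (s t : \bar R) : Prop :=
  [/\ maximal_trajectory g s t,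
      forall K : set S, compact K ->
        exists2 x, oint s t x & forall y, oint s t y -> x < y -> ~ K (g y) &
      forall K : set S, compact K ->
        exists2 x, oint s t x & forall y, oint s t y -> y < x -> ~ K (g y)].

Definition cross_cuts : set S :=
  [set p | exists g s t, cross_cut g s t /\ (g @` oint s t) p].

Definition translation_chart (U : set S) (w : S -> Cplx R) : Prop :=
  [/\ open U,
      forall p q, U p -> U q -> w p = w q -> p = q &
      forall i p, U p -> in_chart i p ->
        is_derive (local_coord i p) 1 (w \o local_inv i)
                  (coef a i (local_coord i p))].

Definition plane_act (A : 'M[R]_2) (z : Cplx R) : Cplx R :=
  (A 0 0 * complex.Re z + A 0 1 * complex.Im z) +i*
  (A 1 0 * complex.Re z + A 1 1 * complex.Im z).

(* Homeomorphisms of [S] that permute the zeros and are affine with linear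
   part [A] in translation charts. *)
Definition affine_diffeo (A : 'M[R]_2) (f : S -> S) : Prop :=
  [/\ exists2 f', continuous f' & cancel f f' /\ cancel f' f,
      continuous f,
      forall p, zeros (f p) <-> zeros p &
      forall U w V w' p, translation_chart U w -> translation_chart V w' ->
        U p -> V (f p) ->
        \forall q \near p, w' (f q) - w' (f p) = plane_act A (w q - w p)].

(* The stabilizer of the flat surface up to sign: [A] acts on flat surfaces by
   post-composition with translation charts. *)
Definition veech_group : set 'M[R]_2 :=
  [set A | \det A = 1 /\
    exists f, affine_diffeo A f \/ affine_diffeo (- A) f].

End flat_surface.

Section cosets.
Variable R : realType.

Definition SL2 : set 'M[R]_2 := [set A | \det A = 1].

Definition left_coset (G : set 'M[R]_2) (A : SL2) : set 'M[R]_2 :=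
  [set \val A *m B | B in G].

Definition coset_rel (G : set 'M[R]_2) : rel SL2 :=
  fun A B => `[< left_coset G A = left_coset G B >].

Lemma coset_rel_equiv G : equiv_class_of (coset_rel G).
Proof.
split=> [A|A B|B A C]; first exact/asboolP.
  by apply: asbool_equiv_eq; split.
by move=> /asboolP AB /asboolP BC; apply/asboolP; rewrite AB.
Qed.

Canonical coset_equiv_rel (G : set 'M[R]_2) :=
  EquivRelPack (coset_rel_equiv G).

(* [SL(2,R) / G] with the quotient topology: when [G] is the Veech group, the
   class [A G] stands for the image of the flat surface under [A]. *)
Definition coset_space (G : set 'M[R]_2) : topologicalType :=
  quotient_topology {eq_quot (coset_equiv_rel G)}%qT.

Definition coset_class (G : set 'M[R]_2) (A : SL2) : coset_space G :=
  (\pi_(coset_space G) A)%qT.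

Definition teichmuller_mx (t : R) : 'M[R]_2 :=
  diag_mx (\row_j expR (if j == 0 then - t else t)).

Lemma det_teichmuller_mx t : SL2 (teichmuller_mx t).
Proof.
by rewrite /SL2 /= det_diag 2!big_ord_recl big_ord0 !mxE /= mulr1 -expRD
  addNr expR0.
Qed.

Definition teichmuller (t : R) : SL2 :=
  exist _ (teichmuller_mx t) (mem_set (det_teichmuller_mx t)).

End cosets.

Arguments SL2 : clear implicits.

(* Main.v *)
(* For [t = t_ n] write [g_t = B *m G] with [G] in the Veech group of [a] and [B]
   in a bounded set independent of [n].  The inverse [f] of an affine map with
   linear part [G] (up to sign) preserves the area and has linear part
   [g_t^-1 *m B] up to sign.  In the coordinate [B *m w] of a flat box [w] of
   size independent of [n], it expands the horizontal direction by [e^t] and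
   contracts the vertical one by [e^-t].

   Let [A] be flow invariant, and let [F1] and [F2] be compact subsets of [A] and
   of its complement, away from the zeros, with a complement of area at most
   [e].  In the box, [f^-1 A] depends only on the vertical coordinate.  For
   large [n] the vertical segments are mapped by [f] to segments too short to
   join [F1] to [F2]; hence each of them meets [f^-1 A] or [f^-1 (~` A)] only
   within the preimage of the complement of [F1 `|` F2], and by Fubini one of
   these two sets has area at most [e] in the box.

   So, along an ultrafilter, near every point off the zeros either the area of
   [f^-1 A] or that of its complement tends to 0.  This gives a partition of the
   complement of the zeros into two open sets, one of which is empty because
   removing the zeros does not disconnect the surface.  As [f] preserves the
   area, [A] or its complement is null. *)

Require Import Defs.
From HB Require Import structures.
From mathcomp Require Import all_boot all_order all_algebra.
From mathcomp Require Import generic_quotient complex ring lra.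
From mathcomp Require Import all_classical all_reals all_analysis measurable_realfun.

Set Implicit Arguments.
Unset Strict Implicit.
Unset Printing Implicit Defensive.

Import Order.TTheory GRing.Theory Num.Theory.
Import numFieldNormedType.Exports.

Local Open Scope classical_set_scope.
Local Open Scope ring_scope.
Local Open Scope complex_scope.

(** * Complex differentiability *)

Section cplx.
Variable R : realType.
Notation C := (Cplx R).
Implicit Types (z w : C) (f g : C -> C).

Definition nm (z : C) : R := Normc.normc (z : R[i]).
Local Arguments nm : simpl never.

Lemma nmE z : `|z| = (nm z)%:C. Proof. by []. Qed.

Lemma nm0 : nm 0 = 0. Proof. exact: Normc.normc0. Qed.
Lemma nm1 : nm 1 = 1. Proof. exact: Normc.normc1. Qed.
Lemma nm_ge0 z : 0 <= nm z.
Proof. by case: z => x y; rewrite /nm /= sqrtr_ge0. Qed.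
Lemma nmD z w : nm (z + w) <= nm z + nm w. Proof. exact: le_normcD. Qed.
Lemma nmN z : nm (- z) = nm z. Proof. exact: normcN. Qed.
Lemma nmB z w : nm (z - w) <= nm z + nm w.
Proof. by rewrite -(nmN w); exact: nmD. Qed.
Lemma nm_distC z w : nm (z - w) = nm (w - z).
Proof. by rewrite -nmN opprB. Qed.
Lemma nmM z w : nm (z * w) = nm z * nm w. Proof. exact: Normc.normcM. Qed.
Lemma nmV z : nm z^-1 = (nm z)^-1. Proof. exact: Normc.normcV. Qed.
Lemma nmX z n : nm (z ^+ n) = nm z ^+ n.
Proof. by elim: n => [|n IH]; rewrite ?expr0 ?nm1// !exprS nmM IH. Qed.
Lemma nm_eq0 z : (nm z == 0) = (z == 0).
Proof.
apply/eqP/eqP => [|->]; last exact: nm0.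
exact: Normc.eq0_normc.
Qed.
Lemma nm_gt0 z : (0 < nm z) = (z != 0).
Proof. by rewrite lt0r nm_ge0 andbT nm_eq0. Qed.
Lemma nmR (x : R) : nm (x%:C) = `|x|.
Proof. by rewrite /nm /= expr0n /= addr0 sqrtr_sqr. Qed.
Lemma nm_Re z : `|complex.Re z| <= nm z.
Proof. by case: z => x y; rewrite /nm /= -sqrtr_sqr ler_wsqrtr // lerDl sqr_ge0. Qed.
Lemma nm_Im z : `|complex.Im z| <= nm z.
Proof. by case: z => x y; rewrite /nm /= -(sqrtr_sqr y) ler_wsqrtr // lerDr sqr_ge0. Qed.
Lemma nm_ReIm (z : C) : nm z <= `|complex.Re z| + `|complex.Im z|.
Proof.
case: z => x y /=.
have E : (x +i* y : C) = x%:C + (0 +i* 1) * y%:C.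
  by apply/eqP; rewrite eq_complex /=; apply/andP; split; apply/eqP; ring.
rewrite [X in nm X]E; apply: (le_trans (nmD _ _)).
by rewrite nmM !nmR {1}/nm /= expr0n add0r expr1n sqrtr1 mul1r.
Qed.
Lemma nm_tri (a b c : C) : nm (a - c) <= nm (a - b) + nm (b - c).
Proof. by have := nmD (a - b) (b - c); rewrite addrA subrK. Qed.

Lemma nbhs_nm (z : C) (A : set C) :
  nbhs z A <-> exists2 e : R, 0 < e & forall w, nm (w - z) < e -> A w.
Proof.
rewrite -nbhs_ballE; split.
  case=> e /= e0 sA; exists (complex.Re e).
    by move: e0; rewrite ltcE => /andP[].
  move=> w wz; apply: sA; rewrite /ball /= -normrN opprB nmE.
  by move: e0; rewrite !ltcE /= => /andP[/eqP-> _]; rewrite eqxx.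
case=> e e0 sA; exists e%:C => /=; first by rewrite ltcR.
move=> w; rewrite /ball /= -normrN opprB nmE ltcR; exact: sA.
Qed.

Lemma cvg_nm {T : Type} (F : set_system T) {FF : Filter F} (f : T -> C) (l : C) :
  f @ F --> l <-> forall e : R, 0 < e -> \forall x \near F, nm (f x - l) < e.
Proof.
split=> [fl e e0|H A /nbhs_nm [e e0 sA]].
  by apply: (fl [set w | nm (w - l) < e]); apply/nbhs_nm; exists e.
by have := H _ e0; apply: filterS => x; exact: sA.
Qed.

Definition cdiff (f : C -> C) (z d : C) := forall e : R, 0 < e ->
  exists2 r : R, 0 < r & forall w, nm (w - z) < r -> nm (f w - f z - d * (w - z)) <= e * nm (w - z).

Lemma cdiff_is_derive f z d : cdiff f z d <-> is_derive z 1 f d.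
Proof.
split=> [H|[df <-]].
  have dl : (fun h : C => h^-1 *: (f (h *: 1 + z) - f z)) @ 0^' --> d.
    apply/cvg_nm => e e0.
    have [r r0 Hr] := H (e / 2) (ltac:(lra)).
    rewrite /dnbhs; apply/nbhs_nm; exists r => // h; rewrite subr0 => hr h0 /=.
    have := Hr (h + z); rewrite addrK => /(_ hr).
    have h0' : 0 < nm h by rewrite nm_gt0.
    rewrite [h *: 1]mulr1 => K.
    have -> : h^-1 *: (f (h + z) - f z) - d = h^-1 * (f (h + z) - f z - d * h).
      by rewrite [_ *: _](_ : _ = h^-1 * (f (h + z) - f z))//; field.
    rewrite nmM nmV ltr_pdivrMl //; apply: (le_lt_trans K).
    by rewrite mulrC ltr_pM2l // ltr_pdivrMr // ltr_pMr // ltr1n.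
  apply: (@DeriveDef _ _ _ _ _ _ _ _); first by apply/cvg_ex; exists d.
  exact: (cvg_lim (@norm_hausdorff _ _) dl).
move=> e e0; move: df => /cvg_nm.
move=> /(_ _ e0); rewrite /dnbhs => /nbhs_nm [r r0 Hr]; exists r => // w wr.
have [->|wz] := eqVneq w z; first by rewrite !subrr mulr0 subr0 nm0 mulr0.
have h0 : w - z != 0 by rewrite subr_eq0.
have := Hr (w - z); rewrite subr0 => /(_ wr h0).
rewrite /= [_ *: 1]mulr1 subrK => K.
have -> : f w - f z - 'D_1 f z * (w - z) = (w - z) * ((w - z)^-1 *: (f w - f z) - 'D_1 f z).
  by rewrite [_ *: _](_ : _ = (w - z)^-1 * (f w - f z))//; field.
by rewrite nmM mulrC ler_wpM2r ?nm_ge0 // ltW.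
Qed.

Lemma derivable_cdiff f z : derivable f z 1 <-> exists d, cdiff f z d.
Proof.
split=> [df|[d /cdiff_is_derive []]//].
by exists ('D_1 f z); apply/cdiff_is_derive/derivableP.
Qed.

End cplx.

Section rdiff.
Variable R : realType.
Notation C := (Cplx R).
Implicit Types (z w : C) (f : C -> C).

Lemma is_derive_epsP (u : R -> R) (t d : R) : is_derive t 1 u d <->
  forall e : R, 0 < e -> exists2 r : R, 0 < r &
    forall s, `|s - t| < r -> `|u s - u t - d * (s - t)| <= e * `|s - t|.
Proof.
split=> [[du <-] e e0|H].
  move: du => /cvgrPdist_le /(_ _ e0); rewrite /dnbhs => /nbhs_ballP[r /= r0 Hr].
  exists r => // s sr; have [->|st] := eqVneq s t.
    by rewrite !subrr mulr0 subr0 normr0 mulr0.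
  have h0 : s - t != 0 by rewrite subr_eq0.
  have := Hr (s - t); rewrite /ball /= sub0r normrN => /(_ sr h0).
  rewrite [_ *: 1]mulr1 subrK -/(derive u t 1).
  have -> : u s - u t - 'D_1 u t * (s - t) = - ('D_1 u t - (s - t)^-1 *: (u s - u t)) * (s - t).
    by rewrite [_ *: _](_ : _ = (s - t)^-1 * (u s - u t))//; field.
  by move=> K; rewrite normrM normrN ler_wpM2r.
have dl : (fun h : R => h^-1 *: (u (h *: 1 + t) - u t)) @ 0^' --> d.
  apply/cvgrPdist_le => e e0; have [r r0 Hr] := H _ e0.
  rewrite /dnbhs; apply/nbhs_ballP; exists r => //= h; rewrite /ball /= sub0r normrN => hr h0 /=.
  have := Hr (h + t); rewrite addrK => /(_ hr) K; rewrite [h *: 1]mulr1.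
  have h0' : 0 < `|h| by rewrite normr_gt0.
  rewrite -(ler_pM2r h0'); apply: le_trans K; rewrite -normrM -normrN.
  suff -> : - ((d - h^-1 *: (u (h + t) - u t)) * h) = u (h + t) - u t - d * h by [].
  by rewrite [_ *: _](_ : _ = h^-1 * (u (h + t) - u t))//; field.
apply: (@DeriveDef _ _ _ _ _ _ _ _); first by apply/cvg_ex; exists d.
exact: (cvg_lim (@norm_hausdorff _ _) dl).
Qed.

Definition rdiff (g : R -> C) (t : R) (d : C) := forall e : R, 0 < e ->
  exists2 r : R, 0 < r & forall s, `|s - t| < r -> nm (g s - g t - d * (s - t)%:C) <= e * `|s - t|.

Lemma rdiff_derive (g : R -> C) (t : R) (d c : C) : rdiff g t d ->
  is_derive t 1 (fun s => complex.Re (c * g s)) (complex.Re (c * d)).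
Proof.
move=> H; apply/is_derive_epsP => e e0.
have n0 : 0 < nm c + 1 by rewrite ltr_wpDl ?nm_ge0.
have [r r0 Hr] := H (e / (nm c + 1)) (divr_gt0 e0 n0).
exists r => // s sr.
have -> : complex.Re (c * g s) - complex.Re (c * g t) - complex.Re (c * d) * (s - t) =
   complex.Re (c * (g s - g t - d * (s - t)%:C)).
  move: c (g s) (g t) d {n0 H Hr} (s - t) => [a b] [a1 b1] [a2 b2] [a3 b3] q /=; ring.
apply: (le_trans (nm_Re _)); rewrite nmM.
apply: (le_trans (ler_wpM2l (nm_ge0 _) (Hr _ sr))).
rewrite !mulrA ler_wpM2r // ler_pdivrMr // mulrC ler_wpM2l ?ltW //.
by rewrite ltrDl.
Qed.

Lemma rdiff_mvi (g dg : R -> C) (a b K : R) : a <= b ->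
  (forall t, a <= t <= b -> rdiff g t (dg t)) ->
  (forall t, a <= t <= b -> nm (dg t) <= K) ->
  nm (g b - g a) <= K * (b - a).
Proof.
move=> ab gd dK.
set D := g b - g a; pose c := (D : R[i])^* : C.
have nc : nm c = nm D by rewrite /nm /c; case: (D) => x y /=; rewrite sqrrN.
have [|D0] := leP (nm D) 0.
  by move=> /le_trans; apply; rewrite mulr_ge0 ?subr_ge0//; apply: le_trans (nm_ge0 _) (dK a _); rewrite lexx.
pose u s := complex.Re (c * g s).
have du t : a <= t <= b -> is_derive t 1 u (complex.Re (c * dg t)).
  by move=> tab; apply/rdiff_derive/gd.
have [||x xab E] := @MVT_segment R u (fun t => complex.Re (c * dg t)) a b ab.
- by move=> x; rewrite in_itv /= => /andP[ax xb]; apply: du; rewrite !ltW.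
- apply: derivable_within_continuous => x; rewrite in_itv /= => xab.
  by have [] := du _ xab.
rewrite in_itv /= in xab.
have {}E : nm D ^+ 2 <= nm D * K * (b - a).
  have -> : nm D ^+ 2 = u b - u a.
    rewrite /u /c /D; case: (g b) (g a) => [a1 b1] [a2 b2].
    rewrite /nm /= sqr_sqrtr; last by rewrite addr_ge0 ?sqr_ge0.
    by ring.
  rewrite E ler_wpM2r ?subr_ge0 //; apply: le_trans (ler_norm _) _.
  by apply: (le_trans (nm_Re _)); rewrite nmM nc ler_wpM2l ?nm_ge0 ?dK.
by rewrite -(ler_pM2l D0) mulrA -expr2.
Qed.

Lemma rdiffB (g h : R -> C) t d d' : rdiff g t d -> rdiff h t d' ->
  rdiff (fun s => g s - h s) t (d - d').
Proof.
move=> gd hd e e0; have e2 : 0 < e / 2 by lra.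
have [r r0 Hr] := gd _ e2; have [r' r'0 Hr'] := hd _ e2.
exists (Num.min r r') => [|s]; first by rewrite lt_min r0.
rewrite lt_min => /andP[/Hr K /Hr' K'].
have -> : g s - h s - (g t - h t) - (d - d') * (s - t)%:C =
  (g s - g t - d * (s - t)%:C) - (h s - h t - d' * (s - t)%:C) by ring.
apply: (le_trans (nmB _ _)); move: K K'; set x := `|_|; lra.
Qed.

Lemma cdiff_line f z d (v : C) (z0 : C) t : z0 + t%:C * v = z -> cdiff f z d ->
  rdiff (fun s => f (z0 + s%:C * v)) t (d * v).
Proof.
move=> zE H e e0.
have n0 : 0 < nm v + 1 by rewrite ltr_wpDl ?nm_ge0.
have [r r0 Hr] := H (e / (nm v + 1)) (divr_gt0 e0 n0).
exists (r / (nm v + 1)); first exact: divr_gt0.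
move=> s sr.
have E : z0 + s%:C * v - z = (s - t)%:C * v by rewrite -zE rmorphB /=; ring.
have Es : nm (z0 + s%:C * v - z) = `|s - t| * nm v by rewrite E nmM nmR.
have rr : nm (z0 + s%:C * v - z) < r.
  rewrite Es; apply: le_lt_trans (_ : `|s - t| * (nm v + 1) < r).
    by rewrite ler_wpM2l // lerDl.
  by rewrite -ltr_pdivlMr.
have := Hr _ rr; rewrite Es E zE.
have -> : d * ((s - t)%:C * v) = d * v * (s - t)%:C by ring.
move=> /le_trans; apply.
rewrite mulrA mulrAC ler_wpM2r //.
by rewrite mulrAC ler_pdivrMr // ler_wpM2l ?ltW // ltrDl.
Qed.

Lemma cdiff_mvi f f' (c : C) (z w : C) (K : R) :
  (forall t : R, 0 <= t <= 1 -> cdiff f (z + t%:C * (w - z)) (f' (z + t%:C * (w - z)))) ->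
  (forall t : R, 0 <= t <= 1 -> nm (f' (z + t%:C * (w - z)) - c) <= K) ->
  nm (f w - f z - c * (w - z)) <= K * nm (w - z).
Proof.
move=> fd fK.
pose g t : C := f (z + t%:C * (w - z)) - (z + t%:C * (w - z)) * c.
have := @rdiff_mvi g (fun t => (f' (z + t%:C * (w - z)) - c) * (w - z)) 0 1 (K * nm (w - z)) ler01.
rewrite subr0 mulr1 /g rmorph1 rmorph0 mul1r mul0r addr0 (addrC z) subrK.
have -> : f w - w * c - (f z - z * c) = f w - f z - c * (w - z) by ring.
apply => t t01; last by rewrite nmM ler_wpM2r ?nm_ge0 ?fK.
rewrite mulrBl; apply: rdiffB; first by apply: cdiff_line (fd _ t01).
move=> e e0; exists 1 => // s _.
have E : (z + s%:C * (w - z)) * c - (z + t%:C * (w - z)) * c -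
    c * (w - z) * (s - t)%:C = 0 by rewrite rmorphB /=; ring.
by rewrite E nm0 mulr_ge0 // ltW.
Qed.

End rdiff.

(** * Goursat's theorem and primitives *)

Section bisect.
Variable R : realType.

Lemma nested_point (a : nat -> R) (s : R) : 0 <= s ->
  (forall n, a n <= a n.+1 <= a n + s / 2 ^+ n.+1) ->
  exists p, forall n, a n <= p <= a n + s / 2 ^+ n.
Proof.
move=> s0 H.
have half n : s / 2 ^+ n.+1 + s / 2 ^+ n.+1 = s / 2 ^+ n.
  by rewrite exprS invfM; lra.
have mono n m : (n <= m)%N -> a n <= a m.
  move=> /subnKC <-; elim: (m - n)%N => [|k IH]; first by rewrite addn0.
  by rewrite addnS; apply: (le_trans IH); case/andP: (H (n + k)%N).
have anti n m : (n <= m)%N -> a m + s / 2 ^+ m <= a n + s / 2 ^+ n.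
  move=> /subnKC <-; elim: (m - n)%N => [|k IH]; first by rewrite addn0.
  rewrite addnS; apply: le_trans IH; rewrite -(half (n + k)%N).
  by case/andP: (H (n + k)%N) => _; lra.
have q0 n : 0 <= s / 2 ^+ n by rewrite divr_ge0 // exprn_ge0.
have ub n m : a n <= a m + s / 2 ^+ m.
  case: (leqP n m) => nm.
    by apply: (le_trans (mono _ _ nm)); rewrite lerDl.
  by apply: le_trans (anti _ _ (ltnW nm)); rewrite lerDl.
exists (sup (range a)) => n; apply/andP; split.
  apply: ub_le_sup; last by exists n.
  by exists (a 0%N + s / 2 ^+ 0) => _ [m _ <-].
apply: ge_sup; first by exists (a 0%N), 0%N.
by move=> _ [m _ <-].
Qed.

Lemma bisection (T : R -> R -> R -> R -> R) (x0 y0 w0 h0 : R) :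
  0 <= w0 -> 0 <= h0 ->
  let inside x y w h := [&& 0 <= w, 0 <= h, x0 <= x, x + w <= x0 + w0, y0 <= y & y + h <= y0 + h0] in
  (forall x y w h, inside x y w h ->
    T x y w h <= T x y (w / 2) (h / 2) + T (x + w / 2) y (w / 2) (h / 2)
      + T x (y + h / 2) (w / 2) (h / 2) + T (x + w / 2) (y + h / 2) (w / 2) (h / 2)) ->
  (forall p q, x0 <= p <= x0 + w0 -> y0 <= q <= y0 + h0 -> forall e, 0 < e ->
    exists2 d, 0 < d & forall x y w h, inside x y w h -> x <= p <= x + w -> y <= q <= y + h ->
      w < d -> h < d -> T x y w h <= e * (w ^+ 2 + h ^+ 2)) ->
  T x0 y0 w0 h0 <= 0.
Proof.
move=> w00 h00 inside sub loc; rewrite leNgt; apply/negP => T0.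
pose D (w h : R) := w ^+ 2 + h ^+ 2.
have D00 : 0 < D w0 h0.
  rewrite lt0r addr_ge0 ?sqr_ge0 // andbT; apply/eqP => D0.
  have [||d d0 Hd] := loc x0 y0 _ _ 1 ltr01; rewrite ?lexx ?lerDl //.
  have := Hd x0 y0 w0 h0; rewrite /inside !lexx w00 h00 /=.
  have : w0 ^+ 2 == 0 /\ h0 ^+ 2 == 0.
    by move/eqP: D0; rewrite paddr_eq0 ?sqr_ge0 // => /andP[].
  rewrite !sqrf_eq0 => -[/eqP w0E /eqP h0E].
  move=> /(_ isT); rewrite -/(D w0 h0) D0 mulr0 => K.
  by move: T0; rewrite ltNge K // ?w0E ?h0E ?addr0 ?lexx.
pose k := T x0 y0 w0 h0 / D w0 h0.
have k0 : 0 < k by rewrite divr_gt0.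
pose good (c : R * R) (n : nat) := inside c.1 c.2 (w0 / 2 ^+ n) (h0 / 2 ^+ n) &&
  (k * D (w0 / 2 ^+ n) (h0 / 2 ^+ n) <= T c.1 c.2 (w0 / 2 ^+ n) (h0 / 2 ^+ n)).
have step n c : good c n -> exists c', [/\ good c' n.+1,
    c.1 <= c'.1 <= c.1 + w0 / 2 ^+ n.+1 & c.2 <= c'.2 <= c.2 + h0 / 2 ^+ n.+1].
  move=> /andP[ic kc].
  have := sub _ _ _ _ ic.
  set w := w0 / 2 ^+ n in ic kc *; set h := h0 / 2 ^+ n in ic kc *.
  have wE : w0 / 2 ^+ n.+1 = w / 2 by rewrite /w exprSr invfM mulrA.
  have hE : h0 / 2 ^+ n.+1 = h / 2 by rewrite /h exprSr invfM mulrA.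
  rewrite /good wE hE.
  have DE : D (w / 2) (h / 2) = D w h / 4 by rewrite /D; field.
  move=> sb; move: ic => /and5P[w_ h_ c1 c2 /andP[c3 c4]].
  have [K|K1] := leP (k * D (w / 2) (h / 2)) (T c.1 c.2 (w / 2) (h / 2)).
    by exists c; split; [rewrite K /inside; lra|lra|lra].
  have [K|K2] := leP (k * D (w / 2) (h / 2)) (T (c.1 + w / 2) c.2 (w / 2) (h / 2)).
    by exists (c.1 + w / 2, c.2); split => /=; [rewrite K /inside; lra|lra|lra].
  have [K|K3] := leP (k * D (w / 2) (h / 2)) (T c.1 (c.2 + h / 2) (w / 2) (h / 2)).
    by exists (c.1, c.2 + h / 2); split => /=; [rewrite K /inside; lra|lra|lra].
  have [K|K4] := leP (k * D (w / 2) (h / 2)) (T (c.1 + w / 2) (c.2 + h / 2) (w / 2) (h / 2)).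
    by exists (c.1 + w / 2, c.2 + h / 2); split => /=; [rewrite K /inside; lra|lra|lra].
  exfalso; rewrite DE in K1 K2 K3 K4.
  by move: kc sb K1 K2 K3 K4; lra.
have good0 : good (x0, y0) 0%N.
  rewrite /good /= !expr0 !divr1 /inside !lexx w00 h00 /k divfK ?lexx //.
  by rewrite gt_eqF.
pose nxt n c := if pselect (good c n) is left g then projT1 (cid (step n c g)) else c.
pose cs := fix cs n := if n is m.+1 then nxt m (cs m) else (x0, y0).
have gcs n : good (cs n) n.
  elim: n => [|n IH] //; rewrite /= /nxt; case: pselect => // g.
  by case: cid => c' [].
have stp n : (cs n).1 <= (cs n.+1).1 <= (cs n).1 + w0 / 2 ^+ n.+1 /\
    (cs n).2 <= (cs n.+1).2 <= (cs n).2 + h0 / 2 ^+ n.+1.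
  rewrite [cs n.+1]/= /nxt; case: pselect => [g|/(_ (gcs n))//].
  by case: cid => c' [].
have [p Hp] := nested_point w00 (fun n => (stp n).1).
have [q Hq] := nested_point h00 (fun n => (stp n).2).
have [||d d0 Hd] := loc p q _ _ (k / 2) (divr_gt0 k0 (ltr0Sn _ _)).
- by have := Hp 0%N; rewrite /= expr0 divr1.
- by have := Hq 0%N; rewrite /= expr0 divr1.
have [n Hn] : exists n, w0 / 2 ^+ n < d /\ h0 / 2 ^+ n < d.
  have [m Hm] : exists m : nat, (w0 + h0) / d < m%:R.
    exists (Num.truncn ((w0 + h0) / d)).+1; exact: truncnS_gt.
  have P : 0 < 2 ^+ m :> R by rewrite exprn_gt0.
  exists m; rewrite !ltr_pdivrMr //.
  have : (m%:R : R) <= 2 ^+ m by rewrite -natrX ler_nat ltnW // ltn_expl.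
  move: Hm; rewrite ltr_pdivrMr // => Hm H2.
  have : m%:R * d <= 2 ^+ m * d by rewrite ler_wpM2r // ltW.
  by move: Hm; lra.
have /andP[ic kc] := gcs n.
have := Hd _ _ _ _ ic (Hp n) (Hq n) Hn.1 Hn.2 => /(le_trans kc).
rewrite -/(D _ _); set DD := D _ _ => K.
have DD0 : 0 < DD.
  have -> : DD = D w0 h0 / (2 ^+ n) ^+ 2.
    by rewrite /DD /D !expr_div_n mulrDl.
  by rewrite divr_gt0 // !exprn_gt0.
by move: K; rewrite ler_pM2r //; move: k0; lra.
Qed.
End bisect.

Section prim.
Variable R : realType.
Notation C := (Cplx R).
Implicit Types (z w : C) (f : C -> C).

Lemma cont_nmP f z : {for z, continuous f} <->
  forall e : R, 0 < e -> exists2 r : R, 0 < r & forall w, nm (w - z) < r -> nm (f w - f z) < e.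
Proof.
have P := @cvg_nm R C (nbhs z) _ f (f z).
split=> [/P H e e0|H]; first by have /nbhs_nm := H _ e0.
by apply/P => e e0; apply/nbhs_nm; exact: H.
Qed.

Lemma cdiff_cont f z d : cdiff f z d -> {for z, continuous f}.
Proof.
move=> H; apply/cont_nmP => e e0.
have [r r0 Hr] := H 1 ltr01.
have n0 : 0 < nm d + 1 by rewrite ltr_wpDl ?nm_ge0.
exists (Num.min r (e / (nm d + 1))) => [|w]; first by rewrite lt_min r0 divr_gt0.
rewrite lt_min ltr_pdivlMr // => /andP[/Hr K1 K2].
have -> : f w - f z = (f w - f z - d * (w - z)) + d * (w - z) by rewrite subrK.
apply: le_lt_trans (nmD _ _) _; apply: le_lt_trans K2.
by move: K1; rewrite nmM mul1r; lra.
Qed.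

Lemma prim_real (u : R -> R) (a : R) : (forall x, {for x, continuous u}) ->
  exists P : R -> R, forall x, a < x -> is_derive x 1 P (u x).
Proof.
move=> cu.
exists (fun x => \int[@lebesgue_measure R]_(t in [set` `[a, x]]) (u t))%R => x ax.
have [||||d dE] := @continuous_FTC1_closed R u a x (x + 1).
- by rewrite ltrDl.
- apply: continuous_compact_integrable; first exact: segment_compact.
  by apply: continuous_subspaceT => y; exact: cu.
- by [].
- exact: cu.
- apply: DeriveDef; first exact: d.
  by rewrite -derive1E; exact: dE.
Qed.

Definition pt (x y : R) : C := x +i* y.

Lemma ptE x y : pt x y = x%:C + (0 +i* 1) * y%:C.
Proof. by apply/eqP; rewrite eq_complex /=; apply/andP; split; apply/eqP; ring. Qed.

Lemma prim_cplx (g : R -> C) (a : R) :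
  (forall x (e : R), 0 < e -> exists2 r : R, 0 < r & forall y, `|y - x| < r -> nm (g y - g x) < e) ->
  exists P : R -> C, forall x, a < x -> rdiff P x (g x).
Proof.
move=> cg.
have cRe x : {for x, continuous (fun t => complex.Re (g t))}.
  apply/cvgrPdist_lt => e e0; have [r r0 Hr] := cg x e e0.
  apply/nbhs_ballP; exists r => //= y; rewrite /ball /= distrC => /Hr.
  rewrite distrC; apply: le_lt_trans.
  by have := nm_Re (g y - g x); case: (g y) (g x) => ? ? [].
have cIm x : {for x, continuous (fun t => complex.Im (g t))}.
  apply/cvgrPdist_lt => e e0; have [r r0 Hr] := cg x e e0.
  apply/nbhs_ballP; exists r => //= y; rewrite /ball /= distrC => /Hr.
  rewrite distrC; apply: le_lt_trans.
  by have := nm_Im (g y - g x); case: (g y) (g x) => ? ? [].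
have [P HP] := prim_real a cRe; have [Q HQ] := prim_real a cIm.
exists (fun x => pt (P x) (Q x)) => x ax e e0.
have e2 : 0 < e / 2 by lra.
have [r r0 Hr] := (is_derive_epsP _ _ _).1 (HP x ax) _ e2.
have [r' r'0 Hr'] := (is_derive_epsP _ _ _).1 (HQ x ax) _ e2.
exists (Num.min r r') => [|s]; first by rewrite lt_min r0.
rewrite lt_min => /andP[/Hr K /Hr' K'].
apply: (le_trans (nm_ReIm _)).
have -> : complex.Re (pt (P s) (Q s) - pt (P x) (Q x) - g x * (s - x)%:C) =
   P s - P x - complex.Re (g x) * (s - x) by case: (g x) => a1 b1 /=; ring.
have -> : complex.Im (pt (P s) (Q s) - pt (P x) (Q x) - g x * (s - x)%:C) =
   Q s - Q x - complex.Im (g x) * (s - x) by case: (g x) => a1 b1 /=; ring.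
move: K K'; set A := `|_ - _ - _|; set B := `|_|; lra.
Qed.

Lemma rdiff_mvi2 (g dg : R -> C) (a b K : R) :
  (forall t, Num.min a b <= t <= Num.max a b -> rdiff g t (dg t)) ->
  (forall t, Num.min a b <= t <= Num.max a b -> nm (dg t) <= K) ->
  nm (g b - g a) <= K * `|b - a|.
Proof.
case: (leP a b) => ab gd dK.
  by rewrite ger0_norm ?subr_ge0 //; apply: rdiff_mvi ab gd dK.
rewrite ltr0_norm ?subr_lt0 // opprB -nmN opprB.
by apply: rdiff_mvi (ltW ab) gd dK.
Qed.

Definition edge_primitives (f : C -> C) (a : R) (H V : R -> R -> C) :=
  forall x y, a < x -> a < y ->
    rdiff (H y) x (f (pt x y)) /\ rdiff (V x) y (f (pt x y) * (0 +i* 1)).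

Lemma edge_primitives_ex f (a : R) : (forall z, {for z, continuous f}) ->
  exists H V, edge_primitives f a H V.
Proof.
move=> cf.
have hH y : exists P : R -> C, forall x, a < x -> rdiff P x (f (pt x y)).
  apply: prim_cplx => x e e0.
  have /cont_nmP /(_ _ e0) [r r0 Hr] := cf (pt x y).
  exists r => // x' xx'; apply: Hr.
  have -> : pt x' y - pt x y = (x' - x)%:C by rewrite !ptE rmorphB /=; ring.
  by rewrite nmR.
have hV x : exists P : R -> C, forall y, a < y -> rdiff P y (f (pt x y) * (0 +i* 1)).
  apply: (@prim_cplx (fun y => f (pt x y) * (0 +i* 1))) => y e e0.
  have /cont_nmP /(_ _ e0) [r r0 Hr] := cf (pt x y).
  exists r => // y' yy'; rewrite -mulrBl nmM.
  have -> : nm (0 +i* 1) = 1 :> R by rewrite /nm /= expr0n add0r expr1n sqrtr1.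
  rewrite mulr1; apply: Hr.
  have -> : pt x y' - pt x y = (0 +i* 1) * (y' - y)%:C by rewrite !ptE rmorphB /=; ring.
  by rewrite nmM nmR /nm /= expr0n add0r expr1n sqrtr1 mul1r.
have [H HH] := choice hH; have [V HV] := choice hV.
by exists H, V => x y ax ay; split; [exact: HH|exact: HV].
Qed.

End prim.

Section goursat.
Variable R : realType.
Notation C := (Cplx R).
Implicit Types (z : C) (f : C -> C).

Definition rect (x y w h : R) : set C :=
  [set z | x <= complex.Re z <= x + w /\ y <= complex.Im z <= y + h].

Definition cdiff_in (D : set C) f (p d : C) := forall e : R, 0 < e ->
  exists2 r : R, 0 < r & forall z, D z -> nm (z - p) < r ->
    nm (f z - f p - d * (z - p)) <= e * nm (z - p).

Definition contour (H V : R -> R -> C) (x y w h : R) : C :=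
  (H y (x + w) - H y x) + (V (x + w) (y + h) - V (x + w) y)
  - (H (y + h) (x + w) - H (y + h) x) - (V x (y + h) - V x y).

Lemma cdiff_horizontal f x y d : cdiff f (pt x y) d -> rdiff (fun s => f (pt s y)) x d.
Proof.
move=> fd.
have E s : pt 0 y + s%:C * 1 = pt s y by rewrite !ptE rmorph0; ring.
have := cdiff_line (E x) fd; rewrite mulr1.
by under eq_fun do rewrite E.
Qed.

Lemma cdiff_vertical f x y d : cdiff f (pt x y) d ->
  rdiff (fun s => f (pt x s)) y (d * (0 +i* 1)).
Proof.
move=> fd.
have E s : pt x 0 + s%:C * (0 +i* 1) = pt x s by rewrite !ptE rmorph0; ring.
have := cdiff_line (E y) fd.
by under eq_fun do rewrite E.
Qed.

Lemma goursat f (H V : R -> R -> C) (a x0 y0 w0 h0 : R) :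
  edge_primitives f a H V -> a < x0 -> a < y0 -> 0 <= w0 -> 0 <= h0 ->
  (forall p, rect x0 y0 w0 h0 p -> exists d, cdiff_in (rect x0 y0 w0 h0) f p d) ->
  contour H V x0 y0 w0 h0 = 0.
Proof.
move=> HV ax ay w00 h00 df.
suff : nm (contour H V x0 y0 w0 h0) <= 0.
  by move=> K; apply/eqP; rewrite -nm_eq0 eq_le K nm_ge0.
refine (@bisection R (fun x y w h => nm (contour H V x y w h)) x0 y0 w0 h0 w00 h00 _ _).
  move=> x y w h _.
  have -> : contour H V x y w h = contour H V x y (w / 2) (h / 2)
    + contour H V (x + w / 2) y (w / 2) (h / 2)
    + contour H V x (y + h / 2) (w / 2) (h / 2)
    + contour H V (x + w / 2) (y + h / 2) (w / 2) (h / 2).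
    rewrite /contour.
    have -> : x + w / 2 + w / 2 = x + w by field.
    have -> : y + h / 2 + h / 2 = y + h by field.
    by ring.
  by do 3! (apply: le_trans (nmD _ _) _; rewrite lerD2r).
move=> p q px qy e e0.
have [d Hd] := df (pt p q) (conj px qy).
have e4 : 0 < e / 4 by lra.
have [r r0 Hr] := Hd _ e4.
exists (r / 2); first by lra.
move=> x y w h /and5P[w_ h_ x1 x2 /andP[y1 y2]] xp yq wr hr.
pose P0 := pt p q.
pose L (z : C) : C := f P0 * z + d * (z - P0) ^+ 2 / 2.
have dL z : cdiff L z (f P0 + d * (z - P0)).
  move=> e' e'0; have n0 : 0 < nm (d / 2) + 1 by rewrite ltr_wpDl ?nm_ge0.
  exists (e' / (nm (d / 2) + 1)); first exact: divr_gt0.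
  move=> z'; rewrite ltr_pdivlMr // => K.
  have -> : L z' - L z - (f P0 + d * (z - P0)) * (z' - z) = d / 2 * (z' - z) * (z' - z).
    by rewrite /L; field.
  rewrite 2!nmM ler_wpM2r ?nm_ge0 // mulrC; apply: le_trans (ltW K).
  by rewrite ler_wpM2l ?nm_ge0 // lerDl.
have est s t : x <= s <= x + w -> y <= t <= y + h ->
    nm (f (pt s t) - (f P0 + d * (pt s t - P0))) <= e / 4 * (w + h).
  move=> sx ty.
  have st : nm (pt s t - P0) <= w + h.
    apply: (le_trans (nm_ReIm _)); apply: lerD; rewrite /= ler_norml;
      move: xp yq sx ty => /andP[? ?] /andP[? ?] /andP[? ?] /andP[? ?];
      apply/andP; split; lra.
  rewrite opprD addrA; apply: (le_trans (Hr _ _ _)).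
  - rewrite /rect /=; move: sx ty => /andP[? ?] /andP[? ?].
    by split; apply/andP; split; lra.
  - by apply: (le_lt_trans st); lra.
  - by rewrite ler_wpM2l // ltW.
have Hest t : y <= t <= y + h ->
  nm ((H t (x + w) - L (pt (x + w) t)) - (H t x - L (pt x t))) <= e / 4 * (w + h) * w.
  move=> ty.
  have := @rdiff_mvi R (fun s => H t s - L (pt s t))
    (fun s => f (pt s t) - (f P0 + d * (pt s t - P0))) x (x + w) (e / 4 * (w + h)).
  have -> : x + w - x = w by ring.
  apply; first by rewrite lerDl.
    move=> s sx; apply: rdiffB.
      have [||] := HV s t; [by case/andP: sx => ? _; lra|by case/andP: ty => ? _; lra|by []].
    exact: cdiff_horizontal.
  by move=> s sx; apply: est.
have Vest s : x <= s <= x + w ->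
  nm ((V s (y + h) - L (pt s (y + h))) - (V s y - L (pt s y))) <= e / 4 * (w + h) * h.
  move=> sx.
  have := @rdiff_mvi R (fun t => V s t - L (pt s t))
    (fun t => (f (pt s t) - (f P0 + d * (pt s t - P0))) * (0 +i* 1)) y (y + h) (e / 4 * (w + h)).
  have -> : y + h - y = h by ring.
  apply; first by rewrite lerDl.
    move=> t ty; rewrite mulrBl; apply: rdiffB.
      have [||] := HV s t; [by case/andP: sx => ? _; lra|by case/andP: ty => ? _; lra|by []].
    exact: cdiff_vertical.
  move=> t ty; rewrite nmM {2}/nm /= expr0n add0r expr1n sqrtr1 mulr1.
  by apply: est.
have -> : contour H V x y w h =
  ((H y (x + w) - L (pt (x + w) y)) - (H y x - L (pt x y)))
  + ((V (x + w) (y + h) - L (pt (x + w) (y + h))) - (V (x + w) y - L (pt (x + w) y)))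
  - ((H (y + h) (x + w) - L (pt (x + w) (y + h))) - (H (y + h) x - L (pt x (y + h))))
  - ((V x (y + h) - L (pt x (y + h))) - (V x y - L (pt x y))).
  by rewrite /contour; ring.
have h1 := Hest y _; have h2 := Vest (x + w) _; have h3 := Hest (y + h) _; have h4 := Vest x _.
apply: le_trans (nmB _ _) _; apply: le_trans (lerD (nmB _ _) (lexx _)) _.
apply: le_trans (lerD (lerD (nmD _ _) (lexx _)) (lexx _)) _.
apply: (@le_trans _ _ (e / 4 * (w + h) * w + e / 4 * (w + h) * h + e / 4 * (w + h) * w + e / 4 * (w + h) * h)).
  apply: lerD; last by apply: h4; lra.
  apply: lerD; last by apply: h3; lra.
  by apply: lerD; [apply: h1; lra|apply: h2; lra].
have -> : e / 4 * (w + h) * w + e / 4 * (w + h) * h + e / 4 * (w + h) * w + e / 4 * (w + h) * h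
  = e / 2 * (w + h) ^+ 2 by field.
have : (w + h) ^+ 2 <= 2 * (w ^+ 2 + h ^+ 2).
  by have := sqr_ge0 (w - h); lra.
by move=> /(ler_wpM2l (ltW e0)); lra.
Qed.

End goursat.

Section primitive.
Variable R : realType.
Notation C := (Cplx R).
Implicit Types (z : C) (f : C -> C).

Definition clamp (x y w h : R) (z : C) : C :=
  pt (Num.max x (Num.min (complex.Re z) (x + w))) (Num.max y (Num.min (complex.Im z) (y + h))).

Lemma clamp_in x y w h z : 0 <= w -> 0 <= h -> rect x y w h (clamp x y w h z).
Proof.
by move=> w0 h0; rewrite /rect /= !ge_max !le_max !ge_min !lexx /= !lerDl w0 h0 !orbT.
Qed.

Lemma clamp_id x y w h z : rect x y w h z -> clamp x y w h z = z.
Proof.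
case: z => p q [/= /andP[xp px] /andP[yq qy]].
by rewrite /clamp /= !min_l // !max_r.
Qed.

Lemma clamp_lip x y w h z z' : nm (clamp x y w h z - clamp x y w h z') <= 2 * nm (z - z').
Proof.
have L (a b p q : R) : `|Num.max a (Num.min p b) - Num.max a (Num.min q b)| <= `|p - q|.
  rewrite !maxEle !minEle.
  by do !case: ifPn; rewrite -?ltNge => *; rewrite ler_norml;
    apply/andP; split; case: (ger0P (p - q)) => ?; lra.
apply: le_trans (nm_ReIm _) _; rewrite mulrDl !mul1r; apply: lerD.
- by apply: (le_trans (L _ _ _ _)); have := nm_Re (z - z'); case: z z' => ? ? [].
- by apply: (le_trans (L _ _ _ _)); have := nm_Im (z - z'); case: z z' => ? ? [].
Qed.

Lemma clamp_cont f x y w h : 0 <= w -> 0 <= h ->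
  (forall z, rect x y w h z -> {for z, continuous f}) ->
  forall z, {for z, continuous (f \o clamp x y w h)}.
Proof.
move=> w0 h0 cf z; apply/cont_nmP => e e0.
have /cont_nmP /(_ _ e0) [r r0 Hr] := cf _ (clamp_in x y z w0 h0).
exists (r / 2); first by lra.
move=> z' K; apply: Hr; apply: le_lt_trans (clamp_lip _ _ _ _ _ _) _; lra.
Qed.

Lemma cdiff_clamp f x y w h p d : rect x y w h p -> cdiff f p d ->
  cdiff_in (rect x y w h) (f \o clamp x y w h) p d.
Proof.
move=> ip fd e e0; have [r r0 Hr] := fd e e0; exists r => // z iz zr.
by rewrite /= !clamp_id //; exact: Hr.
Qed.

Lemma primitive f (c : C) (r : R) : 0 < r ->
  (forall z, `|complex.Re (z - c)| <= r -> `|complex.Im (z - c)| <= r ->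
     exists d, cdiff f z d) ->
  exists F, forall z, `|complex.Re (z - c)| < r -> `|complex.Im (z - c)| < r -> cdiff F z (f z).
Proof.
move=> r0 df.
pose x0 := complex.Re c - r; pose y0 := complex.Im c - r.
have r2 : 0 <= 2 * r by lra.
have sq z : rect x0 y0 (2 * r) (2 * r) z <-> `|complex.Re (z - c)| <= r /\ `|complex.Im (z - c)| <= r.
  rewrite /rect /x0 /y0 /=; case: z (c) => a b [a' b'] /=; rewrite !ler_norml.
  by split=> -[/andP[? ?] /andP[? ?]]; split; apply/andP; split; lra.
pose g := f \o clamp x0 y0 (2 * r) (2 * r).
have cg z : {for z, continuous g}.
  apply: clamp_cont => // {}z /sq[z1 z2]; have [d] := df _ z1 z2; exact: cdiff_cont.
pose a := Num.min x0 y0 - 1.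
have [ax ay] : a < x0 /\ a < y0.
  have : Num.min x0 y0 <= x0 /\ Num.min x0 y0 <= y0 by rewrite !ge_min !lexx orbT.
  by rewrite /a => -[? ?]; split; lra.
have [H [V HV]] := edge_primitives_ex a cg.
pose F z := (H y0 (complex.Re z) - H y0 x0) + (V (complex.Re z) (complex.Im z) - V (complex.Re z) y0).
have FE x y : x0 <= x <= x0 + 2 * r -> y0 <= y <= y0 + 2 * r ->
    F (pt x y) = (V x0 y - V x0 y0) + (H y x - H y x0).
  move=> /andP[x1 x2] /andP[y1 y2].
  have sub p : rect x0 y0 (x - x0) (y - y0) p -> rect x0 y0 (2 * r) (2 * r) p.
    by move=> [/andP[? ?] /andP[? ?]]; split; apply/andP; split; lra.
  have E : contour H V x0 y0 (x - x0) (y - y0) = 0.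
    apply: (goursat HV ax ay); rewrite ?subr_ge0 // => p.
    move=> /[dup] pr /sub pR; have /sq[p1 p2] := pR.
    have [d fd] := df _ p1 p2; exists d => e e0.
    have [r' r'0 Hr'] := cdiff_clamp pR fd e0.
    by exists r' => // z /sub zr; exact: Hr'.
  have [xE yE] : x0 + (x - x0) = x /\ y0 + (y - y0) = y by split; ring.
  rewrite /contour xE yE in E; rewrite /F /=.
  by rewrite -[RHS]addr0 -E; ring.
exists F => z zx zy.
have zx' : x0 < complex.Re z < x0 + 2 * r.
  by move: zx; rewrite /x0; case: z c {sq zy F FE g cg df x0 y0 a ax ay H V HV} => ? ? [? ?] /=; rewrite ltr_norml => /andP[? ?]; apply/andP; split; lra.
have zy' : y0 < complex.Im z < y0 + 2 * r.
  by move: zy; rewrite /y0; case: z c {sq zx zx' F FE g cg df x0 y0 a ax ay H V HV} => ? ? [? ?] /=; rewrite ltr_norml => /andP[? ?]; apply/andP; split; lra.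
have zR : rect x0 y0 (2 * r) (2 * r) z by split; lra.
have gz : g z = f z by rewrite /g /= clamp_id.
move=> e e0; rewrite -gz.
have e2 : 0 < e / 2 by lra.
have /cont_nmP /(_ _ e2) [r1 r10 Hr1] := cg z.
case: z {zx zy gz cg zR} Hr1 zx' zy' => x y; rewrite -/(pt x y) /= => Hr1 zx zy.
pose m := Num.min (Num.min (x - x0) (x0 + 2 * r - x)) (Num.min (y - y0) (y0 + 2 * r - y)).
have m0 : 0 < m.
  by rewrite /m !lt_min; lra.
exists (Num.min m (r1 / 2)) => [|w]; first by rewrite lt_min m0; lra.
rewrite lt_min => /andP[wm wr].
case: w wm wr => x' y'; rewrite -/(pt x' y') => wm wr.
have dx : `|x' - x| <= nm (pt x' y' - pt x y) by exact: nm_Re (pt x' y' - pt x y).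
have dy : `|y' - y| <= nm (pt x' y' - pt x y) by exact: nm_Im (pt x' y' - pt x y).
have mE : [/\ m <= x - x0, m <= x0 + 2 * r - x, m <= y - y0 & m <= y0 + 2 * r - y].
  by rewrite /m !ge_min !lexx ?orbT.
case: mE => m1 m2 m3 m4.
have [x1 x2] : x0 < x' /\ x' < x0 + 2 * r.
  by move: (le_lt_trans dx wm); rewrite ltr_norml => /andP[? ?]; split; lra.
have [y1 y2] : y0 < y' /\ y' < y0 + 2 * r.
  by move: (le_lt_trans dy wm); rewrite ltr_norml => /andP[? ?]; split; lra.
have -> : F (pt x' y') - F (pt x y) - g (pt x y) * (pt x' y' - pt x y) =
  ((V x' y' - g (pt x y) * (0 +i* 1) * y'%:C) - (V x' y - g (pt x y) * (0 +i* 1) * y%:C))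
  + ((H y x' - g (pt x y) * x'%:C) - (H y x - g (pt x y) * x%:C)).
  have -> : F (pt x' y') = F (pt x' y) + (V x' y' - V x' y) by rewrite /F /=; ring.
  have E1 : F (pt x' y) = V x0 y - V x0 y0 + (H y x' - H y x0) by apply: FE; lra.
  have E2 : F (pt x y) = V x0 y - V x0 y0 + (H y x - H y x0) by apply: FE; lra.
  rewrite E1 E2.
  by rewrite !ptE; ring.
have near s t : Num.min x x' <= s <= Num.max x x' -> Num.min y y' <= t <= Num.max y y' ->
    nm (g (pt s t) - g (pt x y)) <= e / 2.
  move=> sx ty; apply/ltW/Hr1; apply: le_lt_trans (nm_ReIm _) _.
  have -> : complex.Re (pt s t - pt x y) = s - x by [].
  have -> : complex.Im (pt s t - pt x y) = t - y by [].
  have B (p p' q : R) : Num.min p p' <= q <= Num.max p p' -> `|q - p| <= `|p' - p|.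
    have := ler_norm (p' - p); have := ler_norm (p - p'); rewrite distrC.
    by case: (leP p p') => K ? ? /andP[? ?]; rewrite ler_norml; apply/andP; split; lra.
  by move: (B _ _ _ sx) (B _ _ _ ty) => ? ?; lra.
have gt_min (a1 b1 c1 t : R) : c1 < a1 -> c1 < b1 -> Num.min a1 b1 <= t -> c1 < t.
  by move=> ? ?; rewrite ge_min => /orP[]; apply: lt_le_trans.
apply: le_trans (nmD _ _) _.
have K1 : nm ((V x' y' - g (pt x y) * (0 +i* 1) * y'%:C) - (V x' y - g (pt x y) * (0 +i* 1) * y%:C)) <= e / 2 * `|y' - y|.
  apply: (@rdiff_mvi2 R (fun t => V x' t - g (pt x y) * (0 +i* 1) * t%:C) (fun t => (g (pt x' t) - g (pt x y)) * (0 +i* 1))).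
    move=> t /andP[t1 t2]; rewrite mulrBl; apply: rdiffB.
      have [||//] := HV x' t; first lra.
      by apply: gt_min t1; lra.
    by move=> e' e'0; exists 1 => // s _; rewrite -mulrBr rmorphB /= subrr nm0 mulr_ge0 // ltW.
  move=> t ty; rewrite nmM {2}/nm /= expr0n add0r expr1n sqrtr1 mulr1.
  by apply: near => //; rewrite ge_min le_max !lexx !orbT.
have K2 : nm ((H y x' - g (pt x y) * x'%:C) - (H y x - g (pt x y) * x%:C)) <= e / 2 * `|x' - x|.
  apply: (@rdiff_mvi2 R (fun t => H y t - g (pt x y) * t%:C) (fun t => (g (pt t y) - g (pt x y)))).
    move=> t /andP[t1 t2]; apply: rdiffB.
      have [||//] := HV t y; last lra.
      by apply: gt_min t1; lra.
    by move=> e' e'0; exists 1 => // s _; rewrite -mulrBr rmorphB /= subrr nm0 mulr_ge0 // ltW.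
  move=> t ty.
  by apply: near => //; rewrite ge_min le_max !lexx.
move: (ler_wpM2l (ltW e2) dx) (ler_wpM2l (ltW e2) dy); lra.
Qed.

End primitive.

Section cexp.
Variable R : realType.
Notation C := (Cplx R).
Implicit Types (z : C) (f : C -> C).

Definition cexp (z : C) : C :=
  (expR (complex.Re z))%:C * pt (cos (complex.Im z)) (sin (complex.Im z)).

Lemma nm_cexp z : nm (cexp z) = expR (complex.Re z).
Proof.
rewrite nmM nmR ger0_norm ?expR_ge0 //.
by rewrite {1}/nm /= cos2Dsin2 sqrtr1 mulr1.
Qed.

Lemma cexpD z z' : cexp (z + z') = cexp z * cexp z'.
Proof.
case: z z' => a b [a' b']; rewrite /cexp /= expRD cosD sinD !ptE.
rewrite !rmorphB !rmorphD !rmorphM /=.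
have i2 : (0 +i* 1) * (0 +i* 1) = -1 :> C.
  by apply/eqP; rewrite eq_complex /=; apply/andP; split; apply/eqP; ring.
set E := (expR a)%:C; set E' := (expR a')%:C.
set c := (cos b)%:C; set c' := (cos b')%:C; set s := (sin b)%:C; set s' := (sin b')%:C.
set i := (0 +i* 1) in i2 *.
have -> : E * (c + i * s) * (E' * (c' + i * s')) = E * E' * (c * c' + i * i * (s * s') + i * (s * c' + c * s')) by ring.
by rewrite i2; ring.
Qed.

Lemma cdiff_cexp z : cdiff cexp z (cexp z).
Proof.
have H0 : cdiff cexp 0 1.
  move=> e e0.
  have e6 : 0 < Num.min (e / 6) 1 by rewrite lt_min; lra.
  have := (is_derive_epsP _ _ _).1 (is_derive_expR (0 : R)) _ e6.
  rewrite expR0 => -[r1 r10 H1].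
  have := (is_derive_epsP _ _ _).1 (is_derive_cos (0 : R)) _ e6.
  rewrite sin0 oppr0 cos0 => -[r2 r20 H2].
  have := (is_derive_epsP _ _ _).1 (is_derive_sin (0 : R)) _ e6.
  rewrite sin0 cos0 => -[r3 r30 H3].
  pose m := Num.min (Num.min r1 r2) (Num.min r3 (Num.min (e / 6) 1)).
  exists m; first by rewrite /m !lt_min r10 r20 r30 ltr01 /=; lra.
  move=> w; rewrite subr0 /m !lt_min => /andP[/andP[w1 w2] /and3P[w3 w4 w5]].
  have := nm_Re w; have := nm_Im w; move: w1 w2 w3 w4 w5.
  case: w => a b; set N := nm _ => w1 w2 w3 w4 w5; rewrite [complex.Im _]/= [complex.Re _]/= => bN aN.
  have := H1 a; rewrite subr0 mul1r => /(_ (le_lt_trans aN w1)) K1.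
  have := H2 b; rewrite !(addr0, subr0, mul0r) => /(_ (le_lt_trans bN w2)) K2.
  have := H3 b; rewrite !(subr0, mul1r) => /(_ (le_lt_trans bN w3)) K3.
  have -> : cexp 0 = 1.
    by rewrite /cexp /= expR0 cos0 sin0 ptE rmorph1 rmorph0 mulr0 addr0 mulr1.
  rewrite -/(pt a b).
  have -> : cexp (pt a b) - 1 - pt a b = (expR a - 1 - a)%:C * pt (cos b) (sin b)
     + (1 + a)%:C * pt (cos b - 1) (sin b - b) + a%:C * pt 0 b.
    apply/eqP; rewrite eq_complex /cexp /=; apply/andP; split; apply/eqP; ring.
  apply: le_trans (nmD _ _) _; apply: le_trans (lerD (nmD _ _) (lexx _)) _.
  have cs1 : nm (pt (cos b) (sin b)) = 1 by rewrite /nm /= cos2Dsin2 sqrtr1.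
  rewrite !nmM !nmR cs1 mulr1.
  have q1 : nm (pt (cos b - 1) (sin b - b)) <= e / 6 * N + e / 6 * N.
    apply: le_trans (nm_ReIm _) _; apply: lerD.
      apply: le_trans K2 _; apply: ler_pM => //; first exact: ltW.
      by rewrite ge_min lexx.
    apply: le_trans K3 _; apply: ler_pM => //; first exact: ltW.
    by rewrite ge_min lexx.
  have q2 : nm (pt 0 b) <= e / 6.
    by apply: le_trans (nm_ReIm _) _; rewrite /= normr0 add0r; apply: (le_trans bN); exact: ltW.
  have a1 : `|1 + a| <= 2.
    by apply: le_trans (ler_normD _ _) _; rewrite normr1; lra.
  have q3 : `|1 + a| * nm (pt (cos b - 1) (sin b - b)) <= 2 * (e / 6 * N + e / 6 * N).
    by apply: ler_pM => //; exact: nm_ge0.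
  have q4 : `|a| * nm (pt 0 b) <= N * (e / 6).
    by apply: ler_pM => //; exact: nm_ge0.
  have q5 : `|expR a - 1 - a| <= e / 6 * N.
    apply: le_trans K1 _; apply: ler_pM => //; first exact: ltW.
    by rewrite ge_min lexx.
  lra.
move=> e e0; have n0 : 0 < nm (cexp z) by rewrite nm_cexp expR_gt0.
have [r r0 Hr] := H0 (e / nm (cexp z)) (divr_gt0 e0 n0).
exists r => // w wr.
have := Hr (w - z); rewrite subr0 => /(_ wr).
have -> : cexp w = cexp z * cexp (w - z) by rewrite -cexpD addrC subrK.
have c0 : cexp 0 = 1.
  by rewrite /cexp /= expR0 cos0 sin0 ptE rmorph1 rmorph0 mulr0 addr0 mulr1.
rewrite c0 => K.
have -> : cexp z * cexp (w - z) - cexp z - cexp z * (w - z) = cexp z * (cexp (w - z) - 1 - 1 * (w - z)) by ring.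
by rewrite nmM mulrC -ler_pdivlMr // mulrAC.
Qed.

Lemma cdiff_comp f g z d d' : cdiff g z d -> cdiff f (g z) d' -> cdiff (f \o g) z (d' * d).
Proof.
move=> gd fd e e0; have e2 : 0 < e / 2 by lra.
have nd : 0 < nm d + 1 by rewrite ltr_wpDl ?nm_ge0.
have nd' : 0 < nm d' + 1 by rewrite ltr_wpDl ?nm_ge0.
have [r1 r10 H1] := fd (e / 2 / (nm d + 1)) (divr_gt0 e2 nd).
have /cont_nmP /(_ _ r10) [r2 r20 H2] := cdiff_cont gd.
have [r3 r30 H3] := gd 1 ltr01.
have [r4 r40 H4] := gd (e / 2 / (nm d' + 1)) (divr_gt0 e2 nd').
exists (Num.min r2 (Num.min r3 r4)); first by rewrite !lt_min r20 r30.
move=> w; rewrite !lt_min => /and3P[w2 w3 w4].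
have K1 := H1 _ (H2 _ w2); have K3 := H3 _ w3; have K4 := H4 _ w4.
have L : nm (g w - g z) <= (nm d + 1) * nm (w - z).
  have -> : g w - g z = (g w - g z - d * (w - z)) + d * (w - z) by rewrite subrK.
  by apply: le_trans (nmD _ _) _; move: K3; rewrite nmM; lra.
have -> : (f \o g) w - (f \o g) z - d' * d * (w - z) =
  (f (g w) - f (g z) - d' * (g w - g z)) + d' * (g w - g z - d * (w - z)) by rewrite /=; ring.
apply: le_trans (nmD _ _) _.
have Q1 : nm (f (g w) - f (g z) - d' * (g w - g z)) <= e / 2 * nm (w - z).
  apply: le_trans K1 _; apply: le_trans (ler_wpM2l _ L) _.
    by rewrite !divr_ge0 ?ltW.
  by rewrite mulrA divfK ?lexx // gt_eqF.
have Q2 : nm (d' * (g w - g z - d * (w - z))) <= e / 2 * nm (w - z).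
  rewrite nmM; apply: (@le_trans _ _ ((nm d' + 1) * (e / 2 / (nm d' + 1) * nm (w - z)))).
    by apply: ler_pM; rewrite ?nm_ge0 // lerDl.
  by rewrite mulrA mulrCA mulfV ?gt_eqF // mulr1.
lra.
Qed.

End cexp.

(** * Mean bound and identity theorem *)

Section identity.
Variable R : realType.
Notation C := (Cplx R).
Implicit Types (z : C) (f : C -> C).

Lemma nm_i : nm (0 +i* 1 : C) = 1.
Proof. by rewrite /nm /= expr0n add0r expr1n sqrtr1. Qed.

(* The integral of [f (z + rho * e^(i t))] over [t] does not depend on [rho]:
   this is Goursat's theorem for [f (z + exp w)] on a rectangle. *)
Lemma circle_bound f z (r M : R) : 0 < r ->
  (forall w, nm (w - z) <= r -> exists d, cdiff f w d) ->
  (forall w, nm (w - z) = r -> nm (f w) <= M) -> nm (f z) <= M.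
Proof.
move=> r0 df fM; apply/ler_addgt0Pr => e e0.
have [dz fdz] : exists d, cdiff f z d by apply: df; rewrite subrr nm0 ltW.
have /cont_nmP /(_ _ e0) [r1 r10 Hr1] := cdiff_cont fdz.
pose rho := Num.min r (r1 / 2).
have rho0 : 0 < rho by rewrite lt_min r0; lra.
have rho_r : rho <= r by rewrite ge_min lexx.
have rho_r1 : rho < r1.
  by apply: (@le_lt_trans _ _ (r1 / 2)); [rewrite ge_min lexx orbT|lra].
pose l1 := ln rho; pose l2 := ln r.
have l12 : l1 <= l2 by rewrite ler_ln.
have l12' : 0 <= l2 - l1 by rewrite subr_ge0.
have p0 : 0 < 2 * pi :> R by rewrite mulr_gt0 // pi_gt0.
have p00 := ltW p0.
pose g x := f (z + cexp x).
pose gc := g \o clamp l1 0 (l2 - l1) (2 * pi).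
have l2E : l1 + (l2 - l1) = l2 by rewrite addrC subrK.
have dg x : rect l1 0 (l2 - l1) (2 * pi) x -> exists d, cdiff g x d.
  move=> [/andP[_ x2] _].
  have [|d fd] := df (z + cexp x).
    by rewrite addrC addKr nm_cexp -(lnK r0) ler_expR -/l2 -l2E.
  exists (d * (0 + cexp x)); apply: (@cdiff_comp _ f (fun x => z + cexp x)) => // e' e'0.
  have [r' r'0 Hr'] := cdiff_cexp x e'0; exists r' => // w /Hr'.
  by rewrite add0r opprD addrACA subrr add0r.
have cgc x : {for x, continuous gc}.
  by apply: clamp_cont => // y /dg[d]; exact: cdiff_cont.
pose a := Num.min l1 0 - 1.
have [al1 a0] : a < l1 /\ a < 0.
  have : Num.min l1 0 <= l1 /\ Num.min l1 0 <= 0 by rewrite !ge_min !lexx orbT.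
  by rewrite /a => -[? ?]; split; lra.
have [H [V HV]] := edge_primitives_ex a cgc.
have : contour H V l1 0 (l2 - l1) (2 * pi) = 0.
  apply: (goursat HV al1 a0) => // x ix; have [d gd] := dg _ ix.
  by exists d; exact: cdiff_clamp.
rewrite /contour l2E add0r => E.
have gcE x : rect l1 0 (l2 - l1) (2 * pi) x -> gc x = g x by move=> ix; rewrite /gc /= clamp_id.
have K0 : nm ((H 0 l2 - H (2 * pi) l2) - (H 0 l1 - H (2 * pi) l1)) <= 0 * (l2 - l1).
  apply: (@rdiff_mvi R (fun s => H 0 s - H (2 * pi) s)
    (fun s => gc (pt s 0) - gc (pt s (2 * pi)))) => // s /andP[s1 s2].
    apply: rdiffB.
      by have [||//] := HV s 0; lra.
    by have [||//] := HV s (2 * pi); lra.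
  rewrite !gcE; [|by split; rewrite /= ?l2E ?add0r; lra..].
  by rewrite /g /cexp /= cos0 sin0 mulr_natl cos2pi sin2pi subrr nm0.
have K1 : nm (V l2 (2 * pi) - V l2 0) <= M * (2 * pi - 0).
  apply: (@rdiff_mvi R (V l2) (fun t => gc (pt l2 t) * (0 +i* 1))) => // t /andP[t0 t1].
    by have [||//] := HV l2 t; lra.
  rewrite nmM nm_i mulr1.
  have -> : gc (pt l2 t) = g (pt l2 t) by apply: gcE; split; rewrite /= ?l2E ?add0r; lra.
  by apply: fM; rewrite addrC addKr nm_cexp /= lnK.
have K2 : nm ((V l1 (2 * pi) - f z * (0 +i* 1) * (2 * pi)%:C) - (V l1 0 - f z * (0 +i* 1) * 0%:C))
    <= e * (2 * pi - 0).
  apply: (@rdiff_mvi R (fun t => V l1 t - f z * (0 +i* 1) * t%:C)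
     (fun t => (gc (pt l1 t) - f z) * (0 +i* 1))) => // t /andP[t0 t1].
    rewrite mulrBl; apply: rdiffB.
      by have [||//] := HV l1 t; lra.
    by move=> e' e'0; exists 1 => // s _; rewrite -mulrBr rmorphB /= subrr nm0 mulr_ge0 // ltW.
  rewrite nmM nm_i mulr1.
  have -> : gc (pt l1 t) = g (pt l1 t) by apply: gcE; split; rewrite /= ?l2E ?add0r; lra.
  by apply/ltW/Hr1; rewrite addrC addKr nm_cexp /= lnK.
rewrite mul0r in K0; rewrite subr0 in K1 K2.
have -> : nm (f z) = nm (f z * (0 +i* 1) * (2 * pi)%:C) / (2 * pi).
  by rewrite !nmM nmR nm_i mulr1 gtr0_norm // mulfK // gt_eqF.
rewrite ler_pdivrMr //.
have -> : f z * (0 +i* 1) * (2 * pi)%:C =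
  ((H 0 l2 - H (2 * pi) l2) - (H 0 l1 - H (2 * pi) l1)) + (V l2 (2 * pi) - V l2 0)
  - ((V l1 (2 * pi) - f z * (0 +i* 1) * (2 * pi)%:C) - (V l1 0 - f z * (0 +i* 1) * 0%:C)).
  by rewrite -[LHS]addr0 -E rmorph0; ring.
apply: le_trans (nmB _ _) _; apply: le_trans (lerD (nmD _ _) (lexx _)) _.
by rewrite [leRHS]mulrDl; lra.
Qed.

Lemma pt_cont (p : R * R) : {for p, continuous (fun p : R * R => pt p.1 p.2)}.
Proof.
apply/cvg_nm => e e0.
have : nbhs p (ball p (e / 2)) by apply: nbhsx_ballx; lra.
apply: filterS => q [/= q1 q2].
rewrite -[X in X < _]/(nm (pt q.1 q.2 - pt p.1 p.2)).
apply: le_lt_trans (nm_ReIm _) _ => /=.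
by move: q1 q2; rewrite /ball /= (distrC p.1) (distrC p.2) => ? ?; lra.
Qed.

Lemma rect_compact x y w h : compact (rect x y w h : set C).
Proof.
have -> : rect x y w h = (fun p : R * R => pt p.1 p.2) @` (`[x, x + w] `*` `[y, y + h]).
  apply/seteqP; split => [[a b] [/= xa yb]|_ [[a b] /= [xa yb] <-]].
    by exists (a, b) => //=; rewrite !in_itv.
  by move: xa yb; rewrite !in_itv.
apply: continuous_compact; last by apply: compact_setX; exact: segment_compact.
by apply: continuous_subspaceT => p; exact: pt_cont.
Qed.

Lemma nm_dist z z' : `|nm z - nm z'| <= nm (z - z').
Proof.
rewrite ler_norml; apply/andP; split.
  by have := nm_tri 0 z z'; rewrite !sub0r !nmN; lra.
by have := nmD (z - z') z'; rewrite subrK; lra.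
Qed.

Lemma nm_cont z : {for z, continuous (@nm R)}.
Proof.
apply: (proj2 (@cvgrPdist_lt R R C (nbhs z) _ (@nm R) (nm z))) => e e0.
apply/nbhs_nm; exists e => // w wz.
by rewrite distrC; apply: le_lt_trans (nm_dist _ _) _.
Qed.

Lemma rect_bounded f x y w h : 0 <= w -> 0 <= h ->
  (forall z, rect x y w h z -> {for z, continuous f}) ->
  exists M, forall z, rect x y w h z -> nm (f z) <= M.
Proof.
move=> w0 h0 cf; pose u z := nm (f (clamp x y w h z)).
have cu : {within rect x y w h, continuous u}.
  apply: continuous_subspaceT => z.
  apply: (@continuous_comp _ _ _ (f \o clamp x y w h) (@nm R)); first exact: clamp_cont.
  exact: nm_cont.
have [|c ic Hc] := compact_EVT_max _ (@rect_compact x y w h) cu.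
  by exists (clamp x y w h 0); exact: clamp_in.
exists (u c) => z iz; have := Hc z; rewrite inE => /(_ iz).
by rewrite /u clamp_id.
Qed.

Lemma cdiff_near f g z d (r : R) : 0 < r -> (forall w, nm (w - z) < r -> f w = g w) ->
  cdiff f z d -> cdiff g z d.
Proof.
move=> r0 fg fd e e0; have [r' r'0 Hr'] := fd e e0.
exists (Num.min r r') => [|w]; first by rewrite lt_min r0.
rewrite lt_min => /andP[/fg <- /Hr']; rewrite -fg // subrr nm0.
by [].
Qed.

(* Apply [circle_bound] at [z] to [f w * ((z - z1) / (w - z1)) ^+ k]; since [f]
   vanishes near [z1] this is holomorphic, its value at [z] is [f z], and on a
   circle of radius much larger than the distance from [z] to [z1] it is small
   for large [k]. *)
Lemma vanish_spread f (z1 : C) (r rho : R) :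
  (forall w, nm (w - z1) < r -> exists d, cdiff f w d) ->
  0 < rho -> (forall w, nm (w - z1) < rho -> f w = 0) ->
  forall z, nm (z - z1) < r / 16 -> f z = 0.
Proof.
move=> df rho0 f0 z zr.
have [->|zz1] := eqVneq z z1; first by apply: f0; rewrite subrr nm0.
have n0 : 0 < nm (z - z1) by rewrite nm_gt0 subr_eq0.
have r0 : 0 < r / 4 by lra.
have [M HM] : exists M, forall w, rect (complex.Re z - r / 4) (complex.Im z - r / 4) (r / 2) (r / 2) w -> nm (f w) <= M.
  apply: rect_bounded; [lra|lra|] => w [/andP[w1 w2] /andP[w3 w4]].
  have [|d] := df w; last exact: cdiff_cont.
  apply: le_lt_trans (nm_tri _ z _) _.
  apply: (@lt_le_trans _ _ (r / 4 + r / 4 + r / 16)); last lra.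
  apply: ler_ltD => //; apply: le_trans (nm_ReIm _) _.
  by case: w z w1 w2 w3 w4 {zr zz1 n0} => p q [p' q'] /= ? ? ? ?; apply: lerD; rewrite ler_norml; apply/andP; split; lra.
have M0 : 0 <= M.
  by apply: le_trans (nm_ge0 (f z)) (HM z _); split; apply/andP; split; lra.
have key k : nm (f z) <= M * (1 / 3) ^+ k.
  pose p w : C := ((z - z1) / (w - z1)) ^+ k.
  have -> : f z = f z * p z by rewrite /p mulfV ?subr_eq0 // expr1n mulr1.
  apply: (@circle_bound (fun w => f w * p w) z (r / 4)) => //.
    move=> w wz.
    have wr : nm (w - z1) < r by apply: le_lt_trans (nm_tri _ z _) _; lra.
    have [w1|w1] := eqVneq w z1.
      exists 0; apply: (@cdiff_near (fun=> 0) _ w 0 rho) => //.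
        by move=> w'; rewrite w1 => /f0 ->; rewrite mul0r.
      by move=> e e0; exists 1 => // ? _; rewrite mul0r !subr0 nm0 mulr_ge0 ?nm_ge0 // ltW.
    pose q w : C := (z - z1) / (w - z1).
    have dq : derivable q w 1.
      apply: (@derivableM _ _ (fun=> z - z1) (fun w => (w - z1)^-1)); first exact: derivable_cst.
      apply: (@derivableV _ _ (fun w => w - z1)); first by rewrite subr_eq0.
      by apply: derivableB; [exact: derivable_id|exact: derivable_cst].
    have -> : p = q ^+ k by apply/funext => ?; rewrite exprfctE.
    apply/derivable_cdiff; apply: (@derivableM _ _ f (q ^+ k)); first exact/derivable_cdiff/df.
    exact: derivableX.
  move=> w wz.
  have t1 : r / 4 <= nm (w - z1) + r / 16.
    by rewrite -wz; apply: le_trans (nm_tri _ z1 _) _; rewrite lerD2l nm_distC ltW.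
  rewrite nmM; apply: ler_pM; rewrite ?nm_ge0 //.
    apply: HM; have := nm_Re (w - z); have := nm_Im (w - z); rewrite wz.
    by rewrite /rect; case: (w) (z) => ? ? [? ?] /=; rewrite !ler_norml => /andP[? ?] /andP[? ?]; split; apply/andP; split; lra.
  have q1 : nm ((z - z1) / (w - z1)) <= 1 / 3 by rewrite nmM nmV ler_pdivrMr; lra.
  have q0 : 0 <= 1 / 3 :> R by lra.
  by rewrite /p nmX; apply: lerXn2r; rewrite ?nnegrE ?nm_ge0.
apply/eqP; rewrite -nm_eq0 eq_le nm_ge0 andbT leNgt; apply/negP => fz.
have [k Hk] : exists k : nat, M < nm (f z) * k%:R.
  exists (Num.truncn (M / nm (f z))).+1.
  by rewrite mulrC -ltr_pdivrMr //; exact: truncnS_gt.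
have := key k; rewrite expr_div_n expr1n mul1r ler_pdivlMr ?exprn_gt0 // leNgt => /negP; apply.
apply: (lt_le_trans Hk); rewrite ler_wpM2l ?nm_ge0 //.
by rewrite -natrX ler_nat ltnW // ltn_expl.
Qed.

End identity.

(** * Planar Lebesgue measure *)

Section image_measures.
Local Open Scope ereal_scope.

Lemma pushforward_ex d d' (T1 : measurableType d) (T2 : measurableType d') (R : realType)
    (m : {measure set T1 -> \bar R}) (f : T1 -> T2) (r : R) :
  measurable_fun [set: T1] f -> (0 <= r)%R ->
  exists m' : {measure set T2 -> \bar R}, forall A, m' A = r%:E * m (f @^-1` A).
Proof.
move=> mf r0.
by exists (mscale (NngNum r0) (measure_function_pushforward__canonical__measure_function_Measure m mf)).
Qed.
End image_measures.

Section lebesgue_plane.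
Variable R : realType.
Local Notation RR := (measurableTypeR R * measurableTypeR R)%type.
Local Notation lam := (@lebesgue_measure R).
Local Notation lam2 := (@lebesgue_measure R \x @lebesgue_measure R)%E.

Lemma lebesgue_affine (a u : R) (A : set (measurableTypeR R)) : a != 0 -> measurable A ->
  lam ((fun x => a * x + u) @^-1` A) = (`|a|^-1%:E * lam A)%E.
Proof.
move=> a0 mA.
have mf : measurable_fun [set: measurableTypeR R] (fun x : measurableTypeR R => (a * x + u : measurableTypeR R)).
  by apply: measurable_funD => //; apply: measurable_funM.
have [m mE] := pushforward_ex lam mf (normr_ge0 a).
have -> : lam A = m A.
  apply: lebesgue_measure_unique => // _ [[p q] _ <-]; rewrite mE /=.
  case: (ltgtP a 0) a0 => // a0 _.
    have -> : (fun x : R => a * x + u) @^-1` `]p, q] = `[(q - u) / a, (p - u) / a[%classic.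
      apply/seteqP; split => x /=; rewrite !in_itv /= ler_ndivrMr // ltr_ndivlMr // => /andP[? ?];
        apply/andP; split; lra.
    rewrite !lebesgue_measure_itv /= !lte_fin.
    have -> : ((q - u) / a < (p - u) / a) = (p < q).
      by rewrite ltr_nM2r ?invr_lt0 // ltrD2r.
    case: ifP => _; last by rewrite mule0.
    rewrite -!EFinB -EFinM; congr EFin; rewrite ltr0_norm //; field.
    by rewrite lt_eqF.
  have -> : (fun x : R => a * x + u) @^-1` `]p, q] = `](p - u) / a, (q - u) / a]%classic.
    apply/seteqP; split => x /=; rewrite !in_itv /= ltr_pdivrMr // ler_pdivlMr // => /andP[? ?];
      apply/andP; split; lra.
  rewrite !lebesgue_measure_itv /= !lte_fin.
  have -> : ((p - u) / a < (q - u) / a) = (p < q).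
    by rewrite ltr_pM2r ?invr_gt0 // ltrD2r.
  case: ifP => _; last by rewrite mule0.
  rewrite -!EFinB -EFinM; congr EFin; rewrite gtr0_norm //; field.
  by rewrite gt_eqF.
by rewrite mE muleA -EFinM mulVf ?mul1e // normr_eq0.
Qed.

Definition scales (f : RR -> RR) (c : R) := measurable_fun setT f /\
  forall A : set RR, measurable A -> lam2 (f @^-1` A) = (c%:E * lam2 A)%E.

Lemma scales_comp f g c d : scales f c -> scales g d -> scales (g \o f) (c * d).
Proof.
move=> [mf fc] [mg gd]; split; first exact: measurableT_comp.
move=> A mA; rewrite comp_preimage fc.
  by rewrite gd // muleA EFinM.
by rewrite -[X in measurable X]setTI; exact: mg.
Qed.

Lemma scales_ext f g c : f =1 g -> scales f c -> scales g c.
Proof. by move=> /funext ->. Qed.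

Lemma measurable_lin (a b u : R) : measurable_fun [set: RR]
  (fun p : RR => a * p.1 + b * p.2 + u).
Proof.
apply: measurable_funD => //; apply: measurable_funD; apply: measurable_funM => //.
Qed.

Lemma measurable_affine2 (a b u c d v : R) : measurable_fun [set: RR]
  (fun p : RR => (a * p.1 + b * p.2 + u, c * p.1 + d * p.2 + v) : RR).
Proof. by apply: measurable_fun_pair; exact: measurable_lin. Qed.

Lemma lam2_ysection (A : set RR) : measurable A -> lam2 A = (\int[lam]_y lam (ysection A y))%E.
Proof.
move=> mA; rewrite -[RHS]/((lam \x^ lam)%E A).
by apply: product_measure_unique => //= *; rewrite product_measure2E.
Qed.

Lemma preimage_measurable (f : RR -> RR) (A : set RR) :
  measurable_fun setT f -> measurable A -> measurable (f @^-1` A).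
Proof. by move=> mf mA; rewrite -[X in measurable X]setTI; exact: mf. Qed.

Lemma lebesgue_shift (u : R) (A : set (measurableTypeR R)) : measurable A ->
  lam ((fun x => x + u) @^-1` A) = lam A.
Proof.
move=> mA; have := @lebesgue_affine 1 u A (oner_neq0 _) mA.
rewrite normr1 invr1 mul1e => <-; congr (lam _).
by apply/seteqP; split => x /=; rewrite mul1r.
Qed.

Lemma scales_shear (k : R) : scales (fun p => (p.1 + k * p.2, p.2)) 1.
Proof.
have mf : measurable_fun setT (fun p : RR => (p.1 + k * p.2, p.2) : RR).
  have := measurable_affine2 1 k 0 0 1 0; congr measurable_fun.
  by apply/funext => p; congr pair; ring.
split => // A mA; rewrite mul1e !lam2_ysection //; last exact: preimage_measurable.
apply: eq_integral => y _; rewrite -[RHS](@lebesgue_shift (k * y)).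
  by congr (lam _); apply/seteqP; split => x; rewrite /ysection /= !inE.
exact: measurable_ysection.
Qed.

Lemma scales_shear2 (k : R) : scales (fun p => (p.1, p.2 + k * p.1)) 1.
Proof.
have mf : measurable_fun setT (fun p : RR => (p.1, p.2 + k * p.1) : RR).
  have := measurable_affine2 1 0 0 k 1 0; congr measurable_fun.
  by apply/funext => p; congr pair; ring.
split => // A mA; rewrite mul1e /product_measure1.
apply: eq_integral => x _ /=; rewrite -[RHS](@lebesgue_shift (k * x)).
  by congr (lam _); apply/seteqP; split => y; rewrite /xsection /= !inE.
exact: measurable_xsection.
Qed.

Lemma scales_diag (a b u v : R) : a != 0 -> b != 0 ->
  scales (fun p => (a * p.1 + u, b * p.2 + v)) `|a * b|^-1.
Proof.
move=> a0 b0.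
have mf : measurable_fun setT (fun p : RR => (a * p.1 + u, b * p.2 + v) : RR).
  have := measurable_affine2 a 0 u 0 b v; congr measurable_fun.
  by apply/funext => p; congr pair; ring.
split => // A mA.
have [m mE'] := pushforward_ex lam2 mf (normr_ge0 (a * b)).
pose f (p : RR) : RR := (a * p.1 + u, b * p.2 + v).
have mE B : m B = (`|a * b|%:E * lam2 (f @^-1` B))%E by exact: mE'.
have -> : lam2 A = m A.
  apply: product_measure_unique => // B C mB mC; rewrite mE.
  have -> : f @^-1` (B `*` C) =
    ((fun x => a * x + u) @^-1` B) `*` ((fun y => b * y + v) @^-1` C) by [].
  have mA1 (c w : R) (D : set (measurableTypeR R)) : measurable D -> measurable ((fun x => c * x + w) @^-1` D).
    move=> mD; rewrite -[X in measurable X]setTI.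
    have : measurable_fun [set: measurableTypeR R] (fun x : measurableTypeR R => (c * x + w : measurableTypeR R)).
      by apply: measurable_funD => //; apply: measurable_funM.
    by apply.
  have -> : lam2 (((fun x => a * x + u) @^-1` B) `*` ((fun y => b * y + v) @^-1` C)) =
      ((`|a|^-1%:E * lam B) * (`|b|^-1%:E * lam C))%E.
    rewrite -(lebesgue_affine u a0 mB) -(lebesgue_affine v b0 mC).
    exact: (@product_measure1E _ _ _ _ R lam lam _ _ (mA1 a u B mB) (mA1 b v C mC)).
  rewrite normrM muleACA !muleA -!EFinM.
  have -> : `|a| * `|b| * `|a|^-1 * `|b|^-1 = 1 by field; rewrite !normr_eq0 a0 b0.
  by rewrite mul1e.
by rewrite mE muleA -EFinM mulVf ?mul1e // normr_eq0 mulf_neq0.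
Qed.

Lemma scales_affine (a b c d u v : R) : a * d - b * c != 0 ->
  scales (fun p => (a * p.1 + b * p.2 + u, c * p.1 + d * p.2 + v)) `|a * d - b * c|^-1.
Proof.
have H a' b' c' d' : a' != 0 -> a' * d' - b' * c' != 0 ->
    scales (fun p => (a' * p.1 + b' * p.2 + u, c' * p.1 + d' * p.2 + v)) `|a' * d' - b' * c'|^-1.
  move=> a0 D0.
  pose e := (a' * d' - b' * c') / a'.
  have e0 : e != 0 by rewrite mulf_neq0 // invr_neq0.
  have := scales_comp (scales_comp (scales_shear (b' / a')) (scales_diag u (v - c' / a' * u) a0 e0))
    (scales_shear2 (c' / a')).
  have -> : 1 * `|a' * e|^-1 * 1 = `|a' * d' - b' * c'|^-1.
    by rewrite mul1r mulr1 /e mulrC divfK.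
  apply: scales_ext => p /=; congr pair; rewrite /e; field => //.
move=> D0; have [a0|] := eqVneq a 0; last by move=> a0; exact: H.
have b0 : b != 0 by apply: contraNneq D0 => ->; rewrite a0; apply/eqP; ring.
have D0' : b * d - b * (c + d) != 0.
  by move: D0; rewrite a0; congr (_ != _); ring.
have := scales_comp (scales_shear2 (-1)) (H b b (c + d) d b0 D0').
have -> : 1 * `|b * d - b * (c + d)|^-1 = `|a * d - b * c|^-1.
  by rewrite mul1r a0; congr (`|_|^-1); ring.
by apply: scales_ext => p /=; rewrite a0; congr pair; ring.
Qed.

End lebesgue_plane.

Section plane_borel.
Variable R : realType.
Notation C := (Cplx R).
Local Notation RR := (measurableTypeR R * measurableTypeR R)%type.

Lemma measurable_oo2 (a b c d : R) :
  measurable ([set p | a < p.1 < b /\ c < p.2 < d] : set RR).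
Proof.
have -> : ([set p | a < p.1 < b /\ c < p.2 < d] : set RR) = `]a, b[%classic `*` `]c, d[%classic.
  by apply/seteqP; split => p /=; rewrite !in_itv.
by apply: measurableX; exact: measurable_itv.
Qed.

Lemma open_measurable2 (A : set (R * R)) : open A -> measurable (A : set RR).
Proof.
move=> oA.
pose Q (q : rat * rat * rat * rat) : set (R * R) :=
  [set p : R * R | (ratr q.1.1.1 : R) < p.1 < ratr q.1.1.2 /\ (ratr q.1.2 : R) < p.2 < ratr q.2].
pose Q' q := if pselect (Q q `<=` A) then Q q else set0.
have AE : A = \bigcup_q Q' q.
  apply/seteqP; split => [p Ap|p [q _]]; last by rewrite /Q'; case: pselect => [qA /qA|].
  have /nbhs_ballP[e /= e0 eA] : nbhs p A by exact: open_nbhs_nbhs.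
  have E1 (x : R) : exists a b : rat, x - e < ratr a /\ (ratr a : R) < x /\ x < ratr b /\ ratr b < x + e.
    have /rat_in_itvoo[a] : x - e < x by lra.
    have /rat_in_itvoo[b] : x < x + e by lra.
    by rewrite !in_itv /= => /andP[? ?] /andP[? ?]; exists a, b.
  have [a [b [a1 [a2 [b1 b2]]]]] := E1 p.1; have [c [d [c1 [c2 [d1 d2]]]]] := E1 p.2.
  exists (a, b, c, d) => //; rewrite /Q'; case: pselect => [?|[]]; first by split; apply/andP.
  move=> q [/andP[q1 q2] /andP[q3 q4]]; apply: eA; split; rewrite /ball /= ltr_norml;
    apply/andP; split; move: q1 q2 q3 q4 => /=; lra.
rewrite AE; apply: countable_bigcupT_measurable => // q; rewrite /Q'.
by case: pselect => ?; [exact: measurable_oo2|exact: measurable0].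
Qed.

Lemma cont_preimage_measurable (T : ptopologicalType) (D : set (R * R)) (g : R * R -> T) :
  open D -> (forall p, D p -> {for p, continuous g}) ->
  measurable_fun (D : set RR) (g : RR -> borel T).
Proof.
move=> oD cg; apply: (measurability _ (erefl : @measurable _ (borel T) = <<s (@open T) >>)).
move=> _ [B oB <-]; apply: open_measurable2; rewrite openE => p [Dp Bgp].
have nD : nbhs p D by exact: open_nbhs_nbhs.
have nB : nbhs p (g @^-1` B) by apply: (cg p Dp); exact: open_nbhs_nbhs.
exact: filterI.
Qed.

Lemma cont_preimage_measurableR (D : set (R * R)) (g : R * R -> R) :
  open D -> (forall p, D p -> {for p, continuous g}) ->
  measurable_fun (D : set RR) (g : RR -> measurableTypeR R).
Proof.
move=> oD cg mD Y mY.
have := @cont_preimage_measurable R D g oD cg mD; apply.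
move: Y mY; apply: smallest_sub; first exact: smallest_sigma_algebra.
move=> _ [[a b] _ <-].
have -> : `]a, b]%classic = `]a, +oo[%classic `\` `]b, +oo[%classic :> set R.
  apply/seteqP; split => x /=; rewrite !in_itv /= !andbT.
    by move=> /andP[-> xb]; split => //; apply/negP; rewrite -leNgt.
  by move=> [-> /negP]; rewrite -leNgt.
by apply: (@measurableD _ (borel R)); apply: sub_sigma_algebra; exact: rray_open.
Qed.

Definition toRR (z : C) : RR := (complex.Re z, complex.Im z).

Lemma cont_Re z : {for z, continuous (fun z : C => complex.Re z)}.
Proof.
apply: (proj2 (@cvgrPdist_lt R R C (nbhs z) _ (fun z : C => complex.Re z) (complex.Re z))) => e e0.
apply/nbhs_nm; exists e => // w; rewrite nm_distC => wz; apply: le_lt_trans wz.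
by have := nm_Re (z - w); case: z w => ? ? [].
Qed.

Lemma cont_Im z : {for z, continuous (fun z : C => complex.Im z)}.
Proof.
apply: (proj2 (@cvgrPdist_lt R R C (nbhs z) _ (fun z : C => complex.Im z) (complex.Im z))) => e e0.
apply/nbhs_nm; exists e => // w; rewrite nm_distC => wz; apply: le_lt_trans wz.
by have := nm_Im (z - w); case: z w => ? ? [].
Qed.

Lemma measurable_fun_toRR d (T : measurableType d) (D : set T) (g : T -> C) :
  measurable_fun D (fun x => complex.Re (g x) : measurableTypeR R) ->
  measurable_fun D (fun x => complex.Im (g x) : measurableTypeR R) ->
  measurable_fun D (fun x => toRR (g x)).
Proof.
move=> m1 m2 mD.
apply: (measurability _ (measurable_prod_measurableType _ _)) => //.
move=> _ [_ [B1 mB1 [B2 mB2 <-]] <-].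
rewrite [X in measurable X](_ : _ = (D `&` (fun x => complex.Re (g x)) @^-1` B1) `&`
   (D `&` (fun x => complex.Im (g x)) @^-1` B2)).
  by apply: measurableI; [exact: m1|exact: m2].
by apply/seteqP; split => x /=; tauto.
Qed.

Lemma continuous_measurable_toRR (D : set (R * R)) (g : R * R -> C) :
  open D -> (forall p, D p -> {for p, continuous g}) ->
  measurable_fun (D : set RR) (fun p : RR => toRR (g p)).
Proof.
move=> oD cg; apply: measurable_fun_toRR.
  apply: cont_preimage_measurableR => // p Dp.
  by apply: (@continuous_comp _ _ _ g (fun z : C => complex.Re z)); [exact: cg|exact: cont_Re].
apply: cont_preimage_measurableR => // p Dp.
by apply: (@continuous_comp _ _ _ g (fun z : C => complex.Im z)); [exact: cg|exact: cont_Im].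
Qed.

Definition hrect (x y w h : R) : set RR := [set p | x < p.1 <= x + w /\ y < p.2 <= y + h].

Definition ocrect : set (set RR) :=
  [set A | exists a b c d, A = [set p | a < p.1 <= b /\ c < p.2 <= d]].

Lemma measurable_ocrect : @measurable _ RR = <<s ocrect >>.
Proof.
apply/seteqP; split; last first.
  apply: smallest_sub; first exact: sigma_algebra_measurable.
  move=> _ [a [b [c [d ->]]]].
  have -> : ([set p | a < p.1 <= b /\ c < p.2 <= d] : set RR) = `]a, b]%classic `*` `]c, d]%classic.
    by apply/seteqP; split => p /=; rewrite !in_itv.
  by apply: measurableX; exact: measurable_itv.
rewrite measurable_prod_measurableType; apply: smallest_sub; first exact: smallest_sigma_algebra.
pose T := g_sigma_algebraType ocrect.
have gen : @measurable _ (measurableTypeR R) = <<s (@ocitv R) >> by [].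
have big (x : R) : exists n : nat, - n%:R < x <= n%:R.
  exists (Num.truncn `|x|).+1.
  have := truncnS_gt `|x|; have := ler_norm x; have := ler_norm (- x).
  by rewrite normrN => ? ? ?; apply/andP; split; lra.
have m1 : measurable_fun setT (fst : T -> measurableTypeR R).
  apply: (measurability _ gen) => _ [_ [[a b] _ <-] <-].
  rewrite setTI [X in measurable X](_ : _ = \bigcup_n ([set p | a < p.1 <= b /\ - n%:R < p.2 <= n%:R] : set T)).
    apply: bigcupT_measurable => n; apply: sub_sigma_algebra.
    by exists a, b, (- n%:R), n%:R.
  apply/seteqP; split => [p|p [n _ [+ _]]] /=; rewrite in_itv //=.
  by move=> ab; have [n Hn] := big p.2; exists n.
have m2 : measurable_fun setT (snd : T -> measurableTypeR R).
  apply: (measurability _ gen) => _ [_ [[a b] _ <-] <-].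
  rewrite setTI [X in measurable X](_ : _ = \bigcup_n ([set p | - n%:R < p.1 <= n%:R /\ a < p.2 <= b] : set T)).
    apply: bigcupT_measurable => n; apply: sub_sigma_algebra.
    by exists (- n%:R), n%:R, a, b.
  apply/seteqP; split => [p|p [n _ [_ +]]] /=; rewrite in_itv //=.
  by move=> ab; have [n Hn] := big p.1; exists n.
move=> _ [A1 mA1 [B1 mB1 <-]].
apply: (@measurableI _ T (fst @^-1` A1) (snd @^-1` B1)); rewrite -[X in measurable X]setTI.
  exact: m1.
exact: m2.
Qed.

Lemma plane_measure_unique (m1 m2 : {measure set RR -> \bar R}) :
  (forall a b c d, m1 [set p | a < p.1 <= b /\ c < p.2 <= d] = m2 [set p | a < p.1 <= b /\ c < p.2 <= d]) ->
  (m1 setT < +oo)%E -> forall A, measurable A -> m1 A = m2 A.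
Proof.
move=> m12 m1oo A mA.
apply: (measure_unique ocrect (fun n => [set p | - n%:R < p.1 <= n%:R /\ - n%:R < p.2 <= n%:R])) => //.
- exact: measurable_ocrect.
- move=> _ _ [a [b [c [d ->]]]] [a' [b' [c' [d' ->]]]].
  exists (Num.max a a'), (Num.min b b'), (Num.max c c'), (Num.min d d').
  apply/seteqP; split => p /=; rewrite !gt_max !le_min.
    by move=> [[/andP[-> ->] /andP[-> ->]] [/andP[-> ->] /andP[-> ->]]].
  by move=> [/andP[/andP[-> ->] /andP[-> ->]] /andP[/andP[-> ->] /andP[-> ->]]].
- by move=> n; exists (- n%:R), n%:R, (- n%:R), n%:R.
- apply/seteqP; split => // p _.
  pose x := `|p.1| + `|p.2|.
  exists (Num.truncn x).+1 => //=.
  have := truncnS_gt x; rewrite /x; move: (_%:R) => N.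
  have := ler_norm p.1; have := ler_norm (- p.1); have := ler_norm p.2; have := ler_norm (- p.2).
  have := normr_ge0 p.1; have := normr_ge0 p.2.
  by rewrite !normrN => ? ? ? ? ? ? ?; split; apply/andP; split; lra.
- by move=> _ [a [b [c [d ->]]]]; exact: m12.
- move=> k; apply: le_lt_trans m1oo; apply: le_measure; rewrite ?inE //.
  rewrite measurable_ocrect; apply: sub_sigma_algebra.
  by exists (- k%:R), k%:R, (- k%:R), k%:R.
Qed.

End plane_borel.

(** * Area in the coordinate of a primitive *)

Section inverse_function.
Variable R : realType.
Notation C := (Cplx R).
Implicit Types (z u : C) (f F G : C -> C).

Definition sqr (c : C) (r : R) : set C :=
  [set z | `|complex.Re (z - c)| < r /\ `|complex.Im (z - c)| < r].

Lemma sqr_nm c r z : nm (z - c) < r -> sqr c r z.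
Proof. by move=> K; split; [have := nm_Re (z - c)|have := nm_Im (z - c)] => /le_lt_trans; apply. Qed.

Lemma nm_sqr c r z : sqr c r z -> nm (z - c) < 2 * r.
Proof. by case=> ? ?; apply: le_lt_trans (nm_ReIm _) _; lra. Qed.

(* [G] inverts the primitive [F] of [f], and [L] is a Lipschitz constant of
   the inverse. *)
Record conformal f F G (z0 : C) (s r L : R) : Prop := Conformal {
  cf_s : 0 < s ;
  cf_r : 0 < r ;
  cf_L : 0 < L ;
  cf_diff : forall z, nm (z - z0) < s -> cdiff F z (f z) ;
  cf_cont : forall z, nm (z - z0) < s -> {for z, continuous f} ;
  cf_neq0 : forall z, nm (z - z0) < s -> f z != 0 ;
  cf_lip : forall z z', nm (z - z0) < s -> nm (z' - z0) < s -> nm (z - z') <= L * nm (F z - F z') ;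
  cf_inv : forall u, sqr (F z0) r u -> nm (G u - z0) < s /\ F (G u) = u }.

Lemma disc_segment (z0 z z' : C) (s t : R) : nm (z - z0) < s -> nm (z' - z0) < s -> 0 <= t <= 1 ->
  nm (z + t%:C * (z' - z) - z0) < s.
Proof.
move=> zs zs' /andP[t0 t1].
have -> : z + t%:C * (z' - z) - z0 = (1 - t)%:C * (z - z0) + t%:C * (z' - z0).
  by rewrite rmorphB rmorph1; ring.
apply: le_lt_trans (nmD _ _) _; rewrite !nmM !nmR !ger0_norm ?subr_ge0 //.
have [->|] := eqVneq t 0; first by rewrite subr0; lra.
rewrite neq_lt => /orP[|t0']; first lra.
have := ltr_pM2l t0' (nm (z' - z0)) s; rewrite zs' => K2.
have : (1 - t) * nm (z - z0) <= (1 - t) * s by rewrite ler_wpM2l ?subr_ge0 // ltW.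
by move: K2; lra.
Qed.

Lemma inverse_function f (z0 : C) (d0 : R) : 0 < d0 ->
  (forall z, nm (z - z0) < d0 -> exists d, cdiff f z d) -> f z0 != 0 ->
  exists F G s r L, s < d0 /\ conformal f F G z0 s r L.
Proof.
move=> d00 df f0; set c := f z0 in f0.
have c0 : 0 < nm c by rewrite nm_gt0.
have c2 : 0 < nm c / 2 by lra.
have [dz0 fdz0] : exists d, cdiff f z0 d by apply: df; rewrite subrr nm0.
have /cont_nmP /(_ _ c2) [r1 r10 Hr1] := cdiff_cont fdz0.
pose m := Num.min d0 r1.
have m0 : 0 < m by rewrite lt_min d00.
have md : m <= d0 by rewrite ge_min lexx.
have mr : m <= r1 by rewrite ge_min lexx orbT.
pose q := m / 3.
have q0 : 0 < q by rewrite /q; lra.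
have [|F HF] := @primitive R f z0 q q0.
  by move=> z z1 z2; apply: df; apply: le_lt_trans (nm_ReIm _) _; rewrite /q in z1 z2; lra.
have FD z : nm (z - z0) < q -> cdiff F z (f z).
  by move=> zq; apply: HF; have [] := sqr_nm zq.
have qm : q < m by rewrite /q; lra.
have fc z : nm (z - z0) < q -> nm (f z - c) <= nm c / 2.
  by move=> zq; apply/ltW/Hr1; lra.
have lin z z' : nm (z - z0) < q -> nm (z' - z0) < q ->
    nm (F z' - F z - c * (z' - z)) <= nm c / 2 * nm (z' - z).
  move=> zq zq'; apply: (@cdiff_mvi R F f) => t t01.
    by apply: FD; exact: disc_segment.
  by apply: fc; exact: disc_segment.
have lip z z' : nm (z - z0) < q -> nm (z' - z0) < q -> nm (z - z') <= 2 / nm c * nm (F z - F z').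
  move=> zq zq'; have := lin _ _ zq' zq.
  have := nmB (F z - F z') (F z - F z' - c * (z - z')).
  rewrite opprB addrC subrK nmM => K1 K2.
  by rewrite mulrAC ler_pdivlMr // mulrC; lra.
pose s := q / 2; pose r := nm c * s / 8.
have s0 : 0 < s by rewrite /s; lra.
have r0 : 0 < r by rewrite /r !mulr_gt0 // invr_gt0.
have sq : s < q by rewrite /s; lra.
have s2q : 2 * s = q by rewrite /s; lra.
have surj u : sqr (F z0) r u -> exists z, nm (z - z0) < s /\ F z = u.
  move=> /nm_sqr ur.
  pose K := rect (complex.Re z0 - s) (complex.Im z0 - s) (2 * s) (2 * s).
  have KP z : K z <-> `|complex.Re (z - z0)| <= s /\ `|complex.Im (z - z0)| <= s.
    rewrite /K /rect /=; case: z z0 {df fdz0 Hr1 HF FD fc lin lip ur K c f0 c0 c2 r r0} => a b [a' b'] /=.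
    by rewrite !ler_norml; split=> -[/andP[? ?] /andP[? ?]]; split; apply/andP; split; lra.
  have s20 : 0 <= 2 * s by lra.
  have cF z : K z -> {for z, continuous F}.
    move=> /KP[z1 z2]; apply: (@cdiff_cont _ _ _ (f z)); apply: HF.
      by apply: le_lt_trans z1 sq.
    by apply: le_lt_trans z2 sq.
  pose cl := clamp (complex.Re z0 - s) (complex.Im z0 - s) (2 * s) (2 * s).
  pose v z := nm (F (cl z) - u).
  have cv : {within K, continuous v}.
    apply: continuous_subspaceT => z.
    apply: (@continuous_comp _ _ _ (fun z => F (cl z) - u) (@nm R)); last exact: nm_cont.
    have /cont_nmP cFc := clamp_cont s20 s20 cF (z := z).
    apply/cont_nmP => e /cFc[r' r'0 Hr']; exists r' => // w /Hr'.
    by rewrite opprB addrA subrK.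
  have K0 : K z0 by apply/KP; rewrite subrr /= normr0; split; exact: ltW.
  have [||z + Hz] := compact_EVT_min _ _ cv; [by exists z0|exact: rect_compact|].
  rewrite inE => Kz.
  have {}Hz z' : K z' -> nm (F z - u) <= nm (F z' - u).
    move=> Kz'; have := Hz z'; rewrite inE => /(_ Kz').
    by rewrite /v /cl !clamp_id.
  have Fzu : nm (F z - u) < 2 * r by apply: le_lt_trans (Hz _ K0) _; rewrite nm_distC.
  have zq : nm (z - z0) <= 2 * s by have /KP[? ?] := Kz; apply: le_trans (nm_ReIm _) _; lra.
  have zin (z' : C) : K z' -> nm (z' - z0) < m.
    by move=> /KP[? ?]; apply: le_lt_trans (nm_ReIm _) _; lra.
  have lin' z' z'' : K z' -> K z'' -> nm (F z'' - F z' - c * (z'' - z')) <= nm c / 2 * nm (z'' - z').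
    move=> K1 K2.
    have Kt (t : R) : 0 <= t <= 1 -> K (z' + t%:C * (z'' - z')).
      move=> /andP[t0 t1]; move: K1 K2; rewrite /K /rect /=.
      case: z' z'' => a1 b1 [a2 b2] /= [/andP[? ?] /andP[? ?]] [/andP[? ?] /andP[? ?]].
      have C1 x y v1 v2 : v1 <= x -> v1 <= y -> x <= v2 -> y <= v2 -> v1 <= x + (t * (y - x) ) <= v2.
        move=> ? ? ? ?; have -> : x + t * (y - x) = (1 - t) * x + t * y by ring.
        apply/andP; split.
          have : (1 - t) * v1 + t * v1 <= (1 - t) * x + t * y by rewrite lerD // ler_wpM2l // subr_ge0.
          by lra.
        have : (1 - t) * x + t * y <= (1 - t) * v2 + t * v2 by rewrite lerD // ler_wpM2l // subr_ge0.
        by lra.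
      by split; rewrite ?mul0r ?subr0 ?addr0; apply: C1.
    apply: (@cdiff_mvi R F f) => t /Kt /[dup] kt /KP[k1 k2].
      by apply: HF; [exact: le_lt_trans k1 sq|exact: le_lt_trans k2 sq].
    by apply/ltW/Hr1; have := zin _ kt; lra.
  have zs : nm (z - z0) < s.
    have K1 := lin' _ _ K0 Kz.
    have K2 := nmB (F z - F z0) (F z - F z0 - c * (z - z0)).
    rewrite opprB addrC subrK nmM in K2.
    have K3 := nm_tri (F z) u (F z0).
    have : nm c * nm (z - z0) < nm c * s by move: K1 K2 K3; rewrite /r in ur Fzu; lra.
    by rewrite ltr_pM2l.
  exists z; split => //; apply/eqP; rewrite -subr_eq0 -nm_eq0; apply/negPn/negP => n0.
  have n1 : 0 < nm (F z - u) by rewrite lt0r n0 nm_ge0.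
  pose h := - (F z - u) / c.
  have h0 : 0 < nm h by rewrite nmM nmN nmV divr_gt0.
  pose t := Num.min 1 ((s - nm (z - z0)) / nm h).
  have t0 : 0 < t by rewrite lt_min ltr01 divr_gt0 // subr_gt0.
  have t1 : t <= 1 by rewrite ge_min lexx.
  have th : t * nm h <= s - nm (z - z0) by rewrite -ler_pdivlMr // ge_min lexx orbT.
  have nth : nm (t%:C * h) = t * nm h by rewrite nmM nmR ger0_norm // ltW.
  have Kzh : K (z + t%:C * h).
    have B : nm (z + t%:C * h - z0) <= s.
      by rewrite addrAC; apply: le_trans (nmD _ _) _; rewrite nth; lra.
    by apply/KP; split; [have := nm_Re (z + t%:C * h - z0)|have := nm_Im (z + t%:C * h - z0)] => /le_trans; apply.
  have := Hz _ Kzh; apply/negP; rewrite -ltNge.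
  have K1 := lin' _ _ Kz Kzh.
  rewrite (addrC z (_ * h)) addrK nth (addrC _ z) in K1.
  have ch : nm c * nm h = nm (F z - u) by rewrite -nmM /h mulrC divfK // nmN.
  have -> : F (z + t%:C * h) - u = (F (z + t%:C * h) - F z - c * (t%:C * h)) + (1 - t)%:C * (F z - u).
    have : c * h = - (F z - u) by rewrite /h mulrC divfK.
    rewrite rmorphB rmorph1; move: (F _) (F z) => A1 A2 E.
    have -> : c * (t%:C * h) = t%:C * (c * h) by ring.
    by rewrite E; ring.
  apply: le_lt_trans (nmD _ _) _; rewrite nmM nmR ger0_norm ?subr_ge0 //.
  have E : nm c / 2 * (t * nm h) = t / 2 * nm (F z - u) by rewrite -ch; field.
  rewrite E in K1.
  have : 0 < t * nm (F z - u) by rewrite mulr_gt0.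
  by move: K1; lra.
have [G HG] : exists G, forall u, sqr (F z0) r u -> nm (G u - z0) < s /\ F (G u) = u.
  have : forall u, exists z, sqr (F z0) r u -> nm (z - z0) < s /\ F z = u.
    move=> u; have [/surj[z Hz]|nu] := pselect (sqr (F z0) r u); first by exists z.
    by exists 0.
  by move=> /choice[G HG]; exists G.
exists F, G, s, r, (2 / nm c); split; first by rewrite /s /q; lra.
split => //.
- by rewrite divr_gt0.
- by move=> z zs; apply: FD; lra.
- by move=> z zs; have [|d] := df z; [lra|exact: cdiff_cont].
- move=> z zs; rewrite -nm_gt0; have := fc z; have := nm_tri c (f z) 0.
  by rewrite !subr0 (nm_distC c) -/c => K K'; have := K' (lt_trans zs sq); lra.
- by move=> z z' zs zs'; apply: lip; lra.
Qed.

End inverse_function.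

Section interval_bounds.
Variable R : realType.
Implicit Types x w k u v e : R.

Lemma interval_dist x w u v : x < u <= x + w -> x <= v <= x + w -> `|u - v| <= w.
Proof. by move=> /andP[? ?] /andP[? ?]; rewrite ler_norml; apply/andP; split; lra. Qed.

Lemma interval_grow x w k u v : x < u <= x + w -> `|u - v| <= k -> x - k < v <= x + w + k.
Proof. by rewrite ler_norml => /andP[? ?] /andP[? ?]; apply/andP; split; lra. Qed.

Lemma interval_shrink x w k u v : x + k < v <= x + w - k -> `|u - v| <= k -> x < u <= x + w.
Proof. by rewrite ler_norml => /andP[? ?] /andP[? ?]; apply/andP; split; lra. Qed.

Lemma interval_shrink_dist x w k u v : 0 <= k -> x + k < u <= x + w - k -> x <= v <= x + w -> `|u - v| <= w.
Proof. by move=> ? /andP[? ?] /andP[? ?]; rewrite ler_norml; apply/andP; split; lra. Qed.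

Lemma interval_grow_le x w k : 0 <= w -> 0 <= k -> x - k <= x + w + k.
Proof. by lra. Qed.

Lemma interval_shrink_le x w k : 2 * k <= w -> x + k <= x + w - k.
Proof. by lra. Qed.

Lemma area_error (n w h t e : R) : 0 <= w -> 0 <= h -> 0 < t -> t <= 1 -> t <= e / 26 -> 0 <= n ->
  n <= (1 + t) * ((w + 2 * (t * (w + h))) * (h + 2 * (t * (w + h)))) ->
  (2 * (t * (w + h)) <= w -> 2 * (t * (w + h)) <= h ->
    (1 - t) * ((w - 2 * (t * (w + h))) * (h - 2 * (t * (w + h)))) <= n) ->
  `|n - w * h| <= e * (w ^+ 2 + h ^+ 2).
Proof.
move=> w0 h0 t0 t1 te n0 up low.
have wh : 0 <= w * h by rewrite mulr_ge0.
have w2 := sqr_ge0 w; have h2 := sqr_ge0 h.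
set s := (w + h) ^+ 2.
have s0 : 0 <= s by exact: sqr_ge0.
have sE : s = w ^+ 2 + h ^+ 2 + 2 * (w * h) by rewrite /s; ring.
have s2 : s <= 2 * (w ^+ 2 + h ^+ 2) by have := sqr_ge0 (w - h); rewrite /s; lra.
have whs : w * h <= s by lra.
have est : 13 * (t * s) <= e * (w ^+ 2 + h ^+ 2).
  have : t * s <= e / 26 * (2 * (w ^+ 2 + h ^+ 2)) by apply: ler_pM => //; exact: ltW.
  by clear; lra.
have ts0 : 0 <= t * s by rewrite mulr_ge0 // ltW.
have ts1 : t * (t * s) <= t * s by rewrite ler_piMl.
have ts2 : t * (t * (t * s)) <= t * s by exact: le_trans (ler_wpM2l (ltW t0) ts1) ts1.
have ts3 : 0 <= t * (t * s) by rewrite mulr_ge0 // ltW.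
have twh : t * (w * h) <= t * s by rewrite ler_wpM2l // ltW.
have twh0 : 0 <= t * (w * h) by rewrite mulr_ge0 // ltW.
have upE : (1 + t) * ((w + 2 * (t * (w + h))) * (h + 2 * (t * (w + h)))) = w * h + t * (w * h) +
   2 * (t * s) + 6 * (t * (t * s)) + 4 * (t * (t * (t * s))) by rewrite /s; ring.
have lowE : (1 - t) * ((w - 2 * (t * (w + h))) * (h - 2 * (t * (w + h)))) = w * h - t * (w * h) -
   2 * (t * s) + 6 * (t * (t * s)) - 4 * (t * (t * (t * s))) by rewrite /s; ring.
rewrite {}upE in up; rewrite {}lowE in low.
have le1 : w * h <= s / 2 by lra.
have small (x : R) : x <= 2 * (t * (w + h)) -> x * (w + h) <= 2 * (t * s).
  move=> x2; apply: le_trans (ler_wpM2r (addr_ge0 w0 h0) x2) _.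
  by rewrite /s expr2 -!mulrA.
have wS : w * h <= w * (w + h) by rewrite ler_wpM2l // lerDr.
have hS : w * h <= h * (w + h) by rewrite mulrC ler_wpM2l // lerDl.
have {small} low' : - (13 * (t * s)) <= n - w * h.
  have [kw|/ltW/small kw] := leP (2 * (t * (w + h))) w; last by clear up low; lra.
  have [kh|/ltW/small kh] := leP (2 * (t * (w + h))) h; last by clear up low; lra.
  by have := low kw kh; clear up low; lra.
by rewrite ler_norml; apply/andP; split; clear low; lra.
Qed.
End interval_bounds.

Section plane_area.
Variable R : realType.
Notation C := (Cplx R).
Local Notation RR := (measurableTypeR R * measurableTypeR R)%type.
Local Notation lam := (@lebesgue_measure R).
Local Notation lam2 := (@lebesgue_measure R \x @lebesgue_measure R)%E.

Lemma lam2_rect (a b c d : R) : a <= b -> c <= d ->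
  lam2 ([set p | a < p.1 <= b /\ c < p.2 <= d] : set RR) = ((b - a) * (d - c))%:E.
Proof.
move=> ab cd.
have -> : ([set p | a < p.1 <= b /\ c < p.2 <= d] : set RR) = `]a, b]%classic `*` `]c, d]%classic.
  by apply/seteqP; split => p /=; rewrite !in_itv.
have E (x y : R) : x <= y -> lam (`]x, y]%classic : set (measurableTypeR R)) = (y - x)%:E.
  move=> xy; rewrite lebesgue_measure_itv /= lte_fin; case: ltP => // yx.
  by have -> : x = y by [apply/eqP; rewrite eq_le xy]; rewrite subrr.
rewrite [LHS](@product_measure1E _ _ _ _ R lam lam); [|exact: measurable_itv..].
by rewrite EFinM -!E.
Qed.

Definition ptp (p : RR) : C := pt p.1 p.2.

Lemma ptpK z : ptp (toRR z) = z. Proof. by case: z. Qed.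
Lemma toRRK p : toRR (ptp p) = p. Proof. by case: p. Qed.

Variables (f F G : C -> C) (z0 : C) (s r L : R).
Hypothesis cf : conformal f F G z0 s r L.

Let Dz : set RR := [set p | nm (ptp p - z0) < s].
Let E (D : set RR) : set RR := [set p | nm (ptp p - z0) < s /\ D (toRR (F (ptp p)))].
Let SQ : set RR := [set p | sqr (F z0) r (ptp p)].
Let g2 (p : RR) : R := nm (f (ptp p)) ^+ 2.

Let ptp_cont (p : R * R) : {for p, continuous (ptp : R * R -> C)}.
Proof. exact: pt_cont. Qed.

Let Dz_open : open (Dz : set (R * R)).
Proof.
rewrite openE => p Dp.
have : \forall q \near p, nm (ptp q - ptp p) < s - nm (ptp p - z0).
  by apply: (proj1 (@cvg_nm R _ (nbhs p) _ (ptp : R * R -> C) (ptp p)) (@ptp_cont p)); rewrite subr_gt0.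
apply: filterS => q qe; rewrite /Dz /=.
by have := nm_tri (ptp q) (ptp p) z0; lra.
Qed.

Let E_measurable D : measurable D -> measurable (E D).
Proof.
move=> mD.
have cg (p : R * R) : Dz p -> {for p, continuous ((fun p => F (ptp p)) : R * R -> C)}.
  move=> Dp; apply: (@continuous_comp _ _ _ (ptp : R * R -> C) F); first exact: ptp_cont.
  by apply: cdiff_cont; exact: (cf_diff cf).
exact: (continuous_measurable_toRR Dz_open cg (open_measurable2 Dz_open) mD).
Qed.

Let g2_measurable : measurable_fun Dz (g2 : RR -> measurableTypeR R).
Proof.
have H : measurable_fun Dz ((fun p => nm (f (ptp p))) : RR -> measurableTypeR R).
  apply: cont_preimage_measurableR => // p Dp.
  apply: (@continuous_comp _ _ _ (fun p => f (ptp p)) (@nm R)); last exact: nm_cont.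
  by apply: (@continuous_comp _ _ _ (ptp : R * R -> C) f); [exact: ptp_cont|exact: (cf_cont cf)].
exact: measurable_funX.
Qed.

Variable m : {measure set RR -> \bar R}.
Hypothesis m_fin : (m setT < +oo)%E.
Hypothesis mI : forall D, measurable D -> D `<=` SQ -> m D = (\int[lam2]_(p in E D) (g2 p)%:E)%E.

Let m_fin_num D : measurable D -> m D \is a fin_num.
Proof.
move=> mD; rewrite ge0_fin_numE ?measure_ge0 //; apply: le_lt_trans m_fin.
by apply: le_measure; rewrite ?inE.
Qed.

Let m_upper D D' (K : R) : measurable D -> D `<=` SQ -> measurable D' -> E D `<=` D' -> 0 <= K ->
  (forall p, E D p -> g2 p <= K) -> (m D <= K%:E * lam2 D')%E.
Proof.
move=> mD DS mD' ED K0 gK; rewrite mI //.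
apply: (@le_trans _ _ (\int[lam2]_(p in E D) K%:E)%E).
  apply: ge0_le_integral => //; first exact: E_measurable.
  - by move=> p _; rewrite lee_fin sqr_ge0.
  - apply/measurable_EFinP; apply: measurable_funS g2_measurable => //.
      exact: (open_measurable2 Dz_open).
    by move=> p [].
have mED := E_measurable mD.
rewrite integral_cst //.
apply: lee_pmul => //.
by apply: le_measure => //; rewrite inE //; exact: E_measurable.
Qed.

Let m_lower D D' (K : R) : measurable D -> D `<=` SQ -> measurable D' -> D' `<=` E D -> 0 <= K ->
  (forall p, E D p -> K <= g2 p) -> (K%:E * lam2 D' <= m D)%E.
Proof.
move=> mD DS mD' ED K0 gK; rewrite mI //.
apply: (@le_trans _ _ (\int[lam2]_(p in E D) K%:E)%E); last first.
  apply: ge0_le_integral => //; first exact: E_measurable.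
  - apply/measurable_EFinP; apply: measurable_funS g2_measurable => //.
      exact: (open_measurable2 Dz_open).
    by move=> p [].
have mED := E_measurable mD.
rewrite integral_cst //.
apply: lee_pmul => //.
by apply: le_measure => //; rewrite inE //; exact: E_measurable.
Qed.

Let hrect_measurable x y w h : measurable (hrect x y w h : set RR).
Proof.
rewrite measurable_ocrect; apply: sub_sigma_algebra.
by exists x, (x + w), y, (y + h).
Qed.

Let fits (x y w h : R) := forall p q, x <= p <= x + w -> y <= q <= y + h -> SQ (p, q).

Let hrect_SQ x y w h : fits x y w h -> hrect x y w h `<=` SQ.
Proof. by move=> H [p q] [/= /andP[/ltW x1 x2] /andP[/ltW y1 y2]]; apply: H; apply/andP. Qed.

(* Near a point, [F] is affine up to a small error, and the Jacobian of this
   affine map cancels the density of [m]. *)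
Let local_estimate (p q : R) : SQ (p, q) -> forall e, 0 < e ->
  exists2 d, 0 < d & forall x y w h, 0 <= w -> 0 <= h -> fits x y w h ->
    x <= p <= x + w -> y <= q <= y + h -> w < d -> h < d ->
    `|fine (m (hrect x y w h)) - w * h| <= e * (w ^+ 2 + h ^+ 2).
Proof.
move=> pqS e e0.
set u := ptp (p, q) in pqS *.
have [zs Fz] := cf_inv cf pqS.
set zeta := G u in zs Fz; set c := f zeta.
have k0 : 0 < nm c by rewrite nm_gt0; exact: (cf_neq0 cf).
set k := nm c in k0.
have L0 := cf_L cf.
pose eta := Num.min 1 (e / 26).
have eta0 : 0 < eta by rewrite lt_min ltr01; lra.
have eta1 : eta <= 1 by rewrite ge_min lexx.
have eta_e : eta <= e / 26 by rewrite ge_min lexx orbT.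
pose M := L + k^-1.
have ki0 : 0 < k^-1 by rewrite invr_gt0.
have M0 : 0 < M by rewrite /M addr_gt0.
have ek0 : 0 < k * (eta / 3) by rewrite mulr_gt0 //; lra.
have /cont_nmP /(_ _ ek0) [d1 d10 Hd1] := cf_cont cf zs.
have eM0 : 0 < eta / M by rewrite divr_gt0.
have [d2 d20 Hd2] := cf_diff cf zs eM0.
rewrite Fz -/c in Hd2.
pose d3 := s - nm (zeta - z0).
have d30 : 0 < d3 by rewrite subr_gt0.
pose d := Num.min d1 (Num.min d2 d3) / (2 * M).
have mm0 : 0 < Num.min d1 (Num.min d2 d3) by rewrite !lt_min d10 d20.
have d0 : 0 < d by rewrite divr_gt0 // mulr_gt0.
exists d => // x y w h w0 h0 fit px qy wd hd.
pose sg := w + h; pose kap := eta * sg.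
have sg0 : 0 <= sg by rewrite addr_ge0.
have kap0 : 0 <= kap by rewrite mulr_ge0 // ltW.
have Msg : M * sg < Num.min d1 (Num.min d2 d3).
  have : sg < 2 * d by rewrite /sg; lra.
  rewrite -(ltr_pM2l M0) => /lt_le_trans; apply.
  have -> : M * (2 * d) = Num.min d1 (Num.min d2 d3) by rewrite /d; field; rewrite gt_eqF.
  by [].
move: Msg; rewrite !lt_min => /and3P[Ms1 Ms2 Ms3].
have near (z : C) : nm (z - zeta) <= M * sg -> [/\ nm (z - z0) < s,
     k ^+ 2 * (1 - eta) <= nm (f z) ^+ 2 <= k ^+ 2 * (1 + eta) &
     nm (F z - (u + c * (z - zeta))) <= kap].
  move=> zM; split.
  - by have := nm_tri z zeta z0; rewrite /d3 in Ms3; lra.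
  - have := Hd1 z (le_lt_trans zM Ms1) => K.
    have K' := le_lt_trans (nm_dist (f z) c) K.
    move: K'; rewrite ltr_norml -/k => /andP[K1 K2].
    have l0 : 0 <= k * (1 - eta / 3) by rewrite mulr_ge0 ?ltW //; lra.
    have K1' : k * (1 - eta / 3) <= nm (f z) by lra.
    have K2' : nm (f z) <= k * (1 + eta / 3) by lra.
    have Q1 := ler_pM l0 l0 K1' K1'.
    have Q2 := ler_pM (nm_ge0 (f z)) (nm_ge0 (f z)) K2' K2'.
    have kk : 0 < k ^+ 2 by rewrite exprn_gt0.
    have e2 : eta ^+ 2 <= eta by rewrite expr2 ler_piMr // ltW.
    have e2' : 0 <= eta ^+ 2 by rewrite sqr_ge0.
    have R1 : k ^+ 2 * (1 - eta) <= k ^+ 2 * (1 - eta / 3) ^+ 2 by rewrite ler_wpM2l // ltW //; lra.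
    have R2 : k ^+ 2 * (1 + eta / 3) ^+ 2 <= k ^+ 2 * (1 + eta).
      by rewrite ler_wpM2l //; [exact: ltW|lra].
    apply/andP; split.
      by apply: le_trans R1 _; apply: le_trans Q1; rewrite -exprMn.
    by apply: le_trans R2; apply: le_trans Q2 _; rewrite -exprMn.
  - have := Hd2 z (le_lt_trans zM Ms2).
    rewrite opprD addrA => /le_trans; apply.
    apply: (@le_trans _ _ (eta / M * (M * sg))).
      by rewrite ler_wpM2l // ltW.
    by rewrite mulrA divfK ?gt_eqF.
pose T (v : RR) : RR := toRR (u + c * (ptp v - zeta)).
have scT : scales T (k ^+ 2)^-1.
  have := @scales_affine R (complex.Re c) (- complex.Im c) (complex.Im c) (complex.Re c)
    (complex.Re (u - c * zeta)) (complex.Im (u - c * zeta)).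
  have -> : complex.Re c * complex.Re c - - complex.Im c * complex.Im c = k ^+ 2.
    rewrite /k /nm; case: (c) => a b; rewrite /= sqr_sqrtr; first by ring.
    by rewrite addr_ge0 ?sqr_ge0.
  have kn : k ^+ 2 != 0 by rewrite expf_neq0 // gt_eqF.
  rewrite ger0_norm ?sqr_ge0 // => /(_ kn); apply: scales_ext.
  move=> v; rewrite /T /toRR; case: (c) (u) (zeta) => a b [u1 u2] [t1 t2] /=.
  by congr pair; ring.
have Tlam (B : set RR) : measurable B -> lam2 (T @^-1` B) = ((k ^+ 2)^-1%:E * lam2 B)%E.
  by case: scT => _; apply.
have mT (B : set RR) : measurable B -> measurable (T @^-1` B).
  by move=> mB; apply: preimage_measurable => //; case: scT.
have mQ := hrect_measurable x y w h.
have QS := hrect_SQ fit.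
have E_near v : E (hrect x y w h) v -> nm (ptp v - zeta) <= M * sg.
  move=> [vs [/= K1 K2]].
  apply: le_trans (cf_lip cf vs zs) _; rewrite Fz.
  apply: (@le_trans _ _ (L * sg)); last by rewrite ler_wpM2r // /M lerDl ltW.
  rewrite ler_wpM2l ?(ltW L0) //; apply: le_trans (nm_ReIm _) _.
  move: K1 K2; rewrite /u; case: (F (ptp v)) => v1 v2 /= K1 K2.
  by apply: lerD; [exact: interval_dist K1 px|exact: interval_dist K2 qy].
have T_near v : `|(T v).1 - p| <= w -> `|(T v).2 - q| <= h -> nm (ptp v - zeta) <= M * sg.
  move=> K1 K2.
  have : nm (c * (ptp v - zeta)) <= sg.
    apply: le_trans (nm_ReIm _) _; move: K1 K2; rewrite /T /u /= => K1 K2.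
    by move: K1 K2; case: (c * _) => a b /=; rewrite ![_ + a - _]addrAC ![_ + b - _]addrAC !subrr !add0r; exact: lerD.
  rewrite nmM -/k mulrC -ler_pdivlMr // => /le_trans; apply.
  by rewrite mulrC ler_wpM2r // /M lerDr ltW.
have Tw v : nm (ptp v - zeta) <= M * sg -> `|complex.Re (F (ptp v)) - (T v).1| <= kap /\
    `|complex.Im (F (ptp v)) - (T v).2| <= kap.
  move=> /near[_ _ K]; rewrite /T /=.
  have := nm_Re (F (ptp v) - (u + c * (ptp v - zeta))).
  have := nm_Im (F (ptp v) - (u + c * (ptp v - zeta))).
  case: (F _) (u + _) K => a b [a' b'] K /= K1 K2.
  by split; [apply: le_trans K2 K|apply: le_trans K1 K].
have kk : 0 < k ^+ 2 by rewrite exprn_gt0.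
have up : fine (m (hrect x y w h)) <= (1 + eta) * ((w + 2 * kap) * (h + 2 * kap)).
  rewrite -lee_fin fineK; last exact: m_fin_num.
  pose Qp := [set p | x - kap < p.1 <= x + w + kap /\ y - kap < p.2 <= y + h + kap] : set RR.
  have mQp : measurable Qp.
    by rewrite measurable_ocrect; apply: sub_sigma_algebra; exists (x - kap), (x + w + kap), (y - kap), (y + h + kap).
  have EQ : E (hrect x y w h) `<=` T @^-1` Qp.
    move=> v Ev; have [K1 K2] := Tw v (E_near v Ev).
    case: Ev => _ [/= K3 K4].
    by split; [exact: interval_grow K3 K1|exact: interval_grow K4 K2].
  have K0 : 0 <= k ^+ 2 * (1 + eta) by rewrite mulr_ge0 ?ltW //; lra.
  apply: le_trans (m_upper mQ QS (mT _ mQp) EQ K0 _) _.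
    by move=> v /E_near/near[_ /andP[]].
  have le1 : x - kap <= x + w + kap by exact: interval_grow_le.
  have le2 : y - kap <= y + h + kap by exact: interval_grow_le.
  rewrite Tlam // lam2_rect; [|by []..].
  rewrite -!EFinM lee_fin.
  have -> : x + w + kap - (x - kap) = w + 2 * kap by ring.
  have -> : y + h + kap - (y - kap) = h + 2 * kap by ring.
  by rewrite mulrACA mulfV ?gt_eqF // mul1r.
have low : 2 * kap <= w -> 2 * kap <= h ->
    (1 - eta) * ((w - 2 * kap) * (h - 2 * kap)) <= fine (m (hrect x y w h)).
  move=> kw kh; rewrite -lee_fin fineK; last exact: m_fin_num.
  pose Qm := [set p | x + kap < p.1 <= x + w - kap /\ y + kap < p.2 <= y + h - kap] : set RR.
  have mQm : measurable Qm.
    by rewrite measurable_ocrect; apply: sub_sigma_algebra; exists (x + kap), (x + w - kap), (y + kap), (y + h - kap).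
  have EQ : T @^-1` Qm `<=` E (hrect x y w h).
    move=> v [v1 v2].
    have vn : nm (ptp v - zeta) <= M * sg.
      by apply: T_near; [exact: interval_shrink_dist kap0 v1 px|exact: interval_shrink_dist kap0 v2 qy].
    have [K1 K2] := Tw v vn; have [K3 _ _] := near _ vn.
    by split => //; split; [exact: interval_shrink v1 K1|exact: interval_shrink v2 K2].
  have K0 : 0 <= k ^+ 2 * (1 - eta) by rewrite mulr_ge0 ?(ltW kk) // subr_ge0.
  apply: le_trans _ (m_lower mQ QS (mT _ mQm) EQ K0 _); last first.
    by move=> v /E_near/near[_ /andP[]].
  have le1 : x + kap <= x + w - kap by exact: interval_shrink_le.
  have le2 : y + kap <= y + h - kap by exact: interval_shrink_le.
  rewrite Tlam // lam2_rect; [|by []..].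
  rewrite -!EFinM lee_fin.
  have -> : x + w - kap - (x + kap) = w - 2 * kap by ring.
  have -> : y + h - kap - (y + kap) = h - 2 * kap by ring.
  by rewrite mulrACA mulfV ?gt_eqF // mul1r.
have m0 : 0 <= fine (m (hrect x y w h)) by rewrite fine_ge0 // measure_ge0.
by apply: (area_error (t := eta)).
Qed.

Let hrect_cutx x y w h : 0 <= w ->
  fine (m (hrect x y w h)) = fine (m (hrect x y (w / 2) h)) + fine (m (hrect (x + w / 2) y (w / 2) h)).
Proof.
move=> w0.
have -> : hrect x y w h = hrect x y (w / 2) h `|` hrect (x + w / 2) y (w / 2) h :> set RR.
  apply/seteqP; split => p; rewrite /hrect /=.
    move=> [/andP[p1 p2] ->]; have [K|K] := leP p.1 (x + w / 2); [left|right];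
    by split => //; apply/andP; split; lra.
  by move=> [[/andP[p1 p2] ->]|[/andP[p1 p2] ->]]; split => //; apply/andP; split; lra.
rewrite measureU //; first by rewrite fineD //; exact: m_fin_num.
apply/seteqP; split => // p [[/andP[_ p2] _] [/andP[p3 _] _]].
by move: (le_lt_trans p2 p3); rewrite ltxx.
Qed.

Let hrect_cuty x y w h : 0 <= h ->
  fine (m (hrect x y w h)) = fine (m (hrect x y w (h / 2))) + fine (m (hrect x (y + h / 2) w (h / 2))).
Proof.
move=> h0.
have -> : hrect x y w h = hrect x y w (h / 2) `|` hrect x (y + h / 2) w (h / 2) :> set RR.
  apply/seteqP; split => p; rewrite /hrect /=.
    move=> [-> /andP[p1 p2]]; have [K|K] := leP p.2 (y + h / 2); [left|right];
    by split => //; apply/andP; split; lra.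
  by move=> [[-> /andP[p1 p2]]|[-> /andP[p1 p2]]]; split => //; apply/andP; split; lra.
rewrite measureU //; first by rewrite fineD //; exact: m_fin_num.
apply/seteqP; split => // p [[_ /andP[_ p2]] [_ /andP[p3 _]]].
by move: (le_lt_trans p2 p3); rewrite ltxx.
Qed.

Let hrect_cut x y w h : 0 <= w -> 0 <= h ->
  fine (m (hrect x y w h)) = fine (m (hrect x y (w / 2) (h / 2))) + fine (m (hrect (x + w / 2) y (w / 2) (h / 2)))
   + fine (m (hrect x (y + h / 2) (w / 2) (h / 2))) + fine (m (hrect (x + w / 2) (y + h / 2) (w / 2) (h / 2))).
Proof.
move=> w0 h0; have w20 : 0 <= w / 2 by lra.
by rewrite hrect_cutx // (hrect_cuty _ _ (w / 2) h0) (hrect_cuty (x + _) _ (w / 2) h0); ring.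
Qed.

Let m_hrect x y w h : 0 <= w -> 0 <= h -> fits x y w h -> m (hrect x y w h) = (w * h)%:E.
Proof.
move=> w0 h0 fit.
have mf := m_fin_num (hrect_measurable x y w h).
have sub x' y' w' h' : [&& 0 <= w', 0 <= h', x <= x', x' + w' <= x + w, y <= y' & y' + h' <= y + h] ->
    [/\ 0 <= w', 0 <= h' & fits x' y' w' h'].
  move=> /and5P[? ? ? ? /andP[? ?]]; split => // p q /andP[? ?] /andP[? ?].
  by apply: fit; apply/andP; split; lra.
have up : fine (m (hrect x y w h)) - w * h <= 0.
  refine (@bisection R (fun x y w h => fine (m (hrect x y w h)) - w * h) x y w h w0 h0 _ _).
    by move=> x' y' w' h' /sub[w'0 h'0 _]; rewrite [in leLHS]hrect_cut //; lra.
  move=> p q px qy e e0; have [d d0 Hd] := local_estimate (fit _ _ px qy) e0.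
  exists d => // x' y' w' h' /sub[w'0 h'0 fit'] px' qy' wd hd.
  by apply: le_trans (ler_norm _) _; apply: Hd.
have low : w * h - fine (m (hrect x y w h)) <= 0.
  refine (@bisection R (fun x y w h => w * h - fine (m (hrect x y w h))) x y w h w0 h0 _ _).
    by move=> x' y' w' h' /sub[w'0 h'0 _]; rewrite [in leLHS]hrect_cut //; lra.
  move=> p q px qy e e0; have [d d0 Hd] := local_estimate (fit _ _ px qy) e0.
  exists d => // x' y' w' h' /sub[w'0 h'0 fit'] px' qy' wd hd.
  by apply: le_trans (ler_norm _) _; rewrite distrC; apply: Hd.
by rewrite -[LHS]fineK //; congr EFin; lra.
Qed.

Lemma plane_area (rho : R) : rho < r -> forall D, measurable D ->
  D `<=` [set p | sqr (F z0) rho (ptp p)] -> m D = lam2 D.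
Proof.
move=> rr D mD Dr.
pose u := F z0.
pose HQ := [set p | complex.Re u - rho < p.1 <= complex.Re u + rho /\
  complex.Im u - rho < p.2 <= complex.Im u + rho] : set RR.
have mHQ : measurable HQ.
  by rewrite measurable_ocrect; apply: sub_sigma_algebra; do 4!eexists.
have DHQ : D `<=` HQ.
  move=> p /Dr; rewrite /HQ /sqr -/u /=; case: p (u) => p q [u1 u2] /=.
  by rewrite !ltr_norml => -[/andP[? ?] /andP[? ?]]; split; apply/andP; split; lra.
have HQS p q : complex.Re u - rho <= p <= complex.Re u + rho ->
    complex.Im u - rho <= q <= complex.Im u + rho -> SQ (p, q).
  rewrite /SQ /sqr /= -/u; case: (u) => u1 u2 /= /andP[? ?] /andP[? ?].
  by split; rewrite ltr_norml; apply/andP; split; lra.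
have key : mrestr m mHQ D = mrestr lam2 mHQ D.
  apply: plane_measure_unique => //; last first.
    by rewrite /= /mrestr setTI; apply: le_lt_trans m_fin; apply: le_measure; rewrite ?inE.
  move=> a b c d; pose Q : set RR := [set p | a < p.1 <= b /\ c < p.2 <= d].
  rewrite -[LHS]/(m (Q `&` HQ)) -[RHS]/(lam2 (Q `&` HQ)).
  have -> : Q `&` HQ =
    [set p | Num.max a (complex.Re u - rho) < p.1 <= Num.min b (complex.Re u + rho) /\
             Num.max c (complex.Im u - rho) < p.2 <= Num.min d (complex.Im u + rho)] :> set RR.
    apply/seteqP; split => p; rewrite /Q /HQ /= !gt_max !le_min.
      by move=> [[/andP[-> ->] /andP[-> ->]] [/andP[-> ->] /andP[-> ->]]].
    by move=> [/andP[/andP[-> ->] /andP[-> ->]] /andP[/andP[-> ->] /andP[-> ->]]].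
  have [h1 h2 h3 h4] : [/\ complex.Re u - rho <= Num.max a (complex.Re u - rho),
     Num.min b (complex.Re u + rho) <= complex.Re u + rho,
     complex.Im u - rho <= Num.max c (complex.Im u - rho) &
     Num.min d (complex.Im u + rho) <= complex.Im u + rho].
    by rewrite !le_max !ge_min !lexx !orbT.
  move: h1 h2 h3 h4; move: (Num.max a _) (Num.min b _) (Num.max c _) (Num.min d _) => a' b' c' d' h1 h2 h3 h4.
  have [ab|ab] := leP a' b'; last first.
    have -> : [set p | a' < p.1 <= b' /\ c' < p.2 <= d'] = set0 :> set RR.
      by apply/seteqP; split => // p [/andP[? ?] _] /=; lra.
    by rewrite measure0 [RHS]measure0.
  have [cd|cd] := leP c' d'; last first.
    have -> : [set p | a' < p.1 <= b' /\ c' < p.2 <= d'] = set0 :> set RR.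
      by apply/seteqP; split => // p [_ /andP[? ?]] /=; lra.
    by rewrite measure0 [RHS]measure0.
  rewrite [RHS]lam2_rect //.
  have -> : [set p | a' < p.1 <= b' /\ c' < p.2 <= d'] = hrect a' c' (b' - a') (d' - c') :> set RR.
    by rewrite /hrect !(addrC _ (_ - _)) !subrK.
  apply: m_hrect; rewrite ?subr_ge0 //.
  move=> p q; rewrite !(addrC _ (_ - _)) !subrK => /andP[? ?] /andP[? ?].
  by apply: HQS; apply/andP; split; lra.
by move: key; rewrite /mrestr !setIidl.
Qed.

End plane_area.

Section injective_primitive.
Variable R : realType.
Notation C := (Cplx R).
Implicit Types (z : C) (f W : C -> C).

Lemma cdiffB f g z d d' : cdiff f z d -> cdiff g z d' -> cdiff (fun w => f w - g w) z (d - d').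
Proof. by move=> /cdiff_is_derive df /cdiff_is_derive dg; apply/cdiff_is_derive; exact: is_deriveB. Qed.

Lemma cdiff_id z : cdiff id z 1.
Proof. by move=> e e0; exists 1 => // w _; rewrite mul1r subrr nm0 mulr_ge0 ?nm_ge0 // ltW. Qed.

Lemma cdiff_cst z (c : C) : cdiff (fun=> c) z 0.
Proof. by move=> e e0; exists 1 => // w _; rewrite mul0r !subrr nm0 mulr_ge0 ?nm_ge0 // ltW. Qed.

Lemma derivable_inv_neq0 f z : derivable f z 1 -> f z != 0 -> derivable (fun w => (f w)^-1) z 1.
Proof. by move=> df f0; exact: (@derivableV _ _ f). Qed.

Lemma quotient_cdiff f W z (d : C) (r : R) : 0 < r ->
  (forall w, nm (w - z) < r -> cdiff W w (f w)) -> cdiff f z d ->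
  cdiff (fun w => if w == z then f z else (W w - W z) / (w - z)) z (d / 2).
Proof.
move=> r0 dW df e e0.
have [r1 r10 H1] := df e e0.
exists (Num.min r r1) => [|w]; first by rewrite lt_min r0.
rewrite lt_min eqxx => /andP[wr wr1].
have [->|wz] := eqVneq w z; first by rewrite !subrr mulr0 subr0 nm0 mulr0.
have n0 : 0 < nm (w - z) by rewrite nm_gt0 subr_eq0.
pose P w : C := W w - d / 2 * (w - z) ^+ 2.
have dP v : nm (v - z) < r -> cdiff P v (f v - d * (v - z)).
  move=> vr; apply: cdiffB; first exact: dW.
  move=> e' e'0; have nn : 0 < nm (d / 2) + 1 by rewrite ltr_wpDl ?nm_ge0.
  exists (e' / (nm (d / 2) + 1)); first exact: divr_gt0.
  move=> v'; rewrite ltr_pdivlMr // => K.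
  have -> : d / 2 * (v' - z) ^+ 2 - d / 2 * (v - z) ^+ 2 - d * (v - z) * (v' - v) = d / 2 * (v' - v) * (v' - v).
    by field.
  rewrite 2!nmM ler_wpM2r ?nm_ge0 // mulrC; apply: le_trans (ltW K).
  by rewrite ler_wpM2l ?nm_ge0 // lerDl.
have seg (t : R) : 0 <= t <= 1 -> nm (z + t%:C * (w - z) - z) <= nm (w - z).
  move=> /andP[t0 t1]; rewrite addrC addKr nmM nmR ger0_norm //.
  by rewrite ler_piMl ?nm_ge0.
have := @cdiff_mvi R P (fun v => f v - d * (v - z)) (f z) z w (e * nm (w - z)).
have -> : P w - P z - f z * (w - z) = (W w - W z - f z * (w - z)) - d / 2 * (w - z) * (w - z).
  by rewrite /P subrr; ring.
move=> K.
have {K} : nm (W w - W z - f z * (w - z) - d / 2 * (w - z) * (w - z)) <= e * nm (w - z) * nm (w - z).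
  apply: K => t t01; have st := seg t t01.
    by apply: dP; exact: le_lt_trans wr.
  rewrite addrAC; apply: le_trans (H1 _ (le_lt_trans st wr1)) _.
  by rewrite ler_wpM2l // ltW.
have -> : (W w - W z) / (w - z) - f z - d / 2 * (w - z) =
   (W w - W z - f z * (w - z) - d / 2 * (w - z) * (w - z)) / (w - z).
  by field; rewrite subr_eq0.
by rewrite nmM nmV => K; rewrite ler_pdivrMr.
Qed.

Lemma circle_compact z (r : R) : compact [set w : C | nm (w - z) = r].
Proof.
apply: (@subclosed_compact _ _ (rect (complex.Re z - r) (complex.Im z - r) (2 * r) (2 * r))); last first.
- move=> w /= wr; have := nm_Re (w - z); have := nm_Im (w - z); rewrite wr /rect.
  by case: w z {wr} => ? ? [? ?] /=; rewrite !ler_norml => /andP[? ?] /andP[? ?]; split; apply/andP; split; lra.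
- exact: rect_compact.
have -> : [set w : C | nm (w - z) = r] = (fun w : C => nm (w - z)) @^-1` [set r] by [].
apply: preimage_closed; last exact: closed_eq.
move=> w _; apply: (@continuous_comp _ _ _ (fun w => w - z) (@nm R)); last exact: nm_cont.
by apply: cdiff_cont (cdiffB (cdiff_id w) (cdiff_cst w z)).
Qed.

(* For [z1] near [z0], the function [(z - z1) / (W z - W z1)] is holomorphic, and
   is bounded on a circle around [z0] independently of [z1]; for [z1] close to
   [z0] its value at [z0] is of the order of [1 / f z0]. *)
Lemma injective_primitive_neq0 f W z0 (r : R) : 0 < r ->
  (forall w, nm (w - z0) < r -> cdiff W w (f w)) ->
  (forall w, nm (w - z0) < r -> exists d, cdiff f w d) ->
  (forall w w', nm (w - z0) < r -> nm (w' - z0) < r -> W w = W w' -> w = w') ->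
  f z0 != 0.
Proof.
move=> r0 dW df injW; apply/eqP => f0.
pose rho := r / 2.
have rho0 : 0 < rho by rewrite /rho; lra.
have rr : rho < r by rewrite /rho; lra.
have z0r : nm (z0 - z0) < r by rewrite subrr nm0.
have [m [m0 Hm]] : exists m, 0 < m /\ forall w, nm (w - z0) = rho -> m <= nm (W w - W z0).
  have cW : {within [set w : C | nm (w - z0) = rho], continuous (fun w => nm (W w - W z0))}.
    move=> x; apply: continuous_in_subspaceT => w; rewrite inE /= => wr.
    apply: (@continuous_comp _ _ _ (fun w => W w - W z0) (@nm R)); last exact: nm_cont.
    by apply: cdiff_cont (cdiffB (dW w _) (cdiff_cst w (W z0))); rewrite wr.
  have [||c +] := compact_EVT_min _ _ cW.
  - by exists (z0 + rho%:C); rewrite /= addrC addKr nmR gtr0_norm.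
  - exact: circle_compact.
  rewrite inE /= => cr Hc; exists (nm (W c - W z0)); split.
    rewrite nm_gt0 subr_eq0; apply/eqP => /injW E.
    have := rho0; rewrite -cr E ?subrr ?nm0 ?ltxx //.
    by rewrite cr.
  by move=> w wr; apply: Hc; rewrite inE.
have q0 : 0 < m / (8 * rho) by rewrite divr_gt0 // mulr_gt0.
have [r1 r10 H1] := dW z0 z0r _ q0.
have m2 : 0 < m / 2 by lra.
have /cont_nmP /(_ _ m2) [r2 r20 H2] := cdiff_cont (dW z0 z0r).
pose s := Num.min rho (Num.min r1 r2).
have s0 : 0 < s by rewrite !lt_min rho0 r10.
have [sr [s1 s2]] : s <= rho /\ s <= r1 /\ s <= r2 by rewrite /s !ge_min !lexx !orbT.
have [z1 [z1s fz1]] : exists z1, nm (z1 - z0) < s /\ f z1 != 0.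
  apply: contrapT => H.
  have fz w : nm (w - z0) < s -> f w = 0.
    by move=> ws; apply/eqP; apply: contrapT => /negP fw; apply: H; exists w.
  pose w := z0 + (s / 2)%:C.
  have ws : nm (w - z0) = s / 2 by rewrite /w addrC addKr nmR gtr0_norm //; lra.
  have K := @cdiff_mvi R W f 0 z0 w 0.
  have : nm (W w - W z0 - 0 * (w - z0)) <= 0 * nm (w - z0).
    apply: K => t /andP[t0 t1].
      apply: dW; rewrite addrC addKr nmM nmR ger0_norm // ws.
      by have := ler_pM t0 (ltW s0) t1 (lexx s); lra.
    rewrite fz ?subrr ?nm0 // addrC addKr nmM nmR ger0_norm // ws.
    by have := ler_pM t0 (ltW s0) t1 (lexx s); lra.
  rewrite !mul0r subr0 => WE.
  have Wz : W w = W z0 by apply/eqP; rewrite -subr_eq0 -nm_eq0 eq_le WE nm_ge0.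
  have wr : nm (w - z0) < r by rewrite ws; lra.
  by move: ws; rewrite (injW _ _ wr z0r Wz) subrr nm0; lra.
have z1r : nm (z1 - z0) < r by lra.
have z10 : z1 != z0 by apply: contraNneq fz1 => ->; rewrite f0.
have n1 : 0 < nm (z1 - z0) by rewrite nm_gt0 subr_eq0.
pose Q w : C := if w == z1 then f z1 else (W w - W z1) / (w - z1).
have Q0 w : nm (w - z0) < r -> Q w != 0.
  move=> wr; rewrite /Q; have [//|wz] := eqVneq w z1.
  rewrite mulf_neq0 ?invr_eq0 ?subr_eq0 //.
  by apply: contraNneq wz => /(injW _ _ wr z1r) ->.
have dQ w : nm (w - z0) < r -> derivable Q w 1.
  move=> wr; have [->|wz] := eqVneq w z1.
    apply/derivable_cdiff; have [d fd] := df z1 z1r.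
    exists (d / 2); apply: (@quotient_cdiff f W z1 d (r - nm (z1 - z0))) => //.
      by rewrite subr_gt0.
    by move=> v vr; apply: dW; have := nm_tri v z1 z0; lra.
  apply/derivable_cdiff.
  have : derivable (fun w => (W w - W z1) / (w - z1)) w 1.
    apply: (@derivableM _ _ (fun w => W w - W z1) (fun w => (w - z1)^-1)).
      apply: derivableB; last exact: derivable_cst.
      by apply/derivable_cdiff; exists (f w); exact: dW.
    apply: (@derivableV _ _ (fun w => w - z1)); first by rewrite subr_eq0.
    by apply: derivableB; [exact: derivable_id|exact: derivable_cst].
  move=> /derivable_cdiff[d Hd]; exists d.
  apply: (@cdiff_near _ _ _ _ _ (nm (w - z1))) Hd; first by rewrite nm_gt0 subr_eq0.
  move=> v vw; rewrite /Q; case: eqP => // vz; move: vw.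
  by rewrite vz nm_distC ltxx.
have K : nm ((Q z0)^-1) <= 4 * rho / m.
  apply: (@circle_bound R (fun w => (Q w)^-1) z0 rho) => //.
    move=> w wr; apply/derivable_cdiff; apply: derivable_inv_neq0; first by apply: dQ; lra.
    by apply: Q0; lra.
  move=> w wr; rewrite /Q; have wz : w != z1.
    by apply/eqP => E; move: z1s; rewrite -E wr; lra.
  rewrite (negbTE wz) invf_div nmM nmV.
  have A1 : nm (w - z1) <= 2 * rho.
    by have := nm_tri w z0 z1; rewrite (nm_distC z0 z1) wr; lra.
  have A2 : m / 2 <= nm (W w - W z1).
    have := Hm w wr; have := nm_tri (W w) (W z1) (W z0).
    by have := H2 z1 (lt_le_trans z1s s2); lra.
  have A3 : 0 < nm (W w - W z1) by lra.
  rewrite ler_pdivrMr // mulrAC ler_pdivlMr //.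
  apply: (@le_trans _ _ (2 * rho * m)); first by rewrite ler_wpM2r // ltW.
  have : 2 * rho * m <= 2 * rho * (2 * nm (W w - W z1)) by rewrite ler_wpM2l //; lra.
  by lra.
have := H1 z1 (lt_le_trans z1s s1); rewrite f0 mul0r subr0 => K1.
move: K; rewrite /Q eq_sym (negbTE z10) invf_div nmM nmV.
have nW : 0 < nm (W z0 - W z1).
  by rewrite nm_gt0 subr_eq0; apply: contraNneq z10 => /(injW _ _ z0r z1r) ->.
rewrite ler_pdivrMr // nm_distC (nm_distC (W z0)) => K2.
have : 4 * rho / m * nm (W z1 - W z0) <= 4 * rho / m * (m / (8 * rho) * nm (z1 - z0)).
  by rewrite ler_wpM2l //; apply: divr_ge0; lra.
have -> : 4 * rho / m * (m / (8 * rho) * nm (z1 - z0)) = nm (z1 - z0) / 2.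
  by field; rewrite !gt_eqF //; lra.
by lra.
Qed.

End injective_primitive.

(** * Flat boxes *)

Section borel_sets.
Variables (R : realType) (S : ptopologicalType).
Notation C := (Cplx R).
Local Notation RR := (measurableTypeR R * measurableTypeR R)%type.

Lemma borel_open (A : set S) : open A -> measurable (A : set (borel S)).
Proof. by move=> oA; apply: sub_sigma_algebra. Qed.

Lemma borel_closed (A : set S) : closed A -> measurable (A : set (borel S)).
Proof.
move=> cA; rewrite -(setCK A); apply: (@measurableC _ (borel S)).
by apply: borel_open; exact: closed_openC.
Qed.

Lemma borel_continuous (T : ptopologicalType) (D : set S) (g : S -> T) :
  open D -> (forall p, D p -> {for p, continuous g}) ->
  measurable_fun (D : set (borel S)) (g : borel S -> borel T).
Proof.
move=> oD cg; apply: (measurability _ (erefl : @measurable _ (borel T) = <<s (@open T) >>)).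
move=> _ [B oB <-]; apply: borel_open; rewrite openE => p [Dp Bgp].
have nD : nbhs p D by exact: open_nbhs_nbhs.
have nB : nbhs p (g @^-1` B) by apply: (cg p Dp); exact: open_nbhs_nbhs.
exact: filterI.
Qed.

Lemma borel_continuousR (D : set S) (g : S -> R) :
  open D -> (forall p, D p -> {for p, continuous g}) ->
  measurable_fun (D : set (borel S)) (g : borel S -> measurableTypeR R).
Proof.
move=> oD cg mD Y mY.
have := @borel_continuous R D g oD cg mD; apply.
move: Y mY; apply: smallest_sub; first exact: smallest_sigma_algebra.
move=> _ [[a b] _ <-].
have -> : `]a, b]%classic = `]a, +oo[%classic `\` `]b, +oo[%classic :> set R.
  apply/seteqP; split => x /=; rewrite !in_itv /= !andbT.
    by move=> /andP[-> xb]; split => //; apply/negP; rewrite -leNgt.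
  by move=> [-> /negP]; rewrite -leNgt.
by apply: (@measurableD _ (borel R)); apply: sub_sigma_algebra; exact: rray_open.
Qed.

Lemma borel_continuous_toRR (D : set S) (g : S -> C) :
  open D -> (forall p, D p -> {for p, continuous g}) ->
  measurable_fun (D : set (borel S)) (fun p : borel S => toRR (g p)).
Proof.
move=> oD cg; apply: measurable_fun_toRR.
  apply: borel_continuousR => // p Dp.
  by apply: (@continuous_comp _ _ _ g (fun z : C => complex.Re z)); [exact: cg|exact: cont_Re].
apply: borel_continuousR => // p Dp.
by apply: (@continuous_comp _ _ _ g (fun z : C => complex.Im z)); [exact: cg|exact: cont_Im].
Qed.

Lemma nbhs_sqr (c z : C) (r : R) : sqr c r z -> nbhs z (sqr c r).
Proof.
move=> [z1 z2]; apply/nbhs_nm.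
exists (Num.min (r - `|complex.Re (z - c)|) (r - `|complex.Im (z - c)|)).
  by rewrite lt_min !subr_gt0 z1.
move=> w; rewrite lt_min => /andP[w1 w2]; have := nm_Re (w - z); have := nm_Im (w - z).
have -> : complex.Re (w - z) = complex.Re (w - c) - complex.Re (z - c).
  by case: w z c {z1 z2 w1 w2} => ? ? [? ?] [? ?] /=; ring.
have -> : complex.Im (w - z) = complex.Im (w - c) - complex.Im (z - c).
  by case: w z c {z1 z2 w1 w2} => ? ? [? ?] [? ?] /=; ring.
move=> K1 K2; split.
  have := ler_normD (complex.Re (w - c) - complex.Re (z - c)) (complex.Re (z - c)).
  by rewrite subrK; lra.
have := ler_normD (complex.Im (w - c) - complex.Im (z - c)) (complex.Im (z - c)).
by rewrite subrK; lra.
Qed.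

Lemma nbhs_disc (c z : C) (r : R) : nm (z - c) < r -> nbhs z [set z | nm (z - c) < r].
Proof.
move=> zr; apply/nbhs_nm; exists (r - nm (z - c)); first by rewrite subr_gt0.
by move=> w wz /=; have := nm_tri w z c; lra.
Qed.

Lemma sqr_center (c : C) (r : R) : 0 < r -> sqr c r c.
Proof. by move=> r0; rewrite /sqr /= subrr /= normr0. Qed.

Lemma sqr_sub (c : C) (r r' : R) : r <= r' -> sqr c r `<=` sqr c r'.
Proof. by move=> rr z [z1 z2]; split; lra. Qed.
End borel_sets.

Section flat_box.
Variables (R : realType) (S : ptopologicalType) (X : riemann_surface R S).
Variables (a : abelian_differential X) (mu : {measure set (borel S) -> \bar R}).
Notation C := (Cplx R).
Local Notation RR := (measurableTypeR R * measurableTypeR R)%type.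
Local Notation lam2 := (@lebesgue_measure R \x @lebesgue_measure R)%E.

Implicit Types (i j : atlas_index X) (p q : S).

Lemma nonzero_coef i p : ~ zeros a p -> in_chart i p -> coef a i (local_coord i p) != 0.
Proof. by move=> nz ip; apply/eqP => e; apply: nz; exists i. Qed.

Lemma coef_nonzero i p : in_chart i p -> coef a i (local_coord i p) != 0 -> ~ zeros a p.
Proof.
move=> ip c0 [j [jp cj]]; move: c0.
by rewrite (coef_transition a ip jp) cj mul0r eqxx.
Qed.

Lemma local_coordK i p : in_chart i p -> local_inv i (local_coord i p) = p.
Proof. exact: chart_mapK. Qed.

Lemma local_coord_cont i p : in_chart i p -> {for p, continuous (local_coord i)}.
Proof. exact: chart_map_cont. Qed.

Lemma local_inv_cont i p : in_chart i p -> {for local_coord i p, continuous (local_inv i)}.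
Proof. by move=> ip; apply: chart_inv_cont; exists p. Qed.

Lemma in_chart_nbhs i p : in_chart i p -> nbhs p (in_chart i).
Proof. by move=> ip; apply: open_nbhs_nbhs; split => //; exact: chart_dom_open. Qed.

Lemma chart_disc i p (N : set S) : in_chart i p -> nbhs p N ->
  exists2 d, 0 < d & forall z, nm (z - local_coord i p) < d ->
    [/\ in_chart i (local_inv i z), N (local_inv i z) & local_coord i (local_inv i z) = z].
Proof.
move=> ip Np.
have /nbhs_nm[d1 d10 H1] : nbhs (local_coord i p) (local_coord i @` in_chart i).
  by apply: open_nbhs_nbhs; split; [exact: chart_img_open|exists p].
have /nbhs_nm[d2 d20 H2] : nbhs (local_coord i p) (local_inv i @^-1` N).
  by apply: local_inv_cont => //; rewrite local_coordK.
exists (Num.min d1 d2) => [|z]; first by rewrite lt_min d10.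
rewrite lt_min => /andP[/H1[q iq <-] /H2]; rewrite /= local_coordK //.
Qed.

Record flat_box (U : set S) (w : S -> C) (phi : C -> S) (c : C) (r : R) : Prop := FlatBox {
  fb_r : 0 < r ;
  fb_chart : translation_chart a U w ;
  fb_w : forall q, U q -> [/\ sqr c r (w q), phi (w q) = q, {for q, continuous w} & ~ zeros a q] ;
  fb_phi : forall z, sqr c r z -> [/\ U (phi z), w (phi z) = z & {for z, continuous phi}] ;
  fb_area : forall A : set S, measurable (A : set (borel S)) -> A `<=` U ->
    mu A = lam2 ([set p | sqr c r (ptp p) /\ A (phi (ptp p))] : set RR) }.

Hypothesis mu_area : is_area_measure a mu.
Hypothesis mu_finite : (mu [set: S] < +oo)%E.

Lemma flat_box_ex p (N : set S) : ~ zeros a p -> nbhs p N ->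
  exists U w phi r, [/\ flat_box U w phi (w p) r, U p & U `<=` N].
Proof.
move=> nzp Np; have [i ip] := atlas_cover X p.
set z0 := local_coord i p.
have [d0 d00 Hd0] := chart_disc ip Np.
rewrite -/z0 in Hd0.
have df z : nm (z - z0) < d0 -> exists d, cdiff (coef a i) z d.
  move=> /Hd0[iq _ zE]; apply/derivable_cdiff; rewrite -zE; exact: coef_holomorphic.
have [F [G [s [r [L [sd cf]]]]]] := inverse_function d00 df (nonzero_coef nzp ip).
rewrite -/z0 in cf.
have Hz z : nm (z - z0) < s ->
    [/\ in_chart i (local_inv i z), N (local_inv i z) & local_coord i (local_inv i z) = z].
  by move=> zs; apply: Hd0; apply: lt_trans sd.
pose w q := F (local_coord i q).
pose phi u := local_inv i (G u).
pose B (rho : R) : set S := [set q | [/\ in_chart i q, nm (local_coord i q - z0) < s & sqr (F z0) rho (w q)]].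
have w_cont q : in_chart i q -> nm (local_coord i q - z0) < s -> {for q, continuous w}.
  move=> iq qs; apply: (@continuous_comp _ _ _ (local_coord i) F); first exact: local_coord_cont.
  by apply: cdiff_cont; exact: (cf_diff cf).
have B_open rho : open (B rho).
  rewrite openE => q [iq qs qr].
  have n1 : nbhs q (in_chart i) := in_chart_nbhs iq.
  have n2 : nbhs q [set q | nm (local_coord i q - z0) < s].
    exact: (local_coord_cont iq) (nbhs_disc qs).
  have n3 : nbhs q [set q | sqr (F z0) rho (w q)] := w_cont q iq qs _ (nbhs_sqr qr).
  by apply: filterS3 n1 n2 n3 => q'; split.
have Bw q rho : B rho q -> rho <= r -> phi (w q) = q.
  move=> [iq qs qr] rr; have [Gs FG] := cf_inv cf (sqr_sub rr qr).
  rewrite /phi -[RHS](local_coordK iq); congr (local_inv i _).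
  apply/eqP; rewrite -subr_eq0 -nm_eq0 eq_le nm_ge0 andbT.
  by apply: le_trans (cf_lip cf Gs qs) _; rewrite FG subrr nm0 mulr0.
have Bphi u rho : sqr (F z0) rho u -> rho <= r -> [/\ B rho (phi u), w (phi u) = u & {for u, continuous phi}].
  move=> ur rr; have [Gs FG] := cf_inv cf (sqr_sub rr ur).
  have [iq _ zE] := Hz _ Gs.
  have wE : w (phi u) = u by rewrite /w /phi zE.
  split => //; first by split; rewrite ?wE //= /phi zE.
  apply: (@continuous_comp _ _ _ G (local_inv i)); last first.
    by rewrite -[X in {for X, continuous _}]zE; exact: local_inv_cont.
  apply/cont_nmP => e e0.
  have /nbhs_nm[r1 r10 Hr1] := nbhs_sqr (sqr_sub rr ur).
  exists (Num.min r1 (e / L)); first by rewrite lt_min r10 divr_gt0 // (cf_L cf).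
  move=> v; rewrite lt_min ltr_pdivlMr ?(cf_L cf) // => /andP[/Hr1 vr vu].
  have [Gvs FGv] := cf_inv cf vr.
  by apply: le_lt_trans (cf_lip cf Gvs Gs) _; rewrite FG FGv mulrC.
have r0 := cf_r cf.
have pB rho : 0 < rho -> B rho p.
  by move=> rho0; split; [exact: ip|rewrite subrr nm0; exact: (cf_s cf)|exact: sqr_center].
have r2 : 0 < r / 2 by lra.
have r2r : r / 2 < r by lra.
have BN : B (r / 2) `<=` N.
  by move=> q [iq qs _]; have [_ Nq _] := Hz _ qs; rewrite local_coordK in Nq.
exists (B (r / 2)), w, phi, (r / 2); split; [split => //|exact: pB|exact: BN].
- split; first exact: B_open.
    move=> q q' Bq Bq' E; rewrite -(Bw q _ Bq (ltW r2r)) -(Bw q' _ Bq' (ltW r2r)).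
    by rewrite E.
  move=> j q [iq qs qr] jq; apply/cdiff_is_derive.
  rewrite (coef_transition a jq iq).
  apply: (@cdiff_comp _ F (local_coord i \o local_inv j)); last first.
    by rewrite /= local_coordK //; exact: (cf_diff cf).
  have [d Hd] := (derivable_cdiff _ _).1 (atlas_holomorphic jq iq).
  have /cdiff_is_derive[_ dE] := Hd.
  by rewrite derive1E dE.
- move=> q Bq; have [iq qs qr] := Bq; split => //.
  + exact: Bw Bq (ltW r2r).
  + exact: w_cont.
  + by apply: (coef_nonzero iq); exact: (cf_neq0 cf).
- by move=> u ur; apply: Bphi => //; exact: ltW.
pose Ub := B r.
have mUb : measurable (Ub : set (borel S)) by apply: borel_open; exact: (B_open r).
have mw := @borel_continuous_toRR R S Ub w (B_open r).
have {}mw : measurable_fun (Ub : set (borel S)) (fun q : borel S => toRR (w q)).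
  by apply: mw => q [iq qs _]; exact: w_cont.
pose g (q : borel S) : RR := if pselect (Ub q) then toRR (w q) else (0, 0).
have mg : measurable_fun setT g.
  move=> _ Y mY; rewrite setTI.
  have -> : g @^-1` Y = (Ub `&` (fun q => toRR (w q)) @^-1` Y) `|` (~` Ub `&` [set q | Y (0, 0)]).
    apply/seteqP; split => q; rewrite /g /preimage /mkset.
      by case: pselect => Uq Yq; [left|right].
    by case: pselect => Uq [[? ?]|[? ?]].
  apply: measurableU; first exact: mw.
  have [Y0|Y0] := pselect (Y (0, 0)).
    by rewrite (_ : [set q | Y (0, 0)] = setT) ?setIT; [exact: measurableC|apply/seteqP; split].
  by rewrite (_ : [set q | Y (0, 0)] = set0) ?setI0; [exact: measurable0|apply/seteqP; split => // q /Y0].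
have [m mE] := pushforward_ex (mrestr mu mUb) mg ler01.
have {}mE D : m D = mu [set q | Ub q /\ D (toRR (w q))].
  rewrite mE mul1e /= /mrestr; congr (mu _).
  apply/seteqP; split => q /= [].
    by rewrite /g; case: pselect.
  by move=> Uq Dq; split => //; rewrite /g; case: pselect.
have m_fin : (m setT < +oo)%E.
  rewrite mE (_ : [set q | _] = Ub); last by apply/seteqP; split => q //= [].
  by apply: le_lt_trans mu_finite; apply: le_measure; rewrite ?inE.
have mI (D : set RR) : measurable D -> D `<=` [set p | sqr (F z0) r (ptp p)] ->
    m D = (\int[lam2]_(p in [set p | (nm (ptp p - z0) < s)%R /\ D (toRR (F (ptp p)))]) ((nm (coef a i (ptp p)) ^+ 2)%R)%:E)%E.
  move=> mD DS; rewrite mE.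
  rewrite (@mu_area i); first last.
  - by move=> q [[]].
  - exact: mw.
  congr (integral _ _ _); apply/seteqP; split => x /=.
    by move=> [q [[iq qs qr] Dq] qx]; rewrite -[ptp x]/(x.1 +i* x.2)%C -qx.
  move=> [xs Dx]; have [iq _ zE] := Hz _ xs.
  exists (local_inv i (ptp x)); last exact: zE.
  rewrite /Ub /B /w /= zE; split => //; split => //.
  by have := DS _ Dx; rewrite /= ptpK.
move=> A mA AU.
pose D : set RR := [set p | sqr (F z0) (r / 2) (ptp p) /\ A (phi (ptp p))].
have mD : measurable D.
  have oD : open ([set p | sqr (F z0) (r / 2) (ptp p)] : set (R * R)).
    by rewrite openE => q /nbhs_sqr; exact: (@pt_cont R q).
  have cg (x : R * R) : sqr (F z0) (r / 2) (ptp x) -> {for x, continuous ((fun x => phi (ptp x)) : R * R -> S)}.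
    move=> xr; have [_ _ cphi] := Bphi _ _ xr (ltW r2r).
    exact: (continuous_comp (@pt_cont R x) cphi).
  exact: (cont_preimage_measurable oD cg (open_measurable2 oD) mA).
have := plane_area cf m_fin mI r2r mD (fun x => @proj1 _ _).
rewrite mE => <-; congr (mu _); apply/seteqP; split => q.
  move=> Aq; have Bq := AU _ Aq; have [iq qs qr] := Bq.
  split; first by split => //; exact: sqr_sub (ltW r2r) _ qr.
  by rewrite /D /= ptpK (Bw q _ Bq (ltW r2r)).
move=> [Uq]; rewrite /D /= ptpK => -[qr Aq].
by rewrite (Bw q _ Uq (lexx _)) in Aq.
Qed.

End flat_box.

(** * Affine diffeomorphisms *)

Section plane_act.
Variable R : realType.
Notation C := (Cplx R).
Implicit Types (A B : 'M[R]_2) (z : C).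

Lemma mulmx2E A B i j : (A *m B) i j = A i 0 * B 0 j + A i 1 * B 1 j.
Proof.
rewrite mxE !big_ord_recl big_ord0 addr0; congr (_ * _ + A i _ * B _ _); exact/val_inj.
Qed.

Lemma plane_actM A B z : plane_act (A *m B) z = plane_act A (plane_act B z).
Proof. by rewrite /plane_act /= !mulmx2E; congr Complex; ring. Qed.

Lemma plane_act1 z : plane_act 1%:M z = z.
Proof. by case: z => x y; rewrite /plane_act !mxE /=; congr Complex; ring. Qed.

Lemma plane_actB A z z' : plane_act A (z - z') = plane_act A z - plane_act A z'.
Proof. by case: z z' => x y [x' y']; rewrite /plane_act /=; congr Complex; ring. Qed.

Lemma det_opp A : \det (- A) = \det A.
Proof. by rewrite -scaleN1r detZ sqrrN expr1n mul1r. Qed.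

Lemma det2 A : \det A = A 0 0 * A 1 1 - A 0 1 * A 1 0.
Proof.
rewrite (expand_det_row _ 0) !big_ord_recl big_ord0 addr0 /cofactor !det_mx11 !mxE /=.
rewrite expr0 expr1 mul1r mulN1r mulrN.
by congr (_ * A _ _ - A _ _ * A _ _); exact/val_inj.
Qed.

Lemma det1_unit A : \det A = 1 -> A \in unitmx.
Proof. by move=> dA; rewrite unitmxE dA unitr1. Qed.

Lemma plane_actK A z : \det A = 1 -> plane_act (invmx A) (plane_act A z) = z.
Proof. by move=> /det1_unit uA; rewrite -plane_actM mulVmx // plane_act1. Qed.

End plane_act.

Section affine.
Variables (R : realType) (S : ptopologicalType) (X : riemann_surface R S).
Variables (a : abelian_differential X) (mu : {measure set (borel S) -> \bar R}).
Notation C := (Cplx R).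
Implicit Types (i j : atlas_index X) (p q : S) (U V : set S) (w : S -> C) (A B : 'M[R]_2).

Lemma chart_nonzero U w p : translation_chart a U w -> U p -> ~ zeros a p.
Proof.
move=> [oU injw dw] Up [i [ip c0]].
have [d d0 Hd] := chart_disc ip (open_nbhs_nbhs (conj oU Up)).
have := @injective_primitive_neq0 R (coef a i) (w \o local_inv i) (local_coord i p) d d0.
rewrite c0 eqxx => K; suff: false by []; apply: K.
- move=> z /Hd[iz Uz zE]; apply/cdiff_is_derive.
  by have := dw i _ Uz iz; rewrite zE.
- move=> z /Hd[iz Uz zE]; apply/derivable_cdiff.
  by have := @coef_holomorphic _ _ _ a _ _ iz; rewrite zE.
- move=> z z' /Hd[iz Uz zE] /Hd[iz' Uz' zE'] E.
  by rewrite -zE -zE'; congr (local_coord i _); exact: injw.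
Qed.

Lemma chart_translation U w V w' p : translation_chart a U w -> translation_chart a V w' ->
  U p -> V p -> \forall q \near p, w' q - w' p = w q - w p.
Proof.
move=> [oU injw dw] [oV injw' dw'] Up Vp.
have [i ip] := atlas_cover X p.
have nUV : nbhs p (U `&` V) by apply: filterI; exact: open_nbhs_nbhs.
have [d d0 Hd] := chart_disc ip nUV.
have n1 : nbhs p [set q | nm (local_coord i q - local_coord i p) < d].
  have z0d : nm (local_coord i p - local_coord i p) < d by rewrite subrr nm0.
  exact: (local_coord_cont ip) (nbhs_disc z0d).
apply: filterS2 n1 (in_chart_nbhs ip) => q /= qd iq.
have K := @cdiff_mvi R (fun z => w' (local_inv i z) - w (local_inv i z)) (fun=> 0) 0
  (local_coord i p) (local_coord i q) 0.
have : nm ((w' q - w q) - (w' p - w p) - 0 * (local_coord i q - local_coord i p))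
    <= 0 * nm (local_coord i q - local_coord i p).
  rewrite !local_coordK // in K; apply: K => t t01; last by rewrite subrr nm0.
  set z := _ + _.
  have /Hd[iz [Uz Vz] zE] : nm (z - local_coord i p) < d.
    by apply: disc_segment t01; rewrite ?subrr ?nm0.
  rewrite -(subrr (coef a i z)); apply: cdiffB; apply/cdiff_is_derive.
    by have := dw' i _ Vz iz; rewrite zE.
  by have := dw i _ Uz iz; rewrite zE.
rewrite !mul0r subr0 => E.
have : w' q - w q - (w' p - w p) = 0 by apply/eqP; rewrite -nm_eq0 eq_le E nm_ge0.
by move=> /eqP; rewrite subr_eq0 => /eqP E'; rewrite -[w' q](subrK (w q)) E'; ring.
Qed.

Hypothesis mu_area : is_area_measure a mu.
Hypothesis mu_finite : (mu [set: S] < +oo)%E.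

Lemma affine_id : affine_diffeo a 1%:M id.
Proof.
have cid : continuous (@id S) by move=> x; exact: cvg_id.
split => //; first by exists id.
move=> U w V w' p tU tV Up Vp.
have := chart_translation tU tV Up Vp; apply: filterS => q.
by rewrite plane_act1.
Qed.

Lemma affine_comp A B f g : affine_diffeo a A f -> affine_diffeo a B g ->
  affine_diffeo a (A *m B) (f \o g).
Proof.
move=> [[f' cf' [fK fK']] cf zf lf] [[g' cg' [gK gK']] cg zg lg]; split.
- exists (g' \o f'); first by move=> p; apply: continuous_comp; [exact: cf'|exact: cg'].
  by split => p /=; rewrite ?fK ?gK ?gK' ?fK'.
- by move=> p; apply: continuous_comp; [exact: cg|exact: cf].
- by move=> p; rewrite /= zf zg.
move=> U w V w' p tU tV Up Vp.
have nz : ~ zeros a (g p) by rewrite zg; exact: chart_nonzero tU Up.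
have [W [u [phi [r [bW Wgp _]]]]] := flat_box_ex mu_area mu_finite nz filterT.
have tW := fb_chart bW.
have n1 := lg _ _ _ _ _ tU tW Up Wgp.
have n2 := cg p _ (lf _ _ _ _ _ tW tV Wgp Vp).
by apply: filterS2 n1 n2 => q /= E1 E2; rewrite /= E2 E1 plane_actM.
Qed.

Lemma affine_inv A f : affine_diffeo a A f -> \det A = 1 ->
  exists f', [/\ affine_diffeo a (invmx A) f', cancel f f' & cancel f' f].
Proof.
move=> [[f' cf' [fK fK']] cf zf lf] dA; exists f'; split => //; split => //.
- by exists f.
- by move=> p; rewrite -{2}(fK' p) zf.
move=> U w V w' p tU tV Up Vp.
have Ufp : U (f (f' p)) by rewrite fK'.
have n1 : nbhs p [set q | w (f (f' q)) - w (f (f' p)) = plane_act A (w' (f' q) - w' (f' p))].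
  exact: (cf' p _ (lf _ _ _ _ _ tV tU Vp Ufp)).
by apply: filterS n1 => q /=; rewrite !fK' => ->; rewrite plane_actK.
Qed.

Lemma affine_continuous A f : affine_diffeo a A f -> continuous f. Proof. by case. Qed.

Lemma veech1 : veech_group a 1%:M.
Proof. by split; [exact: det1|exists id; left; exact: affine_id]. Qed.

Lemma veechM A B : veech_group a A -> veech_group a B -> veech_group a (A *m B).
Proof.
move=> [dA [f Hf]] [dB [g Hg]]; split; first by rewrite det_mulmx dA dB mulr1.
exists (f \o g); case: Hf => Hf; case: Hg => Hg.
- by left; exact: affine_comp.
- by right; rewrite -mulmxN; exact: affine_comp.
- by right; rewrite -mulNmx; exact: affine_comp.
- by left; rewrite -[A *m B]opprK -mulNmx -mulmxN; exact: affine_comp.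
Qed.

Lemma veechV A : veech_group a A -> veech_group a (invmx A).
Proof.
move=> [dA [f Hf]]; split; first by rewrite det_inv dA invr1.
case: Hf => Hf; have [|f' [Hf' _ _]] := affine_inv Hf; rewrite ?det_opp //; exists f'; [by left|right].
by rewrite -scaleN1r invmxZ ?scaleN1r ?unitmxE ?det_opp ?dA ?unitr1 // invrN1 scaleN1r in Hf' *.
Qed.

End affine.

Section countable_covers.
Variables (R : realType) (S : ptopologicalType).
Hypothesis S2 : @second_countable S.

Lemma countable_open_cover (P : set S -> Prop) (D : set S) : P set0 ->
  (forall M M', open M' -> M' `<=` M -> P M -> P M') ->
  (forall p, D p -> exists M, [/\ open M, M p & P M]) ->
  exists M : nat -> set S, (forall k, open (M k) /\ P (M k)) /\ D `<=` \bigcup_k M k.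
Proof.
move=> P0 Psub DP; case: S2 => B /countable_injP[f injf] [Bo Bb].
have H n : exists M, (open M /\ P M) /\ forall b, B b -> P b -> f b = n -> M = b.
  have [[b [Bb' Pb fb]]|N] := pselect (exists b, [/\ B b, P b & f b = n]).
    exists b; split; first by split => //; exact: Bo.
    by move=> b' Bb'' Pb' fb'; apply: injf; rewrite ?inE // fb fb'.
  exists set0; split; first by split => //; exact: open0.
  by move=> b ? ? ?; exfalso; apply: N; exists b.
have [M HM] := choice H; exists M; split; first by move=> k; case: (HM k).
move=> p /DP[N [oN Np PN]].
have [b [Bb' bp] bN] := Bb p N (open_nbhs_nbhs (conj oN Np)).
have Pb : P b by apply: Psub PN => //; exact: Bo.
by exists (f b) => //; have [_ Hb] := HM (f b); rewrite (Hb b).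
Qed.

Lemma measure_eq_cover (m1 m2 : {measure set (borel S) -> \bar R}) (M : nat -> set S) (E : set S) :
  (forall k, open (M k)) ->
  (forall k A, measurable (A : set (borel S)) -> A `<=` M k -> m1 A = m2 A) ->
  measurable (E : set (borel S)) -> E `<=` \bigcup_k M k -> m1 E = m2 E.
Proof.
move=> oM mM mE EM.
have mMk k : measurable (M k : set (borel S)) by apply: borel_open.
have mD k : measurable (seqDU M k : set (borel S)).
  apply: (@measurableD _ (borel S)) => //.
  by apply: (@bigsetU_measurable _ (borel S)) => i _.
have EE : E = \bigcup_k (E `&` seqDU M k).
  by rewrite -setI_bigcupr -seqDU_bigcup_eq setIidl.
have tD : trivIset setT (fun k => E `&` seqDU M k).
  exact/trivIset_setIl/trivIset_seqDU.
have mED k : measurable (E `&` seqDU M k : set (borel S)) by exact: (@measurableI _ (borel S)).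
rewrite EE !measure_semi_bigcup //; [|by rewrite -EE..].
apply: eq_eseriesr => k _; apply: (mM k) => //.
by apply: subset_trans (@subset_seqDU _ M k); exact: subIsetr.
Qed.

End countable_covers.

Section affine_measure.
Variables (R : realType) (S : ptopologicalType) (X : riemann_surface R S).
Variables (a : abelian_differential X) (mu : {measure set (borel S) -> \bar R}).
Notation C := (Cplx R).
Local Notation RR := (measurableTypeR R * measurableTypeR R)%type.
Local Notation lam2 := (@lebesgue_measure R \x @lebesgue_measure R)%E.
Hypothesis mu_area : is_area_measure a mu.
Hypothesis mu_finite : (mu [set: S] < +oo)%E.
Implicit Types (p q : S) (B : 'M[R]_2).

Lemma nonzeros_open : open (~` zeros a).
Proof.
rewrite openE => p nzp.
have [U [w [phi [r [bU Up _]]]]] := flat_box_ex mu_area mu_finite nzp filterT.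
have [oU _ _] := fb_chart bU.
apply: filterS (open_nbhs_nbhs (conj oU Up)) => q Uq.
by have [_ _ _] := fb_w bU Uq.
Qed.

Lemma zeros_measurable : measurable (zeros a : set (borel S)).
Proof. by apply: borel_closed; rewrite -(setCK (zeros a)); apply/open_closedC/nonzeros_open. Qed.

Lemma zeros_null : mu (zeros a) = 0%E.
Proof.
have [||p _|M [HM cM]] := @countable_open_cover S (surface_second_countable X)
  (fun M => exists i : atlas_index X, M `<=` in_chart i) setT.
- by have [i _] := atlas_cover X point; exists i.
- by move=> M M' _ MM [i Mi]; exists i; exact: subset_trans Mi.
- have [i ip] := atlas_cover X p; exists (in_chart i); split => //; first exact: chart_dom_open.
  by exists i.
have mz := zeros_measurable.
apply/negligibleP => //; apply: (@negligibleS _ (borel S) _ _ (\bigcup_k (zeros a `&` M k))).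
  by rewrite -setI_bigcupr => p zp; split => //; exact: cM.
apply: negligible_bigcup => k; have [oM [i Mi]] := HM k.
have mzM : measurable (zeros a `&` M k : set (borel S)).
  by apply: (@measurableI _ (borel S)) => //; exact: borel_open.
apply/negligibleP => //; have ziM : zeros a `&` M k `<=` in_chart i by move=> p [_ /Mi].
apply: (eq_trans (mu_area mzM ziM)).
apply: integral0_eq => x [q [zq Mq] qx].
rewrite -qx; have -> : coef a i (local_coord i q) = 0.
  apply/eqP; apply: contrapT => /negP c0.
  exact: (coef_nonzero (Mi _ Mq) c0 zq).
by rewrite Normc.normc0 expr0n.
Qed.

Lemma affine_local_measure B f p : affine_diffeo a B f -> \det B = 1 -> ~ zeros a (f p) ->
  exists M, [/\ open M, M (f p) & forall E : set S, measurable (E : set (borel S)) -> E `<=` M ->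
    mu (f @^-1` E) = mu E].
Proof.
move=> Hf dB nzf; have [[f' cf' [fK fK']] cf zf lf] := Hf.
have nzp : ~ zeros a p by rewrite -zf.
have [U [w [phi [r [bU Up _]]]]] := flat_box_ex mu_area mu_finite nzp filterT.
have [V [w' [phi' [r' [bV Vp _]]]]] := flat_box_ex mu_area mu_finite nzf filterT.
have [oU injU _] := fb_chart bU; have [oV injV _] := fb_chart bV.
have n1 := lf _ _ _ _ _ (fb_chart bU) (fb_chart bV) Up Vp.
have n2 : nbhs p (U `&` [set q | w' (f q) - w' (f p) = plane_act B (w q - w p)]).
  by apply: filterI n1; exact: open_nbhs_nbhs.
pose N := (U `&` [set q | w' (f q) - w' (f p) = plane_act B (w q - w p)])°.
pose M := V `&` f' @^-1` N.
exists M; split.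
- apply: openI => //; apply: open_comp; last exact: open_interior.
  by move=> x _; exact: cf'.
- by split => //; rewrite /= fK.
move=> E mE EM.
have mfE : measurable (f @^-1` E : set (borel S)).
  have := @borel_continuous S S setT f openT (fun p _ => cf p).
  by move=> /(_ (@measurableT _ (borel S)) E mE); rewrite setTI.
have fEN q : (f @^-1` E) q -> U q /\ w' (f q) = w' (f p) + plane_act B (w q - w p).
  move=> /EM[_]; rewrite /= fK => /interior_subset[Uq E1]; split => //.
  by rewrite -E1 addrC subrK.
rewrite (fb_area bU mfE); last by move=> q /fEN[].
rewrite (fb_area bV mE); last by move=> q /EM[].
pose c0 := w' (f p) - plane_act B (w p).
have sc := @scales_affine R (B 0 0) (B 0 1) (B 1 0) (B 1 1) (complex.Re c0) (complex.Im c0).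
rewrite -det2 dB normr1 invr1 in sc; have {sc} [mT scT] := sc (oner_neq0 _).
set T := (fun p : RR => _) in mT scT.
have TE x : ptp (T x) = w' (f p) + plane_act B (ptp x - w p).
  rewrite plane_actB addrCA [LHS](_ : _ = plane_act B (ptp x) + c0); first by rewrite /c0; ring.
  by rewrite /T; case: (c0) => c1 c2; rewrite /ptp /plane_act /=.
have mY : measurable ([set x | sqr (w' (f p)) r' (ptp x) /\ E (phi' (ptp x))] : set RR).
  have oD : open ([set x | sqr (w' (f p)) r' (ptp x)] : set (R * R)).
    by rewrite openE => x /nbhs_sqr; exact: (@pt_cont R x).
  have cg (x : R * R) : sqr (w' (f p)) r' (ptp x) -> {for x, continuous ((fun x => phi' (ptp x)) : R * R -> S)}.
    move=> xr; have [_ _ cphi] := fb_phi bV xr.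
    exact: (continuous_comp (@pt_cont R x) cphi).
  exact: (cont_preimage_measurable oD cg (open_measurable2 oD) mE).
rewrite -[RHS]mul1e -scT //; congr (lam2 _); apply/seteqP; split => x.
  move=> [xr Ex]; have [Ux wx _] := fb_phi bU xr.
  have [_ E1] := fEN _ Ex; rewrite wx -TE in E1.
  have [Vx _] := EM _ Ex.
  have [sx phx _ _] := fb_w bV Vx.
  by rewrite /preimage /= -E1; split => //; rewrite phx.
rewrite /preimage /= => -[xr Ex].
have [Vx wx _] := fb_phi bV xr.
set e := phi' _ in Ex Vx wx.
have Ef : (f @^-1` E) (f' e) by rewrite /= fK'.
have [Ue E1] := fEN _ Ef.
rewrite fK' wx TE in E1.
have {E1} E1 : ptp x = w (f' e).
  move/addrI/(congr1 (plane_act (invmx B))): E1; rewrite !plane_actK //.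
  by move=> /addIr.
have [sx phx _ _] := fb_w bU Ue.
by rewrite E1; split => //; rewrite phx fK'.
Qed.

Lemma affine_measure B f : affine_diffeo a B f -> \det B = 1 ->
  forall E : set S, measurable (E : set (borel S)) -> mu (f @^-1` E) = mu E.
Proof.
move=> Hf dB E mE; have [[f' cf' [fK fK']] cf zf lf] := Hf.
have mf : measurable_fun [set: borel S] (f : borel S -> borel S).
  exact: (@borel_continuous S S setT f openT (fun p _ => cf p)).
have [||p nzp|M [HM cM]] := @countable_open_cover S (surface_second_countable X)
  (fun M => forall E : set S, measurable (E : set (borel S)) -> E `<=` M -> mu (f @^-1` E) = mu E) (~` zeros a).
- by move=> A _; rewrite subset0 => ->; rewrite preimage_set0 !measure0.
- by move=> M M' _ MM PM A mA AM; apply: PM => //; exact: subset_trans MM.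
- by have := @affine_local_measure B f (f' p) Hf dB; rewrite fK'; apply.
have [m mE'] := pushforward_ex mu mf ler01.
have {}mE' A : m A = mu (f @^-1` A) by rewrite mE' mul1e.
have mz := zeros_measurable.
have split_z (A : set S) : measurable (A : set (borel S)) -> mu A = mu (A `\` zeros a).
  move=> mA; have mAz : measurable (A `&` zeros a : set (borel S)) by exact: (@measurableI _ (borel S)).
  have mAD : measurable (A `\` zeros a : set (borel S)) by exact: (@measurableD _ (borel S)).
  rewrite [LHS](measureDI mu mA mz) -[RHS]adde0; congr (_ + _)%E.
  apply/eqP; rewrite -measure_le0 -[leRHS]zeros_null; apply: le_measure; rewrite ?inE //.
have mED : measurable (E `\` zeros a : set (borel S)) by exact: (@measurableD _ (borel S)).
rewrite [RHS]split_z //.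
have mfE : measurable (f @^-1` E : set (borel S)) by have := mf measurableT E mE; rewrite setTI.
rewrite split_z // (_ : f @^-1` E `\` zeros a = f @^-1` (E `\` zeros a)); last first.
  by apply/seteqP; split => q [Eq zq]; split => //=; rewrite ?zf // -zf.
rewrite -mE'; apply: (@measure_eq_cover R S m mu M) => //.
- by move=> k; case: (HM k).
- by move=> k A mA AM; rewrite mE'; case: (HM k) => _; apply.
- by move=> q [_ zq]; exact: cM.
Qed.

End affine_measure.

(** * Connectedness of the complement of the zeros *)

Section nonzeros.
Variables (R : realType) (S : ptopologicalType) (X : riemann_surface R S).
Variables (a : abelian_differential X).
Notation C := (Cplx R).
Implicit Types (i : atlas_index X) (p q : S) (z : C).

Definition cut_off (V1 : set S) i z : C :=
  if pselect (V1 (local_inv i z)) then coef a i z * coef a i z else 0.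

(* The form [a * a] restricted to the open set [V1] and extended by [0] is
   still holomorphic, since [a * a] vanishes to second order at the zeros. *)
Lemma cut_off_cdiff (V1 V2 : set S) i (z0 : C) (d : R) :
  open V1 -> open V2 -> V1 `&` V2 = set0 -> V1 `|` V2 = ~` zeros a ->
  (forall z, nm (z - z0) < d -> in_chart i (local_inv i z) /\ local_coord i (local_inv i z) = z) ->
  forall z, nm (z - z0) < d ->
  exists d', cdiff (cut_off V1 i) z d'.
Proof.
move=> oV1 oV2 V12 V12U Hd z zd.
pose g := cut_off V1 i; rewrite -/g.
have [iq zE] := Hd z zd; set q := local_inv i z in iq zE.
have [c Hc] : exists c, cdiff (coef a i) z c.
  by apply/derivable_cdiff; have := @coef_holomorphic _ _ _ a _ _ iq; rewrite zE.
have near (V : set S) : open V -> V q -> exists2 r : R, 0 < r & forall w, nm (w - z) < r -> V (local_inv i w).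
  move=> oV Vq; have := local_inv_cont iq; rewrite zE => cinv.
  by have /nbhs_nm := cinv _ (open_nbhs_nbhs (conj oV Vq)).
have [V1q|nV1] := pselect (V1 q).
  have [r r0 Hr] := near _ oV1 V1q.
  have : derivable (fun z => coef a i z * coef a i z) z 1.
    by apply: derivableM; apply/derivable_cdiff; exists c.
  move=> /derivable_cdiff[d' Hd']; exists d'.
  apply: (@cdiff_near _ _ _ _ _ r) Hd' => // w /Hr V1w.
  by rewrite /g /cut_off; case: pselect.
have [V2q|nV2] := pselect (V2 q).
  have [r r0 Hr] := near _ oV2 V2q.
  exists 0; apply: (@cdiff_near _ (fun=> 0) _ _ _ r) (@cdiff_cst R z 0) => // w /Hr V2w.
  rewrite /g /cut_off; case: pselect => // V1w.
  by have : (V1 `&` V2) (local_inv i w) := conj V1w V2w; rewrite V12.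
have cz : coef a i z = 0.
  apply/eqP; apply: contrapT => /negP c0.
  have : (V1 `|` V2) q by rewrite V12U; apply: (coef_nonzero iq); rewrite zE.
  by case.
exists 0 => e e0.
have [r r0 Hr] := Hc 1 ltr01.
have n0 : 0 < nm c + 1 by rewrite ltr_wpDl ?nm_ge0.
exists (Num.min r (e / (nm c + 1) ^+ 2)) => [|w].
  by rewrite lt_min r0 divr_gt0 // exprn_gt0.
rewrite lt_min ltr_pdivlMr ?exprn_gt0 // => /andP[/Hr K1 K2].
have gz : g z = 0 by rewrite /g /cut_off; case: pselect.
rewrite gz subr0 mul0r subr0 /g /cut_off; case: pselect => V1w; last by rewrite nm0 mulr_ge0 ?nm_ge0 // ltW.
rewrite cz subr0 mul1r in K1.
have K3 : nm (coef a i w) <= (nm c + 1) * nm (w - z).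
  have := nmD (coef a i w - c * (w - z)) (c * (w - z)); rewrite subrK nmM.
  by move: K1; lra.
rewrite nmM; apply: le_trans (ler_pM (nm_ge0 _) (nm_ge0 _) K3 K3) _.
rewrite [leLHS](_ : _ = (nm (w - z) * (nm c + 1) ^+ 2) * nm (w - z)); last by ring.
by rewrite ler_wpM2r ?nm_ge0 // ltW.
Qed.

Lemma nonzeros_not_separated (V1 V2 : set S) : open V1 -> open V2 -> V1 `&` V2 = set0 ->
  V1 `|` V2 = ~` zeros a -> V1 = set0 \/ V2 = set0.
Proof.
move=> oV1 oV2 V12 V12U.
have [->|/set0P[q2 V2q2]] := eqVneq V2 set0; [by right|left].
pose O := (~` V1)°.
have V1nz q : V1 q -> ~ zeros a q by move=> V1q; have : (V1 `|` V2) q := or_introl V1q; rewrite V12U.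
suff OT : O = setT.
  apply/seteqP; split => // q V1q.
  have : O q by rewrite OT.
  by move=> /interior_subset.
apply: (surface_connected X).
- exists q2; rewrite /O /interior /=; apply: (filterS _ (open_nbhs_nbhs (conj oV2 V2q2))).
  by move=> q V2q V1q; have : (V1 `&` V2) q := conj V1q V2q; rewrite V12.
- by exists O; [exact: open_interior|rewrite setTI].
exists O; last by rewrite setTI.
move=> p cp.
have [i ip] := atlas_cover X p; set z0 := local_coord i p.
have [d d0 Hd] := chart_disc ip filterT.
rewrite -/z0 in Hd.
have {}Hd z : nm (z - z0) < d -> in_chart i (local_inv i z) /\ local_coord i (local_inv i z) = z.
  by move=> /Hd[].
pose g := cut_off V1 i.
have dg := cut_off_cdiff oV1 oV2 V12 V12U Hd.
have near_p (r : R) : 0 < r -> nbhs p [set q | in_chart i q /\ nm (local_coord i q - z0) < r].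
  move=> r0; have z0r : nm (z0 - z0) < r by rewrite subrr nm0.
  have n1 : nbhs p (local_coord i @^-1` [set z | nm (z - z0) < r]) := local_coord_cont ip (nbhs_disc z0r).
  exact: filterS2 (in_chart_nbhs ip) n1.
have d34 : 0 < d / 34 by lra.
have [q1 [Oq1 [iq1 q1d]]] := cp _ (near_p _ d34).
set z1 := local_coord i q1 in q1d.
have [rho rho0 Hrho] : exists2 rho : R, 0 < rho & forall z, nm (z - z1) < rho -> g z = 0.
  have nO : nbhs (local_inv i z1) O.
    by rewrite local_coordK //; apply: open_nbhs_nbhs; split => //; exact: open_interior.
  have /nbhs_nm[r r0 Hr] : nbhs z1 (local_inv i @^-1` O) := local_inv_cont iq1 nO.
  exists r => // z /Hr /interior_subset nV1.
  by rewrite /g /cut_off; case: pselect.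
have van : forall z, nm (z - z1) < d / 2 / 16 -> g z = 0.
  apply: (@vanish_spread R g z1 (d / 2) rho) => // w wd.
  by apply: dg; have := nm_tri w z1 z0; lra.
have dd : 0 < d / 32 - d / 34 by lra.
rewrite /O /interior /=; apply: filterS (near_p _ dd) => q [iq qd] V1q.
have := van (local_coord i q).
rewrite /g /cut_off local_coordK //; case: pselect => // ? H.
have : coef a i (local_coord i q) * coef a i (local_coord i q) = 0.
  by apply: H; have := nm_tri (local_coord i q) z0 z1; rewrite (nm_distC z0 z1); lra.
by apply/eqP; rewrite mulf_neq0 //; exact: nonzero_coef (V1nz _ V1q) iq.
Qed.

End nonzeros.

(** * Inner regularity *)

Section inner_regularity.
Variables (R : realType) (S : ptopologicalType) (X : riemann_surface R S).
Variables (a : abelian_differential X) (mu : {measure set (borel S) -> \bar R}).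
Notation C := (Cplx R).
Hypothesis mu_area : is_area_measure a mu.
Hypothesis mu_finite : (mu [set: S] < +oo)%E.
Implicit Types (p q : S) (A F : set S).
Let hS := surface_hausdorff X.

Lemma compact_borel F : compact F -> measurable (F : set (borel S)).
Proof. by move=> cF; apply: borel_closed; exact: compact_closed. Qed.

Lemma compact_nbhs p (O : set S) : open O -> O p ->
  exists M, [/\ open M, M p & exists k, [/\ compact k, M `<=` k & k `<=` O]].
Proof.
move=> oO Op; have [i ip] := atlas_cover X p; set z0 := local_coord i p.
have [d d0 Hd] := chart_disc ip (open_nbhs_nbhs (conj oO Op)).
rewrite -/z0 in Hd.
pose Q := rect (complex.Re z0 - d / 4) (complex.Im z0 - d / 4) (d / 2) (d / 2).
have Qd z : Q z -> nm (z - z0) < d.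
  move=> Qz; apply: le_lt_trans (nm_ReIm _) _; move: Qz; rewrite /Q /rect.
  case: z (z0) => u v [u0 v0] /= [/andP[? ?] /andP[? ?]].
  have : `|u - u0| <= d / 4 by rewrite ler_norml; apply/andP; split; lra.
  have : `|v - v0| <= d / 4 by rewrite ler_norml; apply/andP; split; lra.
  by lra.
pose M0 := [set q | in_chart i q /\ nm (local_coord i q - z0) < d / 4].
have nM : nbhs p M0.
  have z0d : nm (z0 - z0) < d / 4 by rewrite subrr nm0; lra.
  have n1 : nbhs p (local_coord i @^-1` [set z | nm (z - z0) < d / 4]) := local_coord_cont ip (nbhs_disc z0d).
  exact: filterI (in_chart_nbhs ip) n1.
exists M0°; split; [exact: open_interior|exact: nM|].
exists (local_inv i @` Q); split.
- apply: continuous_compact; last exact: rect_compact.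
  move=> x; apply: continuous_in_subspaceT => z; rewrite inE => /Qd/Hd[iz _ zE].
  by have := local_inv_cont iz; rewrite zE.
- move=> q /interior_subset[iq qd]; exists (local_coord i q); last exact: local_coordK.
  have := nm_Re (local_coord i q - z0); have := nm_Im (local_coord i q - z0).
  rewrite /Q /rect /=; case: (local_coord i q) (z0) qd => u v [u0 v0] qd /= K1 K2.
  have := le_lt_trans K1 qd; have := le_lt_trans K2 qd; rewrite !ltr_norml => /andP[? ?] /andP[? ?].
  by split; apply/andP; split; lra.
- by move=> _ [z /Qd/Hd[_ Oz _] <-].
Qed.

Lemma open_sigma_compact (O : set S) : open O ->
  exists k : nat -> set S, (forall n, compact (k n)) /\ O = \bigcup_n k n.
Proof.
move=> oO.
have [||p Op|M [HM cM]] := @countable_open_cover S (surface_second_countable X)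
  (fun M => exists k, [/\ compact k, M `<=` k & k `<=` O]) O.
- by exists set0; split => //; exact: compact0.
- by move=> M M' _ MM [k [ck Mk kO]]; exists k; split => //; exact: subset_trans Mk.
- exact: compact_nbhs.
have /choice[k Hk] n : exists k, [/\ compact k, M n `<=` k & k `<=` O] := (HM n).2.
exists k; split; first by move=> n; case: (Hk n).
apply/seteqP; split => [p /cM[n _ Mp]|p [n _ kp]].
  by exists n => //; case: (Hk n) => _ + _; apply.
by case: (Hk n) => _ _; apply.
Qed.

Lemma finite_union_approx (G : nat -> set S) (e : R) : (forall n, measurable (G n : set (borel S))) -> 0 < e ->
  exists N, (mu ((\bigcup_n G n) `\` \big[setU/set0]_(n < N) G n) < e%:E)%E.
Proof.
move=> mG e0.
pose D N := (\bigcup_n G n) `\` \big[setU/set0]_(n < N) G n.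
have mU N : measurable (\big[setU/set0]_(n < N) G n : set (borel S)) by apply: (@bigsetU_measurable _ (borel S)) => i _.
have mUU : measurable (\bigcup_n G n : set (borel S)) by exact: (@bigcupT_measurable _ (borel S)).
have mD N : measurable (D N : set (borel S)) by exact: (@measurableD _ (borel S)).
have D0 : \bigcap_N D N = set0.
  apply/seteqP; split => // x Dx; have [[n _ Gx] _] := Dx 0%N Logic.I.
  have [_] := Dx n.+1 Logic.I; apply; rewrite -bigcup_mkord.
  by exists n => //=.
have cv : mu (D n) @[n --> \oo] --> mu (\bigcap_N D N).
  apply: nonincreasing_cvg_mu => //.
  - by apply: le_lt_trans mu_finite; apply: le_measure; rewrite ?inE.
  - by rewrite D0.
  - apply/nonincreasing_seqP => n; apply/subsetPset => x [Ux nx]; split => //.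
    by apply: contra_not nx; rewrite big_ord_recr; left.
rewrite D0 measure0 in cv.
have n0 : nbhs (0%E : \bar R) [set y | (y < e%:E)%E].
  by apply: open_nbhs_nbhs; split; [exact: open_ereal_lt_ereal|rewrite /= lte_fin].
by have [N _ HN] := cv _ n0; exists N; apply: HN => /=.
Qed.

(* Symmetric in [A] and its complement, so that the sets with this property
   form a sigma-algebra. *)
Definition approximable A := forall e : R, 0 < e -> exists F1 F2,
  [/\ compact F1, compact F2, F1 `<=` A, F2 `<=` ~` A & (mu (~` (F1 `|` F2)) < e%:E)%E].

Let mu_le A B : measurable (A : set (borel S)) -> measurable (B : set (borel S)) -> A `<=` B -> (mu A <= mu B)%E.
Proof. by move=> mA mB AB; apply: le_measure; rewrite ?inE. Qed.

Let mu_U A B : measurable (A : set (borel S)) -> measurable (B : set (borel S)) -> (mu (A `|` B) <= mu A + mu B)%E.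
Proof. by move=> mA mB; exact: measureU2. Qed.

Let mC A : measurable (A : set (borel S)) -> measurable (~` A : set (borel S)).
Proof. exact: (@measurableC _ (borel S)). Qed.

Let mU A B : measurable (A : set (borel S)) -> measurable (B : set (borel S)) -> measurable (A `|` B : set (borel S)).
Proof. exact: (@measurableU _ (borel S)). Qed.

Let mD A B : measurable (A : set (borel S)) -> measurable (B : set (borel S)) -> measurable (A `\` B : set (borel S)).
Proof. exact: (@measurableD _ (borel S)). Qed.

Lemma approximable_open (O : set S) : open O -> approximable O.
Proof.
move=> oO e e0.
have e2 : 0 < e / 2 by lra.
have [k [ck OE]] := open_sigma_compact oO.
have [l [cl TE]] := open_sigma_compact openT.
have [N HN] := finite_union_approx (fun n => compact_borel (ck n)) e2.
have [M HM] := finite_union_approx (fun n => compact_borel (cl n)) e2.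
rewrite -OE in HN; rewrite -TE in HM.
set k' := \big[_/_]_(n < N) _ in HN; set l' := \big[_/_]_(n < M) _ in HM.
have ck' : compact k' by apply: bigsetU_compact.
have cl' : compact l' by apply: bigsetU_compact.
have mO : measurable (O : set (borel S)) by exact: borel_open.
have mk := compact_borel ck'; have ml := compact_borel cl'.
exists k', (l' `&` ~` O); split => //.
- by apply: compact_closedI => //; exact: open_closedC.
- by move=> x; rewrite /k' -bigcup_mkord OE => -[n _ kx]; exists n.
have mT := @measurableT _ (borel S).
apply: (@le_lt_trans _ _ (mu (O `\` k') + mu ([set: S] `\` l'))%E).
  apply: le_trans (mu_U (mD mO mk) (mD mT ml)); apply: mu_le.
  - by apply: mC; apply: mU => //; apply: (@measurableI _ (borel S)) => //; exact: mC.
  - by apply: mU; exact: mD.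
  move=> x /not_orP[nk nl]; have [Ox|nO] := pselect (O x); first by left.
  by right; split => // lx; apply: nl.
by rewrite [e]splitr EFinD; exact: lteD.
Qed.

Lemma approximable_borel A : measurable (A : set (borel S)) -> approximable A.
Proof.
move: A; apply: smallest_sub; last exact: approximable_open.
split.
- exact: approximable_open open0.
- move=> A apA e /apA[F1 [F2 [c1 c2 F1A F2A Fe]]]; exists F2, F1.
  by rewrite setTD setCK setUC.
move=> A_ apA e e0.
have e2 : 0 < e / 2 by lra.
have e3 : 0 < e / 2 / 2 by lra.
have en n : 0 < e / 2 / 2 / (2 ^ n.+1)%:R by rewrite divr_gt0 // ltr0n expn_gt0.
have /choice[F HF] n : exists F : set S * set S, [/\ compact F.1, compact F.2, F.1 `<=` A_ n, F.2 `<=` ~` A_ n &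
    (mu (~` (F.1 `|` F.2)) < (e / 2 / 2 / (2 ^ n.+1)%:R)%:E)%E].
  by have [F1 [F2 H]] := apA n _ (en n); exists (F1, F2).
have c1 n : compact (F n).1 by case: (HF n).
have c2 n : compact (F n).2 by case: (HF n).
have m1 n := compact_borel (c1 n); have m2 n := compact_borel (c2 n).
have [N HN] := finite_union_approx (fun n => compact_borel (c1 n)) e2.
set F1 := \big[_/_]_(n < N) _ in HN.
pose F2 := \bigcap_n (F n).2.
have cF1 : compact F1 by apply: bigsetU_compact.
have cF2 : compact F2.
  apply: (@subclosed_compact _ _ (F 0%N).2) => //; last by move=> x /(_ 0%N Logic.I).
  by apply: closed_bigI => n _; exact: compact_closed.
have mF1 := compact_borel cF1; have mF2 := compact_borel cF2.
have mUU : measurable (\bigcup_n (F n).1 : set (borel S)) by exact: (@bigcupT_measurable _ (borel S)).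
exists F1, F2; split => //.
- move=> x; rewrite /F1 -(bigcup_mkord N (fun n => (F n).1)) => -[n _ Fx]; exists n => //.
  by case: (HF n) => _ _ + _ _; apply.
- move=> x Fx [n _ Ax]; have := Fx n Logic.I.
  by case: (HF n) => _ _ _ + _ => /[apply].
have mB n : measurable (~` ((F n).1 `|` (F n).2) : set (borel S)) by apply: mC; exact: mU.
have mBU : measurable (\bigcup_n ~` ((F n).1 `|` (F n).2) : set (borel S)) by exact: (@bigcupT_measurable _ (borel S)).
apply: (@le_lt_trans _ _ (mu (\bigcup_n ~` ((F n).1 `|` (F n).2)) + mu ((\bigcup_n (F n).1) `\` F1))%E).
  apply: le_trans (mu_U mBU (mD mUU mF1)); apply: mu_le.
  - by apply: mC; exact: mU.
  - by apply: mU => //; exact: mD.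
  move=> x /not_orP[n1 n2].
  have [[n _ Fx]|nF] := pselect ((\bigcup_n (F n).1) x); first by right; split => //; exists n.
  left; have /existsNP[n nFx] : ~ forall n, (F n).2 x by move=> H; apply: n2 => n _; exact: H.
  by exists n => // -[Fx|//]; apply: nF; exists n.
rewrite [e]splitr EFinD; apply: lteD => //.
apply: (@le_lt_trans _ _ (e / 2 / 2)%:E); last by rewrite lte_fin; lra.
have K := measure_sigma_subadditive mu mB mBU (@subset_refl _ _).
apply: le_trans K _.
apply: le_trans (epsilon_trick0 xpredT (ltW e3)).
apply: lee_nneseries => // n _; apply/ltW.
by case: (HF n).
Qed.

Lemma compact_approx A (e : R) : measurable (A : set (borel S)) -> 0 < e -> exists F1 F2,
  [/\ compact F1, compact F2, F1 `<=` A `\` zeros a, F2 `<=` ~` A `\` zeros a &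
     (mu (~` (F1 `|` F2)) < e%:E)%E].
Proof.
move=> mA e0; have e2 : 0 < e / 2 by lra.
have mz := zeros_measurable mu_area mu_finite.
have [F1 [F1' [c1 c1' F1A F1A' H1]]] := approximable_borel (mD mA mz) e2.
have [F2 [F2' [c2 c2' F2A F2A' H2]]] := approximable_borel (mD (mC mA) mz) e2.
exists F1, F2; split => //.
have m1 := compact_borel c1; have m2 := compact_borel c2.
have m1' := compact_borel c1'; have m2' := compact_borel c2'.
apply: (@le_lt_trans _ _ (mu (~` (F1 `|` F1')) + mu (~` (F2 `|` F2')) + mu (zeros a))%E).
  have mm1 : measurable (~` (F1 `|` F1') : set (borel S)) by apply: mC; exact: mU.
  have mm2 : measurable (~` (F2 `|` F2') : set (borel S)) by apply: mC; exact: mU.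
  apply: le_trans (leeD2r _ (mu_U mm1 mm2)).
  apply: le_trans (mu_U (mU mm1 mm2) mz); apply: mu_le.
  - by apply: mC; exact: mU.
  - by apply: mU => //; exact: mU.
  move=> x /not_orP[n1 n2]; have [zx|nz] := pselect (zeros a x); first by right.
  left; have [Ax|nA] := pselect (A x).
    by left => -[//|F1'x]; exact: (F1A' x F1'x (conj Ax nz)).
  by right => -[//|F2'x]; exact: (F2A' x F2'x (conj nA nz)).
rewrite (zeros_null mu_area mu_finite) adde0 [e]splitr EFinD.
exact: lteD.
Qed.
End inner_regularity.

(** * Straight paths *)

Section straight.
Variables (R : realType) (S : ptopologicalType) (X : riemann_surface R S).
Variables (a : abelian_differential X) (mu : {measure set (borel S) -> \bar R}).
Notation C := (Cplx R).
Hypothesis mu_area : is_area_measure a mu.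
Hypothesis mu_finite : (mu [set: S] < +oo)%E.
Implicit Types (p q : S) (U : set S) (w : S -> C) (v z : C) (g : R -> S) (t s l h k : R).

Definition straight v g l h := forall t, l < t -> t < h ->
  [/\ ~ zeros a (g t), {for t, continuous g} &
      forall U w, translation_chart a U w -> U (g t) ->
        \forall s \near t, w (g s) - w (g t) = (s - t)%:C * v].

Lemma line_cont z v : continuous (fun t : R => z + t%:C * v : C).
Proof.
move=> t; apply/(@cvg_nm R _ (nbhs t) _ (fun t : R => z + t%:C * v : C)) => e e0.
have v0 : 0 < nm v + 1 by have := nm_ge0 v; lra.
have : \forall s \near t, `|t - s| < e / (nm v + 1).
  exact: (nbhsx_ballx t _ (divr_gt0 e0 v0)).
apply: filterS => s; rewrite distrC ltr_pdivlMr // => st.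
have -> : z + s%:C * v - (z + t%:C * v) = (s - t)%:C * v.
  by rewrite rmorphB /=; ring.
rewrite nmM nmR; apply: le_lt_trans st; rewrite ler_wpM2l //; lra.
Qed.

Lemma straight_box U w phi c r z v l h : flat_box a mu U w phi c r ->
  (forall t, l < t -> t < h -> sqr c r (z + t%:C * v)) ->
  straight v (fun t => phi (z + t%:C * v)) l h.
Proof.
move=> bU Hz t lt th.
have zt := Hz t lt th; have [Up wp cp] := fb_phi bU zt.
have cg : {for t, continuous (fun t => phi (z + t%:C * v))}.
  exact: (continuous_comp (@line_cont z v t) cp).
split => //; first by have [_ _ _] := fb_w bU Up.
move=> V w' tV Vp.
have n1 : nbhs t [set s | w' (phi (z + s%:C * v)) - w' (phi (z + t%:C * v)) =
    w (phi (z + s%:C * v)) - w (phi (z + t%:C * v))] :=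
  cg _ (chart_translation (fb_chart bU) tV Up Vp).
have n2 : nbhs t [set s | sqr c r (z + s%:C * v)] := @line_cont z v t _ (nbhs_sqr zt).
apply: filterS2 n1 n2 => s /= -> /(fb_phi bU)[_ -> _].
by rewrite wp rmorphB /=; ring.
Qed.

Lemma plane_act_scale (B : 'M[R]_2) t v : plane_act B (t%:C * v) = t%:C * plane_act B v.
Proof. by case: v => x y; rewrite /plane_act /=; simpc; congr Complex; ring. Qed.

Lemma straight_affine (B : 'M[R]_2) f g v l h : affine_diffeo a B f ->
  straight v g l h -> straight (plane_act B v) (f \o g) l h.
Proof.
move=> [_ cf zf af] sg t lt th; have [nz cg wg] := sg t lt th; split.
- by rewrite /= zf.
- exact: (continuous_comp cg (cf _)).
move=> V w' tV Vf.
have [U [w [phi [r [bU Ug _]]]]] := flat_box_ex mu_area mu_finite nz filterT.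
have tU := fb_chart bU.
have n1 := wg _ _ tU Ug.
have n2 : nbhs t [set s | w' (f (g s)) - w' (f (g t)) = plane_act B (w (g s) - w (g t))] :=
  cg _ (af _ _ _ _ _ tU tV Ug Vf).
by apply: filterS2 n1 n2 => s /= E1 ->; rewrite E1 plane_act_scale.
Qed.

Lemma straight_reparam v g l h l' h' (k s0 : R) :
  (forall t, l' < t -> t < h' -> l < s0 + k * t /\ s0 + k * t < h) ->
  straight v g l h -> straight (k%:C * v) (fun t => g (s0 + k * t)) l' h'.
Proof.
move=> lh sg t lt th; have [l1 h1] := lh t lt th; have [nz cg wg] := sg _ l1 h1.
have ck : {for t, continuous (fun t => s0 + k * t)}.
  by apply: cvgD; [exact: cvg_cst|apply: cvgM; [exact: cvg_cst|exact: cvg_id]].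
split => //; first exact: (continuous_comp ck cg).
move=> U w tU Ug; have n1 : nbhs t [set s | w (g (s0 + k * s)) - w (g (s0 + k * t)) =
    (s0 + k * s - (s0 + k * t))%:C * v] := ck _ (wg _ _ tU Ug).
apply: filterS n1 => s /= ->.
have -> : s0 + k * s - (s0 + k * t) = (s - t) * k by ring.
by rewrite rmorphM mulrA.
Qed.

Lemma straight_trajectory g l h : l < h -> straight 1 g l h -> trajectory a g l%:E h%:E.
Proof.
move=> lh sg; split; first by rewrite lte_fin.
move=> t /andP[]; rewrite !lte_fin => lt th; have [nz cg wg] := sg t lt th.
split => // i ip.
have [U [w [phi [r [bU Ug _]]]]] := flat_box_ex mu_area mu_finite nz filterT.
have [oU injw dw] := fb_chart bU.
have /cdiff_is_derive dwt := dw i _ Ug ip.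
set z0 := local_coord i (g t) in dwt *; set c0 := coef a i z0 in dwt *.
have c00 : c0 != 0 by exact: nonzero_coef.
exists c0^-1; last by rewrite mulfV.
rewrite /velocity -/z0.
apply/(@cvg_nm R R 0^' _ (fun h : R => (h%:C : C)^-1 * (local_coord i (g (t + h)) - z0))) => e e0.
have n0 : 0 < nm c0 by rewrite nm_gt0.
pose e' := Num.min (nm c0 / 2) (e * nm c0 ^+ 2 / 4).
have e'0 : 0 < e'.
  by rewrite lt_min !divr_gt0 // mulr_gt0 // exprn_gt0.
have [r' r'0 Hr] := dwt _ e'0.
have n1 : \forall s \near t, nm (local_coord i (g s) - z0) < r'.
  have z0r : nm (z0 - z0) < r' by rewrite subrr nm0.
  exact: (cg _ (local_coord_cont ip (nbhs_disc z0r))).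
have n2 := wg _ _ (fb_chart bU) Ug.
have n3 := cg _ (in_chart_nbhs ip).
have [d /= d0 Hd] := (nbhs_ballP _ _).1 (filterI n1 (filterI n2 n3)).
rewrite /dnbhs /within; apply/nbhs_ballP; exists d => //= x xd x0.
have [|x1 [x2 x3]] := Hd (t + x).
  by move: xd; rewrite /ball /= sub0r normrN opprD addrA subrr sub0r normrN.
have := Hr _ x1; rewrite /= !local_coordK // x2 mulr1 addrAC subrr add0r.
set D := local_coord i (g (t + x)) - z0 => K.
have xp : 0 < `|x| by rewrite normr_gt0.
have xC : x%:C != 0 :> C by rewrite -nm_eq0 nmR gt_eqF.
have K1 : nm c0 * nm D <= `|x| + e' * nm D.
  have -> : nm c0 * nm D = nm (x%:C - (x%:C - c0 * D)) by rewrite -nmM; congr nm; ring.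
  by apply: le_trans (nmB _ _) _; rewrite nmR lerD2l.
have K2 : e' * nm D <= nm c0 / 2 * nm D by rewrite ler_wpM2r ?nm_ge0 // ge_min lexx.
have K3 : nm D <= 2 * `|x| / nm c0 by rewrite ler_pdivlMr //; lra.
have -> : (x%:C)^-1 * D - c0^-1 = (x%:C * c0)^-1 * - (x%:C - c0 * D).
  by field; rewrite xC c00.
rewrite nmM nmN nmV nmM nmR mulrC ltr_pdivrMr ?mulr_gt0 //.
apply: le_lt_trans K _.
apply: (@le_lt_trans _ _ (e * nm c0 ^+ 2 / 4 * (2 * `|x| / nm c0))).
  by apply: ler_pM => //; [exact: ltW|exact: nm_ge0|rewrite ge_min lexx orbT].
have -> : e * nm c0 ^+ 2 / 4 * (2 * `|x| / nm c0) = e * (`|x| * nm c0) / 2 by field; lra.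
have : 0 < e * (`|x| * nm c0) by rewrite !mulr_gt0.
by lra.
Qed.

Lemma invariant_straight (A : set S) g k l h t1 t2 : flow_invariant a A -> k != 0 ->
  straight k%:C g l h -> l < t1 -> t1 < h -> l < t2 -> t2 < h -> A (g t1) <-> A (g t2).
Proof.
move=> invA k0 sg l1 h1 l2 h2.
pose l' := Num.min ((l - t1) * k) ((h - t1) * k).
pose h' := Num.max ((l - t1) * k) ((h - t1) * k).
have Hlh t : l < t1 + k^-1 * t /\ t1 + k^-1 * t < h <-> l' < t /\ t < h'.
  rewrite /l' /h'; have -> : t = k * (k^-1 * t) by rewrite mulrA mulfV ?mul1r.
  set u := k^-1 * t; rewrite mulrA mulVf // mul1r.
  have [kp|kn] := ltrP 0 k.
    rewrite min_l ?max_r ?ler_pM2r //; [|lra|lra].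
    rewrite [k * u]mulrC !ltr_pM2r //; split=> -[? ?]; split; lra.
  have {kn} kn : k < 0 by rewrite lt_neqAle k0.
  rewrite min_r ?max_l ?ler_nM2r //; [|lra|lra].
  rewrite [k * u]mulrC !ltr_nM2r //; split=> -[? ?]; split; lra.
have sg' : straight 1 (fun t => g (t1 + k^-1 * t)) l' h'.
  have -> : (1 : C) = (k^-1)%:C * k%:C by rewrite -rmorphM /= mulVf.
  by apply: straight_reparam sg => t lt th; apply/Hlh.
have E0 : t1 + k^-1 * 0 = t1 by rewrite mulr0 addr0.
have E2 : t1 + k^-1 * (k * (t2 - t1)) = t2 by rewrite mulrA mulVf // mul1r addrC subrK.
have [l'0 h'0] : l' < 0 /\ 0 < h' by apply/Hlh; rewrite E0.
have [l'2 h'2] : l' < k * (t2 - t1) /\ k * (t2 - t1) < h' by apply/Hlh; rewrite E2.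
have tr := straight_trajectory (lt_trans l'0 h'0) sg'.
apply: (invA (k * (t2 - t1))); exists (fun t => g (t1 + k^-1 * t)), l'%:E, h'%:E.
by split; rewrite /oint /= ?lte_fin ?l'0 ?l'2 ?E0 ?E2.
Qed.

Lemma sqr_add (c z d : C) (r1 r2 : R) : sqr c r1 z -> nm d < r2 -> sqr c (r1 + r2) (z + d).
Proof.
move=> [z1 z2] dr; have := nm_Re d; have := nm_Im d.
move=> d2 d1; split.
  have -> : complex.Re (z + d - c) = complex.Re (z - c) + complex.Re d.
    by case: z c d {z1 z2 dr d1 d2} => x y [x' y'] [x'' y''] /=; ring.
  by apply: le_lt_trans (ler_normD _ _) _; apply: ltrD => //; exact: le_lt_trans dr.
have -> : complex.Im (z + d - c) = complex.Im (z - c) + complex.Im d.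
  by case: z c d {z1 z2 dr d1 d2} => x y [x' y'] [x'' y''] /=; ring.
by apply: le_lt_trans (ler_normD _ _) _; apply: ltrD => //; exact: le_lt_trans dr.
Qed.

Lemma straight_in_box U w phi c r g v l h t1 t2 : flat_box a mu U w phi c r ->
  straight v g l h -> l < t1 -> t1 < h -> l < t2 -> t2 < h ->
  U (g t1) -> (forall t, `|t - t1| <= `|t2 - t1| -> sqr c r (w (g t1) + (t - t1)%:C * v)) ->
  g t2 = phi (w (g t1) + (t2 - t1)%:C * v).
Proof.
move=> bU sg l1 h1 l2 h2 Ug Hs.
pose f (t : R) := phi (w (g t1) + (t - t1)%:C * v).
pose I : set R := [set t | [/\ l < t, t < h & `|t - t1| <= `|t2 - t1|]].
pose B : set R := I `&` [set t | g t = f t].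
have cf t : I t -> {for t, continuous f}.
  move=> [_ _ /Hs/(fb_phi bU)[_ _ cphi]].
  have cs : {for t, continuous (fun t : R => t - t1)} by apply: cvgB; [exact: cvg_id|exact: cvg_cst].
  exact: (continuous_comp (continuous_comp cs (@line_cont _ v _)) cphi).
have cI : connected I.
  apply/connected_intervalP => x y [x1 x2 x3] [y1 y2 y3] t /andP[xt ty].
  split; [lra|lra|move: x3 y3; rewrite !ler_norml => /andP[? ?] /andP[? ?]; apply/andP; split; lra].
have I1 : I t1 by split => //; rewrite subrr normr0.
have I2 : I t2 by split.
suff : B = I by move=> BI; have [] : B t2 by rewrite BI.
apply: cI.
- by exists t1; split => //=; rewrite /f subrr mul0r addr0; have [_ ->] := fb_w bU Ug.
- exists (B `|` ~` I)°; first exact: open_interior.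
  apply/seteqP; split => [t Bt|t [It /interior_subset[]//]].
  split; first by case: Bt.
  have [It Et] := Bt; have [lt th tt] := It; have [_ cg wg] := sg t lt th.
  have [Uf wf _] := fb_phi bU (Hs t tt).
  have Ugt : U (g t) by rewrite [g t]Et.
  have [oU _ _] := fb_chart bU.
  have n1 : nbhs t (g @^-1` U) := cg _ (open_nbhs_nbhs (conj oU Ugt)).
  apply: filterS2 n1 (wg _ _ (fb_chart bU) Ugt) => s Us Es.
  have [Is|nI] := pselect (I s); [left|by right].
  split => //=; have [_ <- _ _] := fb_w bU Us.
  rewrite /f; congr phi; rewrite -[w (g s)](subrK (w (g t))) Es.
  by rewrite [in w (g t)]Et wf !rmorphB /=; ring.
exists (closure B); first exact: closed_closure.
apply/seteqP; split => [t Bt|t [It ct]]; first by split; [case: Bt|exact: subset_closure].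
split => //=; apply: (surface_hausdorff X) => P Q gP fQ.
have [lt th _] := It; have [_ cg _] := sg t lt th.
have nP : nbhs t (g @^-1` P) := cg _ gP.
have nQ : nbhs t (f @^-1` Q) := cf t It _ fQ.
have [s [[_ Es] [Ps Qs]]] := ct _ (filterI nP nQ).
by exists (g s); split => //; rewrite [g s]Es.
Qed.

Lemma straight_separation (F1 F2 : set S) : compact F1 -> closed F2 -> F1 `&` F2 = set0 ->
  F1 `<=` ~` zeros a ->
  exists2 d : R, 0 < d & forall g v l h t1 t2, straight v g l h ->
    l < t1 -> t1 < h -> l < t2 -> t2 < h -> nm v * `|t2 - t1| < d ->
    F1 (g t1) -> ~ F2 (g t2).
Proof.
move=> /compact_near_coveringP cF1 cF2 F12 nzF1.
pose P (d : R) p := forall g v l h t1 t2, straight v g l h ->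
    l < t1 -> t1 < h -> l < t2 -> t2 < h -> nm v * `|t2 - t1| < d ->
    g t1 = p -> ~ F2 (g t2).
have : \forall d \near 0^'+, F1 `<=` P d.
  apply: cF1 => p F1p.
  have nF2 : nbhs p (~` F2).
    apply: open_nbhs_nbhs; split; first exact: closed_openC.
    by move=> F2p; have : (F1 `&` F2) p by []; rewrite F12.
  have [U [w [phi [r [bU Up UF]]]]] := flat_box_ex mu_area mu_finite (nzF1 _ F1p) nF2.
  have r2 : 0 < r / 2 by have := fb_r bU; lra.
  have [oU _ _] := fb_chart bU.
  have [_ _ cw _] := fb_w bU Up.
  exists ((U `&` w @^-1` sqr (w p) (r / 2)), [set d : R | d < r / 2]).
    split => /=; last exact: nbhs_right_lt.
    apply: filterI; first exact: open_nbhs_nbhs.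
    exact: (cw _ (nbhs_sqr (sqr_center _ r2))).
  move=> [q d] /= [[Uq wq] dr] g v l h t1 t2 sg l1 h1 l2 h2 vd gq.
  have Hs t : `|t - t1| <= `|t2 - t1| -> sqr (w p) r (w (g t1) + (t - t1)%:C * v).
    move=> tt.
    have K : nm ((t - t1)%:C * v) < r / 2.
      rewrite nmM nmR mulrC; apply: le_lt_trans (lt_trans vd dr).
      by rewrite ler_wpM2l // nm_ge0.
    by rewrite gq [r]splitr; exact: sqr_add.
  have [|Uf _ _] := fb_phi bU (Hs t2 _); first by [].
  rewrite (straight_in_box bU sg l1 h1 l2 h2 _ Hs) ?gq // in Uf *.
  exact: UF.
move=> H.
have [d [d0 Hd]] := filter_ex (filterI (nbhs_right_gt 0) H).
exists d => // g v l h t1 t2 sg l1 h1 l2 h2 vd F1g.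
exact: (Hd _ F1g g v l h t1 t2 sg l1 h1 l2 h2 vd erefl).
Qed.
End straight.

(** * Compact sets of cosets *)

Section cosets.
Variable R : realType.
Implicit Types (G : set 'M[R]_2) (A B : 'M[R]_2).

Lemma entry_mulmx_cont B (i j : 'I_2) A :
  {for A, continuous (fun A : 'M[R]_2 => (A *m B) i j)}.
Proof.
have -> : (fun A : 'M[R]_2 => (A *m B) i j) = (fun A => A i 0 * B 0 j + A i 1 * B 1 j).
  by apply/funext => M; rewrite mulmx2E.
have c (k : 'I_2) : {for A, continuous (fun A : 'M[R]_2 => A i k)} := @coord_continuous R 2 2 i k A.
have m (k : 'I_2) (b : R) : {for A, continuous (fun A : 'M[R]_2 => A i k * b)}.
  by apply: (@continuousM _ _ (fun A : 'M[R]_2 => A i k) (fun=> b)); [exact: c|exact: cst_continuous].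
exact: (@continuousD _ _ _ (fun A : 'M[R]_2 => A i 0 * B 0 j) (fun A : 'M[R]_2 => A i 1 * B 1 j)).
Qed.

Lemma coset_class_eq G (A B : SL2 R) :
  coset_class G A = coset_class G B <-> left_coset G A = left_coset G B.
Proof.
have P := @eqmodP _ (coset_equiv_rel G) A B.
by split=> [/P/asboolP//|AB]; apply/P/asboolP.
Qed.

Variable G : set 'M[R]_2.
Hypothesis G_SL : forall A, G A -> \det A = 1.
Hypothesis G1 : G 1%:M.
Hypothesis GM : forall A B, G A -> G B -> G (A *m B).
Hypothesis GV : forall A, G A -> G (invmx A).

Lemma left_coset_eq (A B : SL2 R) :
  left_coset G A = left_coset G B <-> exists2 D, G D & \val A = \val B *m D.
Proof.
split=> [AB|[D GD AE]].
  have : left_coset G A (\val A) by exists 1%:M => //; rewrite mulmx1.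
  by rewrite AB => -[D GD <-]; exists D.
have uD : D \in unitmx by rewrite unitmxE (G_SL GD) unitr1.
apply/seteqP; split => _ [E GE <-].
  by exists (D *m E); [exact: GM|rewrite mulmxA AE].
exists (invmx D *m E); first by apply: GM => //; exact: GV.
by rewrite AE !mulmxA mulmxK.
Qed.

Lemma compact_coset_bounded (K : set (coset_space G)) : compact K ->
  exists N : nat, forall A : SL2 R, K (coset_class G A) ->
    exists E D, [/\ \val A = E *m D, G D, \det E = 1 & forall i j, `|E i j| < N%:R].
Proof.
move=> /compact_near_coveringP cK.
pose P (n : nat) (x : coset_space G) :=
  exists E : SL2 R, x = coset_class G E /\ forall i j, `|(\val E) i j| < n%:R.
have [N _ HN] : \forall n \near \oo, K `<=` P n.
  apply: cK => x Kx.
  pose A0 : SL2 R := repr x.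
  have A0x : coset_class G A0 = x by exact: reprK.
  have [N HN] : exists N : nat, forall i j, `|(\val A0) i j| < N%:R.
    exists (Num.truncn (\sum_i \sum_j `|(\val A0) i j|)).+1 => i j.
    apply: le_lt_trans (truncnS_gt _).
    rewrite (bigD1 i) //= (bigD1 j) //= -addrA lerDl addr_ge0 ?sumr_ge0 // => k _.
    exact: sumr_ge0.
  pose O : set (coset_space G) := [set y | P N y].
  have oO : open O.
    rewrite /open /= /quotient_open openE => A [E [AE EN]].
    have /coset_class_eq/left_coset_eq[D GD EE] : coset_class G E = coset_class G A by [].
    have near_A : \forall A' \near A, forall i j, `|((\val A') *m D) i j| < N%:R.
      suff near_ij (i j : 'I_2) : \forall A' \near A, `|((\val A') *m D) i j| < N%:R.
        have near_i (i : 'I_2) : \forall A' \near A, forall j, `|((\val A') *m D) i j| < N%:R.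
          exact: (@filter_forall _ _ (fun (j : 'I_2) (A' : SL2 R) => `|((\val A') *m D) i j| < N%:R) (nbhs (A : SL2 R)) _ (near_ij i)).
        exact: (@filter_forall _ _ (fun (i : 'I_2) (A' : SL2 R) => forall j, `|((\val A') *m D) i j| < N%:R) (nbhs (A : SL2 R)) _ near_i).
      have c1 : {for (A : SL2 R), continuous (fun A' : SL2 R => ((\val A') *m D) i j)}.
        apply: (@continuous_comp _ _ _ (fun A' : SL2 R => \val A') (fun M : 'M[R]_2 => (M *m D) i j)).
          exact: initial_continuous.
        exact: entry_mulmx_cont.
      have c2 : {for (A : SL2 R), continuous (fun A' : SL2 R => `|((\val A') *m D) i j|)}.
        exact: (continuous_comp c1 (@norm_continuous _ _ _)).
      have n1 : nbhs `|((\val A) *m D) i j| [set t | t < N%:R :> R].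
        by apply: open_nbhs_nbhs; split; [exact: open_lt|rewrite /= -EE].
      exact: (c2 _ n1).
    apply: filterS near_A => A' HA'.
    have dE : SL2 R (\val A' *m D) by rewrite /SL2 /= det_mulmx (G_SL GD) mulr1; have := valP A'; rewrite inE.
    pose E' : SL2 R := exist _ (\val A' *m D) (mem_set dE).
    exists E'; split => //.
    apply/coset_class_eq/left_coset_eq; exists (invmx D); first exact: GV.
    by rewrite /= mulmxK // unitmxE (G_SL GD) unitr1.
  have nO : nbhs x O by apply: open_nbhs_nbhs; split => //; exists A0.
  exists (O, [set n | (N <= n)%N]); first by split => //; exists N.
  move=> [y n] /= [[E [yE EN]] Nn]; exists E; split => // i j.
  by apply: lt_le_trans (EN i j) _; rewrite ler_nat.
exists N => A KA; have [E [AE EN]] := HN N (leqnn N) _ KA.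
have /left_coset_eq[D GD AD] := (coset_class_eq _ _ _).1 AE.
exists (\val E), D; split => //.
by have := valP E; rewrite inE.
Qed.
End cosets.

(** * Ergodicity *)

Section strips.
Variable R : realType.
Local Notation RR := (measurableTypeR R * measurableTypeR R)%type.
Local Notation lam := (@lebesgue_measure R).
Local Notation lam2 := (@lebesgue_measure R \x @lebesgue_measure R)%E.

Lemma strip_le (Q B : set (measurableTypeR R)) (E : set RR) :
  measurable Q -> measurable B -> measurable E ->
  (forall x, Q x -> (lam B <= lam (xsection E x))%E) ->
  (lam2 (Q `*` B) <= lam2 E)%E.
Proof.
move=> mQ mB mE H.
have mx := measurable_fun_xsection lam mE.
have -> : lam2 (Q `*` B) = (\int[lam]_(x in Q) cst (lam B) x)%E.
  by rewrite integral_cst // product_measure1E // muleC.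
apply: (@le_trans _ _ (\int[lam]_(x in Q) (lam \o xsection E) x)%E).
  apply: ge0_le_integral => //.
  by apply: measurable_funS mx.
rewrite /product_measure1; apply: ge0_subset_integral => //.
Qed.

Lemma strip_dichotomy (Q B : set (measurableTypeR R)) (E : set RR) :
  measurable Q -> measurable B -> measurable E ->
  (forall x, Q x -> B `<=` xsection E x \/ Q `\` B `<=` xsection E x) ->
  (lam2 (Q `*` B) <= lam2 E)%E \/ (lam2 (Q `*` (Q `\` B)) <= lam2 E)%E.
Proof.
move=> mQ mB mE H.
have mQB : measurable (Q `\` B) by exact: measurableD.
have le_sec x (D : set (measurableTypeR R)) : measurable D -> D `<=` xsection E x -> (lam D <= lam (xsection E x))%E.
  by move=> mD DE; apply: le_measure; rewrite ?inE //; exact: measurable_xsection.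
have [le|/ltW le] := leP (lam B) (lam (Q `\` B)); [left|right]; apply: strip_le => // x /H[] K.
- exact: le_sec.
- by apply: le_trans le _; exact: le_sec.
- by apply: le_trans le _; exact: le_sec.
- exact: le_sec.
Qed.
End strips.

Section cell.
Variables (R : realType) (S : ptopologicalType) (X : riemann_surface R S).
Variables (a : abelian_differential X) (mu : {measure set (borel S) -> \bar R}).
Notation C := (Cplx R).
Local Notation RR := (measurableTypeR R * measurableTypeR R)%type.
Local Notation lam2 := (@lebesgue_measure R \x @lebesgue_measure R)%E.
Variables (U : set S) (w : S -> C) (phi : C -> S) (c : C) (r : R).
Hypothesis bU : flat_box a mu U w phi c r.
Variables (B : 'M[R]_2) (rho : R).
Hypothesis detB : \det B = 1.
Implicit Types (u : RR) (G : set S).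

(* The columns of the inverse of [B]. *)
Definition col1 : C := B 1 1 +i* - B 1 0.
Definition col2 : C := - B 0 1 +i* B 0 0.

Definition skew u : C := c + u.2%:C * col2 + u.1%:C * col1.

Definition unskew (p : RR) : RR :=
  (B 0 0 * p.1 + B 0 1 * p.2 + - (B 0 0 * complex.Re c + B 0 1 * complex.Im c),
   B 1 0 * p.1 + B 1 1 * p.2 + - (B 1 0 * complex.Re c + B 1 1 * complex.Im c)).

Let dB : B 0 0 * B 1 1 = 1 + B 0 1 * B 1 0.
Proof. by rewrite -detB det2; ring. Qed.

Lemma plane_act_col1 : plane_act B col1 = 1.
Proof. by rewrite /plane_act /col1 /=; congr Complex; rewrite ?mulrN ?dB; ring. Qed.

Lemma plane_act_col2 : plane_act B col2 = 0 +i* 1.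
Proof. by rewrite /plane_act /col2 /=; congr Complex; rewrite ?[B 1 1 * _]mulrC ?dB; ring. Qed.

Lemma skewE u : toRR (skew u) =
  (complex.Re c - u.2 * B 0 1 + u.1 * B 1 1, complex.Im c + u.2 * B 0 0 - u.1 * B 1 0).
Proof. by rewrite /skew /toRR /col1 /col2; case: c u => x y [u1 u2] /=; congr pair; ring. Qed.

Lemma skewK p : skew (unskew p) = ptp p.
Proof.
rewrite -[LHS]ptpK skewE; congr ptp; rewrite /unskew /=; case: p => p1 p2 /=; congr pair.
  transitivity (complex.Re c + (p1 - complex.Re c) * (B 0 0 * B 1 1 - B 0 1 * B 1 0)); first by ring.
  by rewrite dB; ring.
transitivity (complex.Im c + (p2 - complex.Im c) * (B 0 0 * B 1 1 - B 0 1 * B 1 0)); first by ring.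
by rewrite dB; ring.
Qed.

Definition side : set (measurableTypeR R) := `]- rho, rho[%classic.

Hypothesis skew_box : forall u, (side `*` side) u -> sqr c r (skew u).

Definition cell : set S := [set q | U q /\ (side `*` side) (unskew (toRR (w q)))].
Definition cell_coord G : set RR := [set u | (side `*` side) u /\ G (phi (skew u))].

Let mside : measurable (side `*` side : set RR).
Proof. by apply: measurableX; exact: measurable_itv. Qed.

Let scales_unskew : scales unskew 1.
Proof.
have d1 : B 0 0 * B 1 1 - B 0 1 * B 1 0 = 1 by rewrite dB; ring.
have := @scales_affine R (B 0 0) (B 0 1) (B 1 0) (B 1 1)
  (- (B 0 0 * complex.Re c + B 0 1 * complex.Im c)) (- (B 1 0 * complex.Re c + B 1 1 * complex.Im c)).
by rewrite d1 normr1 invr1; apply; exact: oner_neq0.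
Qed.

Lemma measurable_cell : measurable (cell : set (borel S)).
Proof.
have [oU _ _] := fb_chart bU.
have mw := @borel_continuous_toRR R S U w oU (fun q Uq => let: And4 _ _ cw _ := fb_w bU Uq in cw).
have := mw (borel_open oU) _ (preimage_measurable (proj1 scales_unskew) mside).
by [].
Qed.

Lemma skew_cont (u : R * R) : {for u, continuous (skew : R * R -> C)}.
Proof.
apply/(@cvg_nm R _ (nbhs u) _ (skew : R * R -> C)) => e e0.
have n1 := nm_ge0 col1; have n2 := nm_ge0 col2.
have [K KE] : exists K, K = nm col1 + nm col2 + 1 by exists (nm col1 + nm col2 + 1).
have k0 : 0 < K by lra.
have : nbhs u (ball u (e / K)) by apply: nbhsx_ballx; exact: divr_gt0.
apply: filterS => u' [/=]; rewrite /ball /= (distrC u.1) (distrC u.2) => u1 u2.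
have -> : skew u' - skew u = (u'.2 - u.2)%:C * col2 + (u'.1 - u.1)%:C * col1.
  by rewrite /skew !rmorphB /=; ring.
apply: le_lt_trans (nmD _ _) _; rewrite !nmM !nmR.
move: u1 u2; rewrite !ltr_pdivlMr // KE.
move: `|u'.1 - u.1| `|u'.2 - u.2| (normr_ge0 (u'.1 - u.1)) (normr_ge0 (u'.2 - u.2)) => x y x0 y0.
have [xy|/ltW yx] := leP x y => u1 u2.
  have := ler_wpM2r n1 xy. lra.
by have := ler_wpM2r n2 yx; lra.
Qed.

Lemma measurable_cell_coord G : measurable (G : set (borel S)) -> measurable (cell_coord G).
Proof.
move=> mG.
have oQ : open (side `*` side : set (R * R)).
  rewrite openE => -[x y] [Qx Qy]; exists (side, side) => //=.
  by split; apply: open_nbhs_nbhs; split => //; exact: interval_open.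
have cg (u : R * R) : (side `*` side) u -> {for u, continuous ((fun u => phi (skew u)) : R * R -> S)}.
  move=> /skew_box /(fb_phi bU)[_ _ cphi].
  exact: (continuous_comp (@skew_cont u) cphi).
exact: (cont_preimage_measurable oQ cg mside mG).
Qed.

Lemma cell_area G : measurable (G : set (borel S)) -> mu (cell `&` G) = lam2 (cell_coord G).
Proof.
move=> mG.
have mcG : measurable (cell `&` G : set (borel S)) by apply: (@measurableI _ (borel S)) => //; exact: measurable_cell.
rewrite (fb_area bU mcG); last by move=> q [[]].
have [_ /(_ _ (measurable_cell_coord mG))] := scales_unskew; rewrite mul1e => <-.
congr (_ _); apply/seteqP; split => p /=.
  move=> [pr [[Up Qp] Gp]]; have [_ wp _] := fb_phi bU pr.
  by rewrite wp toRRK in Qp; split; rewrite ?skewK.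
move=> [Qp]; rewrite skewK => Gp.
have pr : sqr c r (ptp p) by rewrite -skewK; exact: skew_box.
have [Up wp _] := fb_phi bU pr.
by split => //; split => //; split => //; rewrite wp toRRK.
Qed.

Hypothesis mu_area : is_area_measure a mu.
Hypothesis mu_finite : (mu [set: S] < +oo)%E.

Lemma straight_horizontal (y : R) : side y ->
  straight a col1 (fun x => phi (skew (x, y))) (- rho) rho.
Proof.
move=> Qy; apply: (straight_box (z := c + y%:C * col2) bU) => x lx xh.
by apply: (@skew_box (x, y)); split => //; rewrite /side /= in_itv /= lx xh.
Qed.

Lemma straight_vertical (x : R) : side x ->
  straight a col2 (fun y => phi (skew (x, y))) (- rho) rho.
Proof.
move=> Qx.
have -> : (fun y => phi (skew (x, y))) = (fun y => phi ((c + x%:C * col1) + y%:C * col2)).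
  by apply/funext => y; rewrite /skew addrAC.
apply: (straight_box (z := c + x%:C * col1) bU) => y ly yh; rewrite addrAC.
by apply: (@skew_box (x, y)); split => //; rewrite /side /= in_itv /= ly yh.
Qed.

(* In the cell, [f^-1 A] is a union of horizontal segments since [A] is flow
   invariant, while no vertical segment meets the preimages of both [F1] and
   [F2]; so each vertical segment meets the preimage of the complement of
   [F1 `|` F2] in a set containing a copy of the base of [f^-1 A], or one of the
   base of its complement. *)
Lemma cell_alternative (M D : 'M[R]_2) (f : S -> S) (A F1 F2 : set S) (d : R) :
  0 < rho -> affine_diffeo a M f -> M = D *m B -> D 0 1 = 0 -> D 1 0 = 0 -> D 0 0 != 0 ->
  \det M = 1 -> `|D 1 1| * (2 * rho) < d ->
  (forall g v l h t1 t2, straight a v g l h ->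
    l < t1 -> t1 < h -> l < t2 -> t2 < h -> nm v * `|t2 - t1| < d ->
    F1 (g t1) -> ~ F2 (g t2)) ->
  flow_invariant a A -> measurable (A : set (borel S)) ->
  measurable (F1 : set (borel S)) -> measurable (F2 : set (borel S)) ->
  F1 `<=` A -> F2 `<=` ~` A ->
  (mu (cell `&` f @^-1` A) <= mu (~` (F1 `|` F2)))%E \/
  (mu (cell `&` f @^-1` (~` A)) <= mu (~` (F1 `|` F2)))%E.
Proof.
move=> rho0 af ME D01 D10 D00 dM Dd sep invA mA m1 m2 F1A F2A.
have mf G : measurable (G : set (borel S)) -> measurable (f @^-1` G : set (borel S)).
  move=> mG; have := @borel_continuous S S setT f openT (fun p _ => @affine_continuous _ _ _ _ _ _ af p).
  by move=> /(_ (@measurableT _ (borel S)) _ mG); rewrite setTI.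
have mE : measurable (~` (F1 `|` F2) : set (borel S)).
  by apply: (@measurableC _ (borel S)); exact: (@measurableU _ (borel S)).
have mAc : measurable (~` A : set (borel S)) by exact: (@measurableC _ (borel S)).
have v1 : plane_act M col1 = (D 0 0)%:C.
  by rewrite ME plane_actM plane_act_col1 /plane_act /= D10; congr Complex; ring.
have v2 : plane_act M col2 = 0 +i* D 1 1.
  by rewrite ME plane_actM plane_act_col2 /plane_act /= D01; congr Complex; ring.
pose P x y := f (phi (skew (x, y))).
have sideP x : side x -> - rho < x /\ x < rho.
  by rewrite /side /= in_itv /= => /andP[].
have s0 : side 0 by rewrite /side /= in_itv /= oppr_lt0 rho0.
have Ahor x y : side x -> side y -> A (P x y) <-> A (P 0 y).
  move=> Qx Qy; have sh := straight_affine mu_area mu_finite af (straight_horizontal Qy).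
  rewrite v1 in sh; have [? ?] := sideP _ Qx; have [? ?] := sideP _ s0.
  exact: (invariant_straight mu_area mu_finite invA D00 sh).
have Fver x y y' : side x -> side y -> side y' -> F1 (P x y) -> ~ F2 (P x y').
  move=> Qx Qy Qy'; have sv := straight_affine mu_area mu_finite af (straight_vertical Qx).
  rewrite v2 in sv; have [? ?] := sideP _ Qy; have [? ?] := sideP _ Qy'.
  apply: (sep _ _ _ _ y y' sv) => //.
  apply: le_lt_trans Dd; apply: ler_pM => //; first exact: nm_ge0.
    by apply: le_trans (nm_ReIm _) _; rewrite /= normr0 add0r.
  by rewrite ler_norml; apply/andP; split; lra.
pose Bs : set (measurableTypeR R) := xsection (cell_coord (f @^-1` A)) 0.
have BsP y : Bs y <-> side y /\ A (P 0 y).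
  by rewrite /Bs /xsection /= inE /cell_coord /=; split => [[[_ Qy] Ay]|[Qy Ay]].
have mBs : measurable Bs by apply: measurable_xsection; apply: measurable_cell_coord; exact: mf.
have mcE : measurable (cell_coord (f @^-1` (~` (F1 `|` F2)))) by apply: measurable_cell_coord; exact: mf.
have leE : (lam2 (cell_coord (f @^-1` (~` (F1 `|` F2)))) <= mu (~` (F1 `|` F2)))%E.
  rewrite -cell_area; last exact: mf.
  rewrite -(affine_measure mu_area mu_finite af dM mE); apply: le_measure; rewrite ?inE //; last exact: mf.
  by apply: (@measurableI _ (borel S)); [exact: measurable_cell|exact: mf].
have EA : cell_coord (f @^-1` A) = side `*` Bs.
  apply/seteqP; split => -[x y] /=.
    by move=> [[Qx Qy] Axy]; split => //; apply/BsP; split => //; exact: (Ahor x y Qx Qy).1.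
  by move=> [Qx /BsP[Qy A0y]]; split => //; exact: (Ahor x y Qx Qy).2.
have EAc : cell_coord (f @^-1` (~` A)) = side `*` (side `\` Bs).
  apply/seteqP; split => -[x y] /=.
    move=> [[Qx Qy] nAxy]; split => //; split => // /BsP[_ A0y]; apply: nAxy.
    exact: (Ahor _ _ Qx Qy).2.
  move=> [Qx [Qy nBs]]; split => // Axy; apply: nBs; apply/BsP; split => //.
  exact: (Ahor _ _ Qx Qy).1.
have ms : measurable side by exact: measurable_itv.
have [x Qx|le|le] := strip_dichotomy ms mBs mcE.
- have [[y [Qy F1y]]|nF1] := pselect (exists y, side y /\ F1 (P x y)).
    right => y' [Qy' nBs]; rewrite /xsection /= inE; split => //=; apply/not_orP; split.
      move=> F1y'; apply: nBs; apply/BsP; split => //.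
      by apply: (Ahor x y' Qx Qy').1; exact: F1A.
    exact: Fver F1y.
  left => y' /BsP[Qy' Ay']; rewrite /xsection /= inE; split => //=; apply/not_orP; split.
    by move=> F1y'; apply: nF1; exists y'.
  by move=> /F2A; apply; exact: (Ahor x y' Qx Qy').2.
- by left; rewrite cell_area ?EA; [exact: le_trans leE|exact: mf].
- by right; rewrite cell_area ?EAc; [exact: le_trans leE|exact: mf].
Qed.
End cell.

Section vanishing.
Variables (R : realType) (S : ptopologicalType) (X : riemann_surface R S).
Variables (a : abelian_differential X) (mu : {measure set (borel S) -> \bar R}).
Notation C := (Cplx R).
Local Notation RR := (measurableTypeR R * measurableTypeR R)%type.
Local Notation lam2 := (@lebesgue_measure R \x @lebesgue_measure R)%E.
Hypothesis mu_area : is_area_measure a mu.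
Hypothesis mu_finite : (mu [set: S] < +oo)%E.

Let mu_le (A B : set S) : measurable (A : set (borel S)) -> measurable (B : set (borel S)) -> A `<=` B -> (mu A <= mu B)%E.
Proof. by move=> mA mB AB; apply: le_measure; rewrite ?inE. Qed.

Lemma open_measure_gt0 (O : set S) q : open O -> O q -> ~ zeros a q -> (0 < mu O)%E.
Proof.
move=> oO Oq nzq.
have [U [w [phi [r [bU Uq UO]]]]] := flat_box_ex mu_area mu_finite nzq (open_nbhs_nbhs (conj oO Oq)).
have r0 := fb_r bU.
have [oU _ _] := fb_chart bU.
have mU := borel_open oU.
apply: lt_le_trans (mu_le mU (borel_open oO) UO).
rewrite (fb_area bU mU (@subset_refl _ _)).
set x := complex.Re (w q); set y := complex.Im (w q).
have le1 : x - r / 2 <= x + r / 2 by lra.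
have le2 : y - r / 2 <= y + r / 2 by lra.
apply: (@lt_le_trans _ _ (lam2 ([set p | x - r / 2 < p.1 <= x + r / 2 /\ y - r / 2 < p.2 <= y + r / 2] : set RR))).
  by rewrite lam2_rect // lte_fin mulr_gt0 //; lra.
have -> : ([set p | sqr (w q) r (ptp p) /\ U (phi (ptp p))] : set RR) =
    [set p | x - r < p.1 < x + r /\ y - r < p.2 < y + r].
  have sqrE p : sqr (w q) r (ptp p) <-> x - r < p.1 < x + r /\ y - r < p.2 < y + r.
    by rewrite -!ltr_distl /sqr /x /y; case: (w q) p => u v [u' v'].
  apply/seteqP; split => p; first by move=> [/sqrE].
  by move=> /sqrE pr; split => //; case: (fb_phi bU pr).
apply: le_measure; rewrite ?inE.
- have -> : ([set p | x - r / 2 < p.1 <= x + r / 2 /\ y - r / 2 < p.2 <= y + r / 2] : set RR) =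
      `]x - r / 2, x + r / 2]%classic `*` `]y - r / 2, y + r / 2]%classic.
    by apply/seteqP; split => p /=; rewrite !in_itv.
  by apply: measurableX; exact: measurable_itv.
- exact: measurable_oo2.
by move=> p /= [/andP[? ?] /andP[? ?]]; split; apply/andP; split; lra.
Qed.

Variable F : set_system nat.
Context {FF : ProperFilter F}.
Variable A_ : nat -> set S.
Hypothesis mA : forall n, measurable (A_ n : set (borel S)).

Definition vanishes (V : set S) := open V /\
  forall e : R, 0 < e -> F [set n | (mu (V `&` A_ n) < e%:E)%E].

Let mVA (V : set S) n : open V -> measurable (V `&` A_ n : set (borel S)).
Proof. by move=> oV; apply: (@measurableI _ (borel S)) => //; exact: borel_open. Qed.

Lemma vanishes_sub V V' : open V' -> V' `<=` V -> vanishes V -> vanishes V'.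
Proof.
move=> oV' V'V [oV HV]; split => // e /HV; apply: filterS => n /=; apply: le_lt_trans.
by apply: mu_le; [exact: mVA|exact: mVA|exact: setSI].
Qed.

Lemma vanishesU V V' : vanishes V -> vanishes V' -> vanishes (V `|` V').
Proof.
move=> [oV HV] [oV' HV']; split; first exact: openU.
move=> e e0; have e2 : 0 < e / 2 by lra.
apply: filterS2 (HV _ e2) (HV' _ e2) => n /= H H'.
rewrite setIUl; apply: le_lt_trans (measureU2 mu (mVA n oV) (mVA n oV')) _.
by rewrite [e]splitr EFinD; exact: lteD.
Qed.

Lemma vanishes_everywhere : (forall q, ~ zeros a q -> exists2 V, vanishes V & V q) ->
  forall e : R, 0 < e -> exists n, (mu (A_ n) < e%:E)%E.
Proof.
move=> H e e0; have e2 : 0 < e / 2 by lra.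
have v0 : vanishes set0.
  by split; [exact: open0|move=> d d0; apply: filterE => n /=; rewrite set0I measure0 lte_fin].
have [|V V' oV' V'V vV|q nzq|M [HM cM]] := @countable_open_cover S (surface_second_countable X)
  vanishes (~` zeros a).
- exact: v0.
- exact: vanishes_sub V'V vV.
- by have [V vV Vq] := H _ nzq; have [oV _] := vV; exists V; split.
have oM n : open (M n) by case: (HM n).
have vM n : vanishes (M n) by case: (HM n).
have [N HN] := finite_union_approx mu_finite (fun n => borel_open (oM n)) e2.
set O := \big[_/_]_(n < N) _ in HN.
have vO : vanishes O by rewrite /O; elim/big_ind: _ => // V V'; exact: vanishesU.
have [oO HO] := vO.
have [n Hn] := filter_ex (HO _ e2); exists n.
have mz := zeros_measurable mu_area mu_finite.
have mM : measurable (\bigcup_n M n : set (borel S)).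
  by apply: borel_open; exact: bigcup_open.
have mD : measurable ((\bigcup_n M n) `\` O : set (borel S)).
  by apply: (@measurableD _ (borel S)) => //; exact: borel_open.
have mVn := mVA n oO.
apply: (@le_lt_trans _ _ (mu (O `&` A_ n) + mu ((\bigcup_n M n) `\` O) + mu (zeros a))%E).
  apply: le_trans (leeD2r _ (measureU2 mu mVn mD)).
  have mU : measurable ((O `&` A_ n) `|` ((\bigcup_n M n) `\` O) : set (borel S)) by exact: (@measurableU _ (borel S)).
  apply: le_trans (measureU2 mu mU mz); apply: mu_le => //; first exact: (@measurableU _ (borel S)).
  move=> q Aq; have [zq|nzq] := pselect (zeros a q); [by right|left].
  have [Oq|nOq] := pselect (O q); [by left|right].
  by split => //; exact: cM.
by rewrite (zeros_null mu_area mu_finite) adde0 [e]splitr EFinD; exact: lteD.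
Qed.
End vanishing.

Section dichotomy.
Variables (R : realType) (S : ptopologicalType) (X : riemann_surface R S).
Variables (a : abelian_differential X) (mu : {measure set (borel S) -> \bar R}).
Notation C := (Cplx R).
Hypothesis mu_area : is_area_measure a mu.
Hypothesis mu_finite : (mu [set: S] < +oo)%E.
Variable A_ : nat -> set S.
Hypothesis mA : forall n, measurable (A_ n : set (borel S)).

Let mVA (V : set S) (G : set S) : open V -> measurable (G : set (borel S)) -> measurable (V `&` G : set (borel S)).
Proof. by move=> oV mG; apply: (@measurableI _ (borel S)) => //; exact: borel_open. Qed.

(* Along an ultrafilter on [nat] finer than [\oo], the points near which [A_ n]
   vanishes, and those near which its complement does, form two disjoint open
   sets that cover the complement of the zeros. *)
Lemma vanishing_dichotomy :
  (forall q, ~ zeros a q -> exists V : set S, [/\ open V, V q & forall e : R, 0 < e ->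
     \forall n \near \oo, (mu (V `&` A_ n) < e%:E)%E \/ (mu (V `&` ~` A_ n) < e%:E)%E]) ->
  (forall e : R, 0 < e -> exists n, (mu (A_ n) < e%:E)%E) \/
  (forall e : R, 0 < e -> exists n, (mu (~` A_ n) < e%:E)%E).
Proof.
move=> H.
have [F [FU Foo]] := @ultraFilterLemma nat \oo _.
pose W (A : nat -> set S) := ~` zeros a `&` \bigcup_(V in vanishes mu F A) V.
have oW A : open (W A).
  apply: openI; first exact: nonzeros_open mu_area mu_finite.
  by apply: bigcup_open => V [].
have mAc n : measurable (~` A_ n : set (borel S)) by exact: (@measurableC _ (borel S)).
have W01 : W A_ `&` W (fun n => ~` A_ n) = set0.
  apply/seteqP; split => // q [[nzq [V [oV HV] Vq]] [_ [V' [oV' HV'] V'q]]].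
  have oO : open (V `&` V') by exact: openI.
  have mO : measurable (V `&` V' : set (borel S)) by exact: borel_open.
  have := open_measure_gt0 mu_area mu_finite oO (conj Vq V'q) nzq.
  have Ofin : (mu (V `&` V') < +oo)%E.
    by apply: le_lt_trans mu_finite; apply: le_measure; rewrite ?inE.
  move=> O0; have fO : mu (V `&` V') \is a fin_num by rewrite ge0_fin_numE.
  have m0 : 0 < fine (mu (V `&` V')) by rewrite fine_gt0 // O0.
  have m2 : 0 < fine (mu (V `&` V')) / 2 by lra.
  have [n [/= H1 H2]] := filter_ex (filterI (HV _ m2) (HV' _ m2)).
  have : (mu (V `&` V') < mu (V `&` V'))%E; last by rewrite ltxx.
  apply: (@le_lt_trans _ _ (mu (V `&` A_ n) + mu (V' `&` ~` A_ n))%E).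
    apply: le_trans (measureU2 mu (mVA oV (mA n)) (mVA oV' (mAc n))).
    apply: le_measure; rewrite ?inE //.
      by apply: (@measurableU _ (borel S)); exact: mVA.
    by move=> p [Vp V'p]; have [?|?] := pselect (A_ n p); [left|right].
  by rewrite -[ltRHS]fineK // [fine _]splitr EFinD; exact: lteD.
have WU : W A_ `|` W (fun n => ~` A_ n) = ~` zeros a.
  apply/seteqP; split => q; first by case=> -[].
  move=> nzq; have [V [oV Vq HV]] := H q nzq.
  have [[_ v0]|nv] := pselect (vanishes mu F A_ V); [by left; split => //; exists V|right].
  split => //; exists V => //; split => // e e0.
  have /existsNP[d /not_implyP[d0 nF]] : ~ forall e : R, 0 < e -> F [set n | (mu (V `&` A_ n) < e%:E)%E].
    by move=> K; apply: nv.
  have Fd : F (~` [set n | (mu (V `&` A_ n) < d%:E)%E]).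
    by case: (in_ultra_setVsetC [set n | (mu (V `&` A_ n) < d%:E)%E] FU).
  have ed0 : 0 < Num.min e d by rewrite lt_min e0.
  apply: filterS2 Fd (Foo _ (HV _ ed0)) => n /= nd [ed|ed].
    exfalso; apply: nd; apply: lt_le_trans ed _.
    by rewrite lee_fin ge_min lexx orbT.
  by apply: lt_le_trans ed _; rewrite lee_fin ge_min lexx.
have := nonzeros_not_separated (oW _) (oW _) W01 WU.
case=> W0; rewrite W0 ?set0U ?setU0 in WU; [right|left]; move=> e e0.
  apply: (@vanishes_everywhere R S X a mu mu_area mu_finite F _ _ mAc) e0.
  by move=> q nzq; have : (~` zeros a) q by []; rewrite -WU => -[_ [V vV Vq]]; exists V.
apply: (@vanishes_everywhere R S X a mu mu_area mu_finite F _ _ mA) e0.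
by move=> q nzq; have : (~` zeros a) q by []; rewrite -WU => -[_ [V vV Vq]]; exists V.
Qed.
End dichotomy.

Section renormalization.
Variables (R : realType) (S : ptopologicalType) (X : riemann_surface R S).
Variables (a : abelian_differential X) (mu : {measure set (borel S) -> \bar R}).
Notation C := (Cplx R).
Hypothesis mu_area : is_area_measure a mu.
Hypothesis mu_finite : (mu [set: S] < +oo)%E.
Implicit Types (p q : S) (U V : set S) (w : S -> C) (B D M : 'M[R]_2).

Lemma invmx_teichmuller (t : R) : invmx (teichmuller_mx t) = teichmuller_mx (- t).
Proof.
have E : teichmuller_mx t *m teichmuller_mx (- t) = 1%:M.
  apply/matrixP => -[[|[|i]] // Hi] [[|[|j]] // Hj]; rewrite mulmx2E !mxE /=
    ?(mulr1n, mulr0n, mulr0, mul0r, addr0, add0r) // -expRD ?opprK ?addNr ?subrr expR0 //.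
by rewrite -[RHS](mulKmx (det1_unit (det_teichmuller_mx t))) E mulmx1.
Qed.

(* Write [g_t = B *m G] with [G] in the Veech group and [B] bounded: the inverse
   of an affine map with linear part [G] or [- G] has linear part
   [g_t^-1 *m B] or its opposite. *)
Lemma recurrent_lifts (K : set (coset_space (veech_group a))) : compact K ->
  exists N : nat, forall t : R, K (coset_class (veech_group a) (teichmuller t)) ->
    exists f M D B, [/\ affine_diffeo a M f /\ \det M = 1, M = D *m B,
      [/\ D 0 1 = 0, D 1 0 = 0, D 0 0 != 0 & `|D 1 1| = expR (- t)],
      \det B = 1 & forall i j, `|B i j| < N%:R].
Proof.
move=> cK.
have [N HN] := compact_coset_bounded (fun A (HA : veech_group a A) => proj1 HA)
  (veech1 a) (fun A B => @veechM _ _ _ _ _ mu_area mu_finite A B) (fun A => @veechV _ _ _ _ A) cK.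
exists N => t /HN[B [G [tE [dG [f Hf]] dB BN]]].
rewrite /= in tE.
have uG := det1_unit dG; have uB := det1_unit dB.
have uT : teichmuller_mx t \in unitmx by exact: det1_unit (det_teichmuller_mx t).
have GE : invmx G = teichmuller_mx (- t) *m B.
  by rewrite -invmx_teichmuller -[LHS](mulKmx uT) {2}tE -mulmxA mulmxV // mulmx1.
have T01 : teichmuller_mx (- t) 0 1 = 0 by rewrite !mxE.
have T10 : teichmuller_mx (- t) 1 0 = 0 by rewrite !mxE.
have T00 : teichmuller_mx (- t) 0 0 = expR t by rewrite !mxE /= opprK.
have T11 : teichmuller_mx (- t) 1 1 = expR (- t) by rewrite !mxE.
case: Hf => Hf.
  have [f' [Hf' _ _]] := affine_inv Hf dG.
  exists f', (invmx G), (teichmuller_mx (- t)), B; split => //.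
  - by split => //; rewrite det_inv dG invr1.
  - by split; rewrite ?T00 ?T11 ?gt_eqF ?expR_gt0 // gtr0_norm // expR_gt0.
have dG' : \det (- G) = 1 by rewrite det_opp.
have [f' [Hf' _ _]] := affine_inv Hf dG'.
exists f', (invmx (- G)), (- teichmuller_mx (- t)), B; split => //.
- by split => //; rewrite det_inv dG' invr1.
- have uN : (-1 : R) \is a GRing.unit by rewrite unitrN unitr1.
  by rewrite -scaleN1r invmxZ ?scaleN1r ?unitmxE ?det_opp ?dG ?unitr1 // invrN1 scaleN1r GE mulNmx.
split; rewrite mxE ?T01 ?T10 ?T00 ?T11 ?oppr0 ?oppr_eq0 ?gt_eqF ?expR_gt0 //.
by rewrite normrN gtr0_norm // expR_gt0.
Qed.

Lemma local_alternative (N : nat) q : ~ zeros a q -> exists V rho,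
  [/\ open V, V q, 0 < rho & forall B, \det B = 1 -> (forall i j, `|B i j| < N%:R) ->
    forall M D (f : S -> S) (A F1 F2 : set S) (d : R),
    affine_diffeo a M f -> M = D *m B -> D 0 1 = 0 -> D 1 0 = 0 -> D 0 0 != 0 ->
    \det M = 1 -> `|D 1 1| * (2 * rho) < d ->
    (forall g v l h t1 t2, straight a v g l h ->
      l < t1 -> t1 < h -> l < t2 -> t2 < h -> nm v * `|t2 - t1| < d ->
      F1 (g t1) -> ~ F2 (g t2)) ->
    flow_invariant a A -> measurable (A : set (borel S)) ->
    measurable (F1 : set (borel S)) -> measurable (F2 : set (borel S)) ->
    F1 `<=` A -> F2 `<=` ~` A ->
    (mu (V `&` f @^-1` A) <= mu (~` (F1 `|` F2)))%E \/
    (mu (V `&` f @^-1` (~` A)) <= mu (~` (F1 `|` F2)))%E].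
Proof.
move=> nzq.
have [U [w [phi [r [bU Uq _]]]]] := flat_box_ex mu_area mu_finite nzq filterT.
have r0 := fb_r bU; have [oU _ _] := fb_chart bU.
have N0 : 0 < N%:R + 1 :> R by rewrite ltr_wpDl // ler0n.
pose rho := r / (2 * (N%:R + 1)).
pose s := rho / (2 * (N%:R + 1)).
have rho0 : 0 < rho by rewrite divr_gt0 // mulr_gt0.
have s0 : 0 < s by rewrite divr_gt0 // mulr_gt0.
have bound (x y b c e : R) : 0 < e -> `|x| < e / (2 * (N%:R + 1)) -> `|y| < e / (2 * (N%:R + 1)) ->
    `|b| < N%:R -> `|c| < N%:R -> `|b * x + c * y| < e.
  move=> e0; rewrite !ltr_pdivlMr ?mulr_gt0 // => xe ye bN cN.
  apply: le_lt_trans (ler_normD _ _) _; rewrite !normrM.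
  have := ler_wpM2r (normr_ge0 x) (ltW bN); have := ler_wpM2r (normr_ge0 y) (ltW cN).
  move: xe ye (normr_ge0 x) (normr_ge0 y); lra.
have ReB (z z' : C) : complex.Re (z - z') = complex.Re z - complex.Re z' by case: z z' => ? ? [].
have ImB (z z' : C) : complex.Im (z - z') = complex.Im z - complex.Im z' by case: z z' => ? ? [].
pose V : set S := U `&` w @^-1` sqr (w q) s.
have oV : open V.
  rewrite openE => p [Up wp]; have [_ _ cw _] := fb_w bU Up.
  apply: filterI; first exact: open_nbhs_nbhs.
  exact: (cw _ (nbhs_sqr wp)).
exists V, rho; split => //; first by split => //; exact: sqr_center.
move=> B dB BN M D f A F1 F2 d Hf ME D01 D10 D00 dM Dd sep invA mA m1 m2 F1A F2A.
have sb u : (side rho `*` side rho) u -> sqr (w q) r (skew (w q) B u).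
  rewrite /side => -[/= ]; rewrite !in_itv /= -!ltr_norml => u1 u2.
  have E := skewE (w q) B u; rewrite /toRR in E; case: E => E1 E2.
  split.
    have -> : complex.Re (skew (w q) B u - w q) = B 1 1 * u.1 + - B 0 1 * u.2.
      by rewrite ReB E1; ring.
    by apply: bound => //; rewrite ?normrN.
  have -> : complex.Im (skew (w q) B u - w q) = B 0 0 * u.2 + - B 1 0 * u.1.
    by rewrite ImB E2; ring.
  by apply: bound => //; rewrite ?normrN.
have Vcell : V `<=` cell U w (w q) B rho.
  move=> p [Up [p1 p2]]; split => //.
  have p1' : `|complex.Re (w p) - complex.Re (w q)| < s by rewrite -ReB.
  have p2' : `|complex.Im (w p) - complex.Im (w q)| < s by rewrite -ImB.
  rewrite /unskew /side; split => /=; rewrite in_itv /= -ltr_norml.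
    have := bound _ _ (B 0 0) (B 0 1) _ rho0 p1' p2' (BN _ _) (BN _ _).
    by congr (`|_| < _); ring.
  have := bound _ _ (B 1 0) (B 1 1) _ rho0 p1' p2' (BN _ _) (BN _ _).
  by congr (`|_| < _); ring.
have mf G : measurable (G : set (borel S)) -> measurable (f @^-1` G : set (borel S)).
  move=> mG; have := @borel_continuous S S setT f openT (fun p _ => @affine_continuous _ _ _ _ _ _ Hf p).
  by move=> /(_ (@measurableT _ (borel S)) _ mG); rewrite setTI.
have leV G : measurable (G : set (borel S)) ->
    (mu (V `&` f @^-1` G) <= mu (cell U w (w q) B rho `&` f @^-1` G))%E.
  move=> mG; apply: le_measure; rewrite ?inE; last exact: setSI.
    by apply: (@measurableI _ (borel S)); [exact: borel_open|exact: mf].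
  by apply: (@measurableI _ (borel S)); [exact: (measurable_cell bU rho dB)|exact: mf].
have [le|le] := cell_alternative bU dB sb mu_area mu_finite rho0 Hf ME D01 D10 D00 dM Dd sep invA mA m1 m2 F1A F2A.
  by left; apply: le_trans (leV _ mA) le.
by right; apply: le_trans (leV _ _) le; exact: (@measurableC _ (borel S)).
Qed.
End renormalization.

Theorem theorem1 (R : realType) (S : ptopologicalType)
    (X : riemann_surface R S) (a : abelian_differential X)
    (a_neq0 : nonzero_form a)
    (mu : {measure set (borel S) -> \bar R})
    (mu_area : is_area_measure a mu)
    (mu_finite : (mu [set: S] < +oo)%E)
    (cross_cuts_null : mu.-negligible (cross_cuts a))
    (K : set (coset_space (veech_group a)))
    (K_compact : compact K)
    (t_ : nat -> R)
    (t_infty : t_ n @[n --> \oo] --> +oo)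
    (recurrence : forall n, K (coset_class (veech_group a) (teichmuller (t_ n)))) :
  flow_ergodic a mu.
Proof.
move=> A mA invA.
have [N HN] := recurrent_lifts mu_area mu_finite K_compact.
pose Lift n (x : (S -> S) * 'M[R]_2 * 'M[R]_2 * 'M[R]_2) :=
  let: (f, M, D, B) := x in [/\ affine_diffeo a M f /\ \det M = 1, M = D *m B,
      [/\ D 0 1 = 0, D 1 0 = 0, D 0 0 != 0 & `|D 1 1| = expR (- t_ n)],
      \det B = 1 & forall i j, `|B i j| < N%:R].
have /choice[x Hx] n : exists x, Lift n x.
  by have [f [M [D [B H]]]] := HN _ (recurrence n); exists (f, M, D, B).
pose f n := (x n).1.1.1.
have mAc : measurable (~` A : set (borel S)) by exact: (@measurableC _ (borel S)).
have Hf n : affine_diffeo a (x n).1.1.2 (f n) /\ \det (x n).1.1.2 = 1.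
  by have := Hx n; rewrite /f /Lift; case: (x n) => [[[? ?] ?] ?] [].
have muf n G : measurable (G : set (borel S)) -> mu (f n @^-1` G) = mu G.
  move=> mG; have [af dM] := Hf n; exact (affine_measure mu_area mu_finite af dM mG).
have mf n G : measurable (G : set (borel S)) -> measurable (f n @^-1` G : set (borel S)).
  move=> mG; have [af _] := Hf n.
  have := @borel_continuous S S setT (f n) openT (fun p _ => @affine_continuous _ _ _ _ _ _ af p).
  by move=> /(_ (@measurableT _ (borel S)) _ mG); rewrite setTI.
have zero (G : set S) : measurable (G : set (borel S)) ->
    (forall e : R, 0 < e -> exists n, (mu (f n @^-1` G) < e%:E)%E) -> mu G = 0%E.
  move=> mG HG; apply/eqP; rewrite -measure_le0; apply/lee_addgt0Pr => e e0.
  by have [n] := HG e e0; rewrite add0e muf // => /ltW.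
have := @vanishing_dichotomy R S X a mu mu_area mu_finite (fun n => f n @^-1` A) (fun n => mf n A mA).
case; first last.
- by move=> H; right; apply: zero.
- by move=> H; left; apply: zero.
move=> q nzq.
have [V [rho [oV Vq rho0 HV]]] := local_alternative mu_area mu_finite N nzq.
exists V; split => // e e0.
have [F1 [F2 [c1 c2 F1A F2A Fe]]] := compact_approx mu_area mu_finite mA e0.
have F12 : F1 `&` F2 = set0.
  by apply/seteqP; split => // p [/F1A[Ap _] /F2A[]].
have nzF1 : F1 `<=` ~` zeros a by move=> p /F1A[].
have cl2 : closed F2 by apply: compact_closed => //; exact: surface_hausdorff X.
have [d d0 sep] := straight_separation mu_area mu_finite c1 cl2 F12 nzF1.
have : \forall n \near \oo, expR (- t_ n) * (2 * rho) < d.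
  have /cvgryPgt/(_ (2 * rho / d)) := t_infty; apply: filterS => n tn.
  have {}tn : 2 * rho < t_ n * d by rewrite -ltr_pdivrMr.
  rewrite expRN mulrC ltr_pdivrMr ?expR_gt0 // [d * _]mulrC; apply: lt_trans tn _.
  by rewrite ltr_pM2r //; have := expR_ge1Dx (t_ n); lra.
apply: filterS => n tn.
have m1 := compact_borel X c1; have m2 := compact_borel X c2.
have F1A' : F1 `<=` A by move=> p /F1A[].
have F2A' : F2 `<=` ~` A by move=> p /F2A[].
have := Hx n; rewrite /Lift /f; case: (x n) => [[[f' M] D] B] [[af dM] ME [D01 D10 D00 D11] dB BN] /=.
rewrite -D11 in tn.
have [le|le] := HV B dB BN M D f' A F1 F2 d af ME D01 D10 D00 dM tn sep invA mA m1 m2 F1A' F2A'.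
  by left; apply: le_lt_trans le Fe.
by right; apply: le_lt_trans le Fe.
Qed.
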